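(* Let $X_w$ be a singular Schubert variety in $Fl(n,\mathbb{C})$, $w\in\mathbf{S}_n$. If $c_T(X_w) = 1$, then $c_{B_L}(X_w) = 0$. In other words, the singular Schubert varieties of $T$-complexity one are spherical.
   Context: $G=\mathbf{GL}(n,\mathbb{C})$, $B\subset G$ is the Borel subgroup of upper triangular matrices, $T\subset B$ is the torus of diagonal matrices, $Fl(n,\mathbb{C})=G/B$. The symmetric group $\mathbf{S}_n$ is identified with the Weyl group of $G$ (permutation matrices, $w e_i=e_{w(i)}$), and $X_w=\overline{BwB/B}\subseteq G/B$. For a torus or a Borel group $H$ acting on $X$, $c_H(X)$ is the transcendence degree over $\mathbb{C}$ of the field $\mathbb{C}(X)^H$ of $H$-invariant rational functions (equivalently, the minimum codimension of an $H$-orbit in $X$). $L$ is the standard Levi subgroup (the one containing $T$) of the stabilizer of $X_w$ in $G$, and $B_L\subseteq L$ is a Borel subgroup of $L$ containing $T$. $X_w$ is spherical if $B_L$ has only finitely many orbits in $X_w$ (equivalently, $c_{B_L}(X_w)=0$). *)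

(* Defs.v *)
From HB Require Import structures.
(* Without its notations, which clash with those of the topology library. *)
From mathcomp Require Import -(notations) mpoly.
From mathcomp Require Import all_boot all_order all_algebra all_fingroup.
From mathcomp Require Import generic_quotient all_classical topology.

Set Implicit Arguments.
Unset Strict Implicit.
Unset Printing Implicit Defensive.

Import GRing.Theory.

Local Open Scope quotient_scope.
Local Open Scope classical_set_scope.
Local Open Scope ring_scope.

(* Varieties over an algebraically closed field K are handled as spaces with
   functions: a topological space X with, at each point x, the set [reg x] of
   the K-valued functions that are regular near x (only the germ at x of such
   a function matters).  A closed subvariety is a subset Y of X with the
   induced regular functions. *)
Section Subvariety.
Variables (K : fieldType) (X : topologicalType) (reg : X -> set (X -> K)).
Variable Y : set X.

Definition regular_at (x : X) (f : X -> K) : Prop :=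
  exists2 F, reg x F & \forall y \near x, Y y -> f y = F y.

(* Rational functions on Y, represented by a regular function on a nonempty
   open subset of Y; values outside [dom] (or outside Y) are irrelevant.
   Equality in the function field K(Y) is agreement on the common domain. *)
Record ratfun := RatFun {
  dom : set X;
  ratval : X -> K;
  dom_open : open dom;
  dom_neq0 : Y `&` dom !=set0;
  ratval_regular : forall x, Y x -> dom x -> regular_at x ratval }.

Definition alg_independent (k : nat) (f : 'I_k -> ratfun) : Prop :=
  forall p : mpoly k K,
    (forall x, Y x -> (forall i, dom (f i) x) ->
       meval (fun i => ratval (f i) x) p = 0) ->
    p = 0.

Definition trdeg_is (F : set ratfun) (k : nat) : Prop :=
  (exists2 f : 'I_k -> ratfun, (forall i, F (f i)) & alg_independent f) /\
  (forall m (f : 'I_m -> ratfun),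
     (forall i, F (f i)) -> alg_independent f -> (m <= k)%N).

(* Dimension of an irreducible Y: transcendence degree of K(Y) over K. *)
Definition dim_is (d : nat) : Prop := trdeg_is setT d.

Definition max_ideal (x : X) : set (X -> K) :=
  [set f | regular_at x f /\ f x = 0].

Definition max_ideal2 (x : X) : set (X -> K) :=
  [set f | exists r (g h : 'I_r -> X -> K),
    [/\ forall j, max_ideal x (g j), forall j, max_ideal x (h j) &
        \forall y \near x, Y y -> f y = \sum_(j < r) g j y * h j y]].

(* dim_K (m / m^2) = e, m the maximal ideal of the local ring of Y at x. *)
Definition cotangent_dim_is (x : X) (e : nat) : Prop :=
  exists2 t : 'I_e -> X -> K, (forall i, max_ideal x (t i)) &
  forall f, max_ideal x f ->
    exists! c : 'rV[K]_e,
      max_ideal2 x (fun y => f y - \sum_(i < e) c 0 i * t i y).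

Definition singular : Prop :=
  exists x d e, [/\ Y x, dim_is d, cotangent_dim_is x e & (d < e)%N].

End Subvariety.

Section GroupAction.
Variables (K : fieldType) (X : topologicalType) (reg : X -> set (X -> K)).
Variables (G : groupType) (act : G -> X -> X).

Definition invariant_ratfun (H : set G) (Y : set X) : set (ratfun reg Y) :=
  [set f | forall h x, H h -> Y x -> dom f x -> dom f (act h x) ->
     ratval f (act h x) = ratval f x].

Definition complexity_is (H : set G) (Y : set X) (c : nat) : Prop :=
  trdeg_is (@invariant_ratfun H Y) c.

Definition finitely_many_orbits (H : set G) (Y : set X) : Prop :=
  finite_set [set O | exists2 x, Y x & O = [set act h x | h in H]].

Definition stabilizer (Y : set X) : set G := [set g | act g @` Y = Y].

End GroupAction.
Arguments invariant_ratfun {K X} reg {G} act H Y _.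

Section AbstractGroup.
Variable G : groupType.
Local Open Scope group_scope.

Definition is_subgroup (H : set G) : Prop :=
  H 1 /\ (forall x y, H x -> H y -> H (x * y^-1)).

Definition generated (A : set G) : set G :=
  [set g | forall H, is_subgroup H -> A `<=` H -> H g].

Definition derived_subgroup (H : set G) : set G :=
  generated [set [~ x, y] | x in H & y in H].

Definition is_solvable (H : set G) : Prop :=
  exists k, iter k derived_subgroup H = [set 1].

Definition normalizes (P U : set G) : Prop :=
  forall g u, P g -> U u -> U (u ^ g).

End AbstractGroup.

Section GeneralLinear.
Variables (K : fieldType) (n : nat).

Record GL := MkGL { glmx :> 'M[K]_n; glmxP : glmx \in unitmx }.

HB.instance Definition _ := [isSub for glmx].
HB.instance Definition _ := [Choice of GL by <:].

Fact gl1_subproof : (1%:M : 'M[K]_n) \in unitmx.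
Proof. exact: unitmx1. Qed.
Fact glV_subproof (g : GL) : invmx g \in unitmx.
Proof. by rewrite unitmx_inv glmxP. Qed.
Fact glM_subproof (g h : GL) : (g *m h : 'M_n) \in unitmx.
Proof. by rewrite unitmx_mul !glmxP. Qed.

Definition gl1 := MkGL gl1_subproof.
Definition glV g := MkGL (glV_subproof g).
Definition glM g h := MkGL (glM_subproof g h).

Fact glMA : associative glM.
Proof. by move=> x y z; apply/val_inj/mulmxA. Qed.
Fact gl1M : left_id gl1 glM.
Proof. by move=> x; apply/val_inj/mul1mx. Qed.
Fact glM1 : right_id gl1 glM.
Proof. by move=> x; apply/val_inj/mulmx1. Qed.
Fact glVM : left_inverse gl1 glV glM.
Proof. by move=> x; apply/val_inj/mulVmx/glmxP. Qed.
Fact glMV : right_inverse gl1 glV glM.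
Proof. by move=> x; apply/val_inj/mulmxV/glmxP. Qed.

HB.instance Definition _ := isGroup.Build GL glMA gl1M glM1 glVM glMV.

(* Polynomials in the n^2 matrix entries. *)
Definition gl_eval (p : mpoly (n * n) K) (g : GL) : K :=
  meval (fun k => mxvec g 0 k) p.

(* Zariski topology: the opens are the unions of the sets {p <> 0}. *)
Definition zariski_open (U : set GL) : Prop :=
  forall g, U g -> exists2 p, gl_eval p g != 0 &
    [set h | gl_eval p h != 0] `<=` U.

Fact zariski_openT : zariski_open setT.
Proof. by move=> g _; exists 1 => //; rewrite /gl_eval meval1 oner_eq0. Qed.
Fact zariski_openI : setI_closed zariski_open.
Proof.
move=> U V oU oV g [/oU [p pg pU] /oV [q qg qV]].
have E h : gl_eval (p * q) h = gl_eval p h * gl_eval q h.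
  by rewrite /gl_eval mevalM.
exists (p * q); first by rewrite E mulf_neq0.
by move=> h /=; rewrite E mulf_eq0 negb_or => /andP[ph qh]; split; auto.
Qed.
Fact zariski_open_bigcup (I : Type) (f : I -> set GL) :
  (forall i, zariski_open (f i)) -> zariski_open (\bigcup_i f i).
Proof.
move=> of_ g [i _ /of_ [p pg pf]]; exists p => // h /pf fh.
by exists i.
Qed.

HB.instance Definition _ := isOpenTopological.Build GL
  zariski_openT zariski_openI zariski_open_bigcup.

Definition gl_regular (g : GL) : set (GL -> K) :=
  [set f | exists p q, \forall h \near g,
    gl_eval q h != 0 /\ f h = gl_eval p h / gl_eval q h].

Local Open Scope group_scope.

Definition torus : set GL := [set t | is_diag_mx (glmx t)].

(* [is_trig_mx] means lower triangular. *)
Definition upper_borel : set GL := [set b | is_trig_mx (glmx b)^T].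

Definition is_unipotent (H : set GL) : Prop :=
  forall u, H u -> exists k, ((glmx u - 1) ^+ k = 0)%R.

Definition conn_closed_subgroup (H : set GL) : Prop :=
  [/\ is_subgroup H, closed H & connected H].

Definition conn_normal_unipotent (P U : set GL) : Prop :=
  [/\ conn_closed_subgroup U, U `<=` P, normalizes P U & is_unipotent U].

Definition is_unipotent_radical (P U : set GL) : Prop :=
  conn_normal_unipotent P U /\
  (forall V, conn_normal_unipotent P V -> V `<=` U).

(* Levi decomposition P = L |>< R_u(P). *)
Definition is_levi_subgroup (P L : set GL) : Prop :=
  [/\ is_subgroup L, closed L, L `<=` P &
  exists U, [/\ is_unipotent_radical P U, L `&` U = [set 1] &
                [set l * u | l in L & u in U] = P]].

Definition conn_solvable (L H : set GL) : Prop :=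
  [/\ conn_closed_subgroup H, H `<=` L & is_solvable H].

Definition is_borel_subgroup (L H : set GL) : Prop :=
  conn_solvable L H /\
  (forall H', conn_solvable L H' -> H `<=` H' -> H' = H).

Definition coset_upper_borel (g : GL) : set GL :=
  [set g * b | b in upper_borel].

Definition same_coset (g h : GL) : bool :=
  `[< coset_upper_borel g = coset_upper_borel h >].

Fact same_coset_refl : reflexive same_coset.
Proof. by move=> g; apply/asboolP. Qed.
Fact same_coset_sym : symmetric same_coset.
Proof. by move=> g h; apply/asboolP/asboolP => ->. Qed.
Fact same_coset_trans : transitive same_coset.
Proof. by move=> h g k /asboolP gh /asboolP hk; apply/asboolP; rewrite gh. Qed.

Canonical same_coset_equiv :=
  EquivRel same_coset same_coset_refl same_coset_sym same_coset_trans.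

(* Fl(n) = G/B with the quotient topology. *)
Definition Fl := quotient_topology {eq_quot same_coset_equiv}.

Definition flag_of (g : GL) : Fl := \pi_{eq_quot same_coset_equiv} g.

(* Functions regular near x on the quotient variety G/B. *)
Definition flag_regular (x : Fl) : set (Fl -> K) :=
  [set f : Fl -> K | \forall y \near x, forall g, flag_of g = y ->
     gl_regular g (f \o flag_of)].

Definition flag_act (g : GL) (x : Fl) : Fl :=
  flag_of (g * repr (x : {eq_quot same_coset_equiv})).

Lemma flag_ofP (g h : GL) :
  flag_of g = flag_of h <-> coset_upper_borel g = coset_upper_borel h.
Proof. by split=> [/eqmodP/asboolP//|gh]; apply/eqmodP/asboolP. Qed.

Lemma flag_actE (g h : GL) : flag_act g (flag_of h) = flag_of (g * h).
Proof.
have cosetM a : coset_upper_borel (g * a) =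
      [set g * x | x in coset_upper_borel a].
  apply/seteqP; split=> [_ [b Bb <-]|_ [_ [b Bb <-] <-]].
    by exists (a * b); [exists b|rewrite mulgA].
  by exists b => //; rewrite mulgA.
apply/flag_ofP; rewrite !cosetM; congr (image _ _); apply/flag_ofP.
exact: reprK.
Qed.

(* w e_i = e_(w i), acting on column vectors. *)
Fact permutation_unitmx (w : 'S_n) :
  (\matrix_(i < n, j < n) (i == w j)%:R : 'M[K]_n)%R \in unitmx.
Proof.
rewrite (_ : (\matrix_(i, j) _)%R = (perm_mx w)^T) ?unitmx_tr ?unitmx_perm //.
by apply/matrixP => i j; rewrite !mxE eq_sym.
Qed.

Definition weyl (w : 'S_n) : GL := MkGL (permutation_unitmx w).

Definition schubert (w : 'S_n) : set Fl :=
  closure [set flag_act b (flag_of (weyl w)) | b in upper_borel].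

End GeneralLinear.

Arguments torus {K n} _.
Arguments flag_regular {K n} x _.
Arguments flag_act {K n} g x.
Arguments schubert K {n} w _.

(* Main.v *)
(* The inversion graph of w has an edge for each inversion, and T acts on the open cell
   BwB/B, whose coordinates are indexed by the edges, with weight t_b / t_a on the edge
   (a, b).  A cycle of the graph thus gives a T-invariant monomial, so T-complexity one
   leaves at most one triangle (pattern 321) or 4-cycle (such as a pattern 3412).

   If there is no 4-cycle, X_w is smooth: every point can be moved by B into the opposite
   big cell, and there the equations F_i <= E_(j-1) and E_i <= F_(j-1) satisfied by X_w
   express all the coordinates as polynomials in those indexed by the (i, j) whose
   transposition is below w; there are at most l(w) <= dim X_w of these.

   Otherwise the unique 4-cycle is a pattern 3412, its values 2 and 3 are consecutive
   integers k and k + 1, and s_k stabilizes X_w.  Each v with vB in X_w satisfies the closed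
   conditions satisfied by w, from which v or s_k v has an acyclic inversion graph; T
   scales the coordinates of its cell to 0 and 1.  Hence T together with one of the root
   groups U_(+-alpha_k) has finitely many orbits in X_w.

   Finally B_L contains such a root group.  In the Levi decomposition x = l u of an element
   of U_alpha, u commutes with the kernel of alpha and lies in a normal unipotent subgroup,
   which forces u = 1; so U_alpha is in L.  A connected solvable group containing T is
   triangular for some ordering of the basis; by maximality B_L is the group of all elements
   of L triangular for that ordering, and thus contains U_alpha or U_(-alpha). *)
Require Import Defs.
From mathcomp Require Import -(notations) mpoly.
From mathcomp Require Import all_boot all_order all_algebra all_fingroup.
From mathcomp Require Import generic_quotient all_classical reals topology.
From mathcomp Require Import complex.
From mathcomp Require Import zify ring.

(** * Cycles of the inversion graph *)

(** Genericity is always tested on polynomial curves: a polynomial in one parameter that is nonzero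
    at one value is nonzero at all but finitely many, and over an algebraically closed field
    finitely many such conditions hold at a common value. Closures, connectedness, algebraic
    independence (by Kronecker substitution) and the absence of cancellation in products of matrices
    all reduce to this. Cycles come from counting the crossings of a cut of positions and values:
    two crossings one way force two the other way, hence a cycle. With a single 4-cycle only the cut
    between [k] and [k + 1] can be crossed twice, and putting these two values in increasing order
    removes the second crossing. That a connected solvable group containing T is triangular is
    proved on supports of matrices. A generic element has a transitive support, and two indices
    related both ways would give a 2 x 2 block without zeros that survives all iterated commutators,
    against solvability. *)

Section InversionGraph.
Set Implicit Arguments.
Unset Strict Implicit.
Unset Printing Implicit Defensive.

Section Comb.
Variables (n : nat).
Implicit Types (w : 'S_n).

(* Cycles of the inversion graph: a triangle (pattern 321) if [b = c], and otherwise a 4-cycle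
   with sides {a, b} and {c, d}; the pattern 3412 has only a 4-cycle. *)
Definition cyc w (a b c d : 'I_n) :=
  [&& a < b, b <= c, c < d, w c < w a, w d < w a, w d < w b &
      (b == c :> nat) || (w c < w b)].

Definition cut w (p q : nat) := [set a : 'I_n | (a < q) && (p <= w a)].
Definition cocut w (p q : nat) := [set b : 'I_n | (q <= b) && (w b < p)].

Lemma card_ord_lt (q : nat) : q <= n -> #|[set a : 'I_n | a < q]| = q.
Proof.
move=> qn; have winj : injective (widen_ord qn) by move=> x y [] /ord_inj.
rewrite -[RHS]card_ord -(card_imset predT winj); apply: eq_card => a.
rewrite inE; apply/idP/imsetP => [aq|[b _ ->]]; last exact: (ltn_ord b).
by exists (Ordinal aq) => //; apply: ord_inj.
Qed.

(** The positions before [q] with values below [p] complete [cut] to [q] positions and [cocut] to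
    [p] values. *)
Lemma card_cut w p q : p <= n -> q <= n -> #|cocut w p q| + q = #|cut w p q| + p.
Proof.
move=> pn qn.
have e1 : #|cut w p q| + #|[set a : 'I_n | (a < q) && (w a < p)]| = q.
  rewrite -[RHS](card_ord_lt qn) -cardsUI -[RHS]addn0.
  congr (_ + _); last first.
    by apply/eqP; rewrite cards_eq0; apply/eqP/setP => a; rewrite !inE; lia.
  by apply: eq_card => a; rewrite !inE; lia.
have e2 : #|cocut w p q| + #|[set a : 'I_n | (a < q) && (w a < p)]| = p.
  rewrite -[RHS](card_ord_lt pn) -[in RHS](card_preimset _ (@perm_inj _ w)).
  rewrite -cardsUI -[RHS]addn0.
  congr (_ + _); last first.
    by apply/eqP; rewrite cards_eq0; apply/eqP/setP => a; rewrite !inE; lia.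
  by apply: eq_card => a; rewrite !inE; lia.
lia.
Qed.

Lemma perm_ninj w (a b : 'I_n) : (w a : nat) = w b -> (a : nat) = b.
Proof. by move=> /ord_inj /perm_inj ->. Qed.

Lemma perm_nE w (a b : 'I_n) : (w a = w b :> nat) <-> (a = b :> nat).
Proof. by split=> [|/ord_inj ->//]; exact: perm_ninj. Qed.


(** By [card_cut] at [p = q = i], as many elements cross the cut downwards as upwards. Two of each
    kind form four inversions, hence a cycle. *)
Lemma cut2_cyc w (i : nat) (a a' : 'I_n) :
  a < a' -> a' < i -> i <= w a -> i <= w a' ->
  exists b b' : 'I_n, [/\ cyc w a a' b b', i <= b, w b < i & w b' < i].
Proof.
move=> aa' a'i wa wa'.
have i_le : i <= n by have := ltn_ord (w a); lia.
have := card_cut w i_le i_le.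
have: 1 < #|cut w i i|.
  apply/card_gt1P; exists a, a'; rewrite !inE; split; first lia; first lia.
  by apply: contraTneq aa' => ->; rewrite ltnn.
move=> c1 c2; have /card_gt1P[b [b' []]] : 1 < #|cocut w i i| by lia.
rewrite !inE => Hb Hb' bb'.
have {}bb' : b != b' :> nat by [].
by case: (ltnP b b') => h; [exists b, b' | exists b', b]; split; rewrite /cyc; lia.
Qed.

Lemma cocut2_cyc w (i : nat) (b b' : 'I_n) :
  b < b' -> i <= b -> w b < i -> w b' < i ->
  exists a a' : 'I_n, [/\ cyc w a a' b b', a' < i, i <= w a & i <= w a'].
Proof.
move=> bb' ib wb wb'.
have i_le : i <= n by have := ltn_ord b; lia.
have := card_cut w i_le i_le.
have: 1 < #|cocut w i i|.
  apply/card_gt1P; exists b, b'; rewrite !inE; split; first lia; first lia.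
  by apply: contraTneq bb' => ->; rewrite ltnn.
move=> c1 c2; have /card_gt1P[a [a' []]] : 1 < #|cut w i i| by lia.
rewrite !inE => Ha Ha' aa'.
have {}aa' : a != a' :> nat by [].
by case: (ltnP a a') => h; [exists a, a' | exists a', a]; split; rewrite /cyc; lia.
Qed.

Definition uniq_cyc w := forall a b c d a' b' c' d',
  cyc w a b c d -> cyc w a' b' c' d' -> [/\ a = a', b = b', c = c' & d = d'].

(* The [(i, j)] such that the transposition of [i] and [j] is below [w] in the Bruhat order. *)
Definition tangent_pairs w : {set 'I_n * 'I_n} :=
  [set p : 'I_n * 'I_n | [&& p.1 < p.2, [exists a : 'I_n, (a <= p.1) && (p.2 <= w a)] &
               [exists b : 'I_n, (p.2 <= b) && (w b <= p.1)]]].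

Definition inversions w : {set 'I_n * 'I_n} :=
  [set p : 'I_n * 'I_n | (p.1 < p.2) && (w p.2 < w p.1)].

Section Smooth.
Variable w : 'S_n.
Hypothesis w_uniq : uniq_cyc w.
Hypothesis w_noK : forall a b c d, cyc w a b c d -> b = c :> nat.

Let cut1 (i : nat) (a a' : 'I_n) :
  a < i -> a' < i -> i <= w a -> i <= w a' -> a = a' :> nat.
Proof.
move=> h1 h2 h3 h4; case: (ltngtP a a') => // h.
  by have [b [b' [/w_noK]]] := cut2_cyc h h2 h3 h4; lia.
by have [b [b' [/w_noK]]] := cut2_cyc h h1 h4 h3; lia.
Qed.

Let cocut1 (i : nat) (a a' : 'I_n) :
  i <= a -> i <= a' -> w a < i -> w a' < i -> a = a' :> nat.
Proof.
move=> h1 h2 h3 h4; case: (ltngtP a a') => // h.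
  by have [b [b' [/w_noK]]] := cocut2_cyc h h1 h3 h4; lia.
by have [b [b' [/w_noK]]] := cocut2_cyc h h2 h4 h3; lia.
Qed.

Definition mid (m : nat) :=
  [exists a : 'I_n, [exists c : 'I_n, [exists b : 'I_n,
     (b == m :> nat) && cyc w a b b c]]].

Lemma midP (m a b : 'I_n) : a < m -> m < b -> w b < w m -> w m < w a -> mid m.
Proof.
move=> *; apply/existsP; exists a; apply/existsP; exists b; apply/existsP; exists m.
rewrite /cyc; lia.
Qed.

Let mid_uniq (m m' : nat) : mid m -> mid m' -> m = m'.
Proof.
move=> /existsP[a /existsP[c /existsP[b /andP[/eqP <- h]]]].
move=> /existsP[a' /existsP[c' /existsP[b' /andP[/eqP <- h']]]].
by have [_ -> _ _] := w_uniq h h'.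
Qed.

Let mid_fix (m : 'I_n) : mid m -> w m = m :> nat.
Proof.
move=> /existsP[a /existsP[c /existsP[b /andP[/eqP /ord_inj-> h]]]].
case: (ltngtP (w m) m) => // hm; rewrite /cyc in h.
  by have := @cocut1 m m c; lia.
by have := @cut1 m.+1 m a; lia.
Qed.

(** Each cut is crossed once each way. The crossings being taken by [a] and [b], [w m] lies strictly
    between [w b] and [w a], so [a], [m], [b] is a triangle. *)
Let between (i j m a b : 'I_n) : a <= i -> j <= w a -> j <= b -> w b <= i ->
  i < m -> m < j -> mid m.
Proof.
move=> h1 h2 h3 h4 h5 h6; apply: (@midP m a b); try lia.
  have := @cocut1 i.+1 m b; have := @perm_ninj w m b; lia.
have := @cut1 m.+1 m a; have := @perm_ninj w m a; lia.
Qed.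

Definition tp_wit (p : 'I_n * 'I_n) (q : 'I_n * 'I_n) :=
  [&& q.1 <= p.1, p.2 <= w q.1, p.2 <= q.2 & w q.2 <= p.1].
(* [w] exchanges two sides of the cut after [p.1] by at most one inversion [q], but two cuts may
   give the same inversion, the long side of a triangle; its short sides are then used for the
   two cuts around the middle vertex. *)
Definition tp_inv (p : 'I_n * 'I_n) : 'I_n * 'I_n :=
  let q := odflt p [pick q | tp_wit p q] in
  if mid p.1 && (p.2 == p.1.+1 :> nat) then (p.1, q.2) else
  if mid p.2 && (p.2 == p.1.+1 :> nat) then (q.1, p.2) else q.

(** [tp_inv] injects the pairs into the inversions. By [between], an index strictly inside a pair is
    the middle of the only triangle, so a pair has length 1, or length 2 around that middle. *)
Lemma card_tangent_pairs : #|tangent_pairs w| <= #|inversions w|.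
Proof.
have tpP p : p \in tangent_pairs w -> exists q,
    [/\ tp_wit p q, p.1 < p.2, (p.2 = p.1.+1 :> nat) \/ (p.2 = p.1.+2 :> nat /\ mid p.1.+1)
     & tp_inv p =
    if mid p.1 && (p.2 == p.1.+1 :> nat) then (p.1, q.2) else
    if mid p.2 && (p.2 == p.1.+1 :> nat) then (q.1, p.2) else q].
  case: p => i j; rewrite inE /= => /and3P[p12 /existsP[a /andP[ha1 ha2]] /existsP[b /andP[hb1 hb2]]].
  have hq : tp_wit (i,j) (a, b) by rewrite /tp_wit /= ha1 ha2 hb1.
  rewrite /tp_inv; case: pickP => [q /= hq'|/(_ (a, b))]; last by rewrite hq.
  exists q; split => //.
  have [h|h] := leqP j i.+1; first by left; lia.
  right; have m1n : i.+1 < n by have := ltn_ord j; lia.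
  have m1 : mid i.+1 by apply: (@between i j (Ordinal m1n) a b).
  split=> //; have [//|h'] := leqP j i.+2; first lia.
  have m2n : i.+2 < n by have := ltn_ord j; lia.
  have m2 : mid i.+2 by apply: (@between i j (Ordinal m2n) a b) => //=; lia.
  by have := mid_uniq m1 m2; lia.
rewrite -(@card_in_imset _ _ tp_inv).
  apply/subset_leq_card/fintype.subsetP => _ /imsetP[[i j] /tpP[[a b] [+ + _ ->]] ->].
  rewrite /tp_wit /= => wit p12.
  case: ifP => [/andP[/mid_fix mp _]|_].
    by rewrite inE /=; have := @perm_ninj w i b; lia.
  case: ifP => [/andP[/mid_fix mp _]|_].
    by rewrite inE /=; have := @perm_ninj w a j; lia.
  by rewrite inE /=; lia.
move=> [i j] [i' j'] /tpP[[a b] [wit ij dj e1]] /tpP[[a' b'] [wit' ij' dj' e2]] e.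
rewrite {}e1 {}e2 /= in e; move: wit ij dj wit' ij' dj' e.
rewrite /tp_wit /= => wit ij dj wit' ij' dj' e.
(* For two pairs with the same witness: if the first indices satisfy [i1 < i2], the witness also
   covers [(i1, j2)], which has [i2] in its interior. *)
have zz (i1 i2 j2 a1 b1 : 'I_n) : i1 < i2 -> i2 < j2 -> a1 <= i1 ->
    j2 <= w a1 -> j2 <= b1 -> w b1 <= i1 -> i2 = i1.+1 :> nat /\ mid i2.
  move=> h1 h2 h3 h4 h5 h6.
  have m1n : i1.+1 < n by have := ltn_ord b1; lia.
  have m1 : mid i1.+1 by apply: (@between i1 j2 (Ordinal m1n) a1 b1) => //=; lia.
  have [h|h] := leqP i2 i1.+1.
    by have -> : (i2 = i1.+1 :> nat) by lia.
  have m2n : i1.+2 < n by have := ltn_ord b1; lia.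
  have m2 : mid i1.+2 by apply: (@between i1 j2 (Ordinal m2n) a1 b1) => //=; lia.
  by have := mid_uniq m1 m2; lia.
have zza := @zz i i' j' a' b'; have zzb := @zz i' i j a b.
have mu (m m' : nat) : mid m /\ mid m' -> m = m' by case; exact: mid_uniq.
have mii := mu i i'; have mij := mu i j; have mi'j' := mu i' j'; have mjj := mu j j'.
have mij1 := mu i i'.+1; have mij2 := mu i' i.+1.
have mij3 := mu j i'.+1; have mij4 := mu j' i.+1.
have mij5 := mu i i.+1; have mij6 := mu i' i'.+1.
have mfi := @mid_fix i; have mfj := @mid_fix j.
have mfi' := @mid_fix i'; have mfj' := @mid_fix j'.
have R : (i = i' :> nat) /\ (j = j' :> nat) -> (i, j) = (i', j').
  by move=> [/ord_inj -> /ord_inj ->].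
apply: R.
have jm : (j = i.+1 :> nat) -> mid j = mid i.+1 by move=> ->.
have jm' : (j' = i'.+1 :> nat) -> mid j' = mid i'.+1 by move=> ->.
have im : (i' = i.+1 :> nat) -> mid i' = mid i.+1 by move=> ->.
have im' : (i = i'.+1 :> nat) -> mid i = mid i'.+1 by move=> ->.
have iim : (i = i' :> nat) -> mid i.+1 = mid i'.+1 by move=> ->.
have iim' : (i = i' :> nat) -> mid i = mid i' by move=> ->.
move: e; do 2 (case: ifP => ?; [|case: ifP => ?]); case=> e1 e2; subst; clear tpP zz mu; lia.
Qed.
End Smooth.

(* If the 4-cycle of [w] is a pattern 3412 whose values 2 and 3 are [k] and [k + 1], these are
   conditions satisfied by [w] and closed under going down in the Bruhat order. *)
Definition K22_bounds w (k : nat) : Prop :=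
  [/\ forall (i : nat) (a a' : 'I_n), i <> k.+1 ->
        a < a' -> a' < i -> i <= w a -> i <= w a' -> False,
      forall i : nat, i <> k -> i <> k.+1 ->
        (forall a : 'I_n, a < i -> w a <= i) \/ (forall b : 'I_n, i < b -> i <= w b),
      forall a : 'I_n, a < k -> w a < k.+2
    & forall b : 'I_n, k.+2 <= b -> k <= w b].

(** Uniqueness does all the work: a position or a value in a wrong place could replace a vertex of
    the 4-cycle or form a triangle, giving a second cycle. *)
Lemma K22_boundsP w a b c d : uniq_cyc w -> cyc w a b c d -> b < c ->
  w a = (w d).+1 :> nat /\ K22_bounds w (w d).
Proof.
move=> uq h bc.
have uqn a1 b1 c1 d1 : cyc w a1 b1 c1 d1 ->
    (a = a1 :> nat) /\ (b = b1 :> nat) /\ (c = c1 :> nat) /\ (d = d1 :> nat).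
  by move=> h'; have [-> -> -> ->] := uq _ _ _ _ _ _ _ _ h h'.
have tri x y z : cyc w x y y z -> False by move/uqn; lia.
have inj := @perm_nE w.
have h' := h; rewrite /cyc in h.
have ab : w a < w b.
  have := tri a b d; have := inj a b; rewrite /cyc; lia.
have cd : w c < w d.
  have := tri a c d; have := inj c d; rewrite /cyc; lia.
have ad : w a = (w d).+1 :> nat.
  have [//|lt] : w a = (w d).+1 :> nat \/ (w d).+1 < w a by lia.
  have mn : (w d).+1 < n by have := ltn_ord (w a); lia.
  (* The position of a value strictly between those of [d] and [a]: left of [b] it could replace
     [a], right of [c] it could replace [d], and between them it is the middle of a triangle. *)
  pose p := (w^-1%g (Ordinal mn)).
  have wp : w p = (w d).+1 :> nat by rewrite /p permKV.
  have i1 := inj p a; have i2 := inj p d.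
  have u1 := uqn p b c d; have u2 := tri a p d; have u3 := uqn a b c p.
  rewrite /cyc in u1 u2 u3; lia.
have cb : c = b.+1 :> nat.
  have [//|lt] : c = b.+1 :> nat \/ b.+1 < c by lia.
  have mn : b.+1 < n by have := ltn_ord c; lia.
  have [p pE] : exists p : 'I_n, p = b.+1 :> nat by exists (Ordinal mn).
  have i1 := inj p b; have i2 := inj p c.
  have u1 := uqn a p c d; have u2 := tri b p c; have u3 := uqn a b p d.
  rewrite /cyc in u1 u2 u3; lia.
have bd : b = w d :> nat.
  have l1 := ltn_ord b; have l2 := ltn_ord (w d).
  (* The cut after position [b] and value [w d] is crossed exactly by [a], [b] one way and [c], [d]
     the other, which forces [b = w d]. *)
  have := card_cut w l2 l1.
  rewrite (_ : cut _ _ _ = [set a; b]); last first.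
    apply/setP => p; rewrite !inE -!val_eqE /=.
    have u1 := uqn p a c d; have u2 := uqn a p c d.
    have i1 := inj p a; have i2 := inj p b.
    rewrite /cyc in u1 u2; lia.
  rewrite (_ : cocut _ _ _ = [set c; d]); last first.
    apply/setP => q; rewrite !inE -!val_eqE /=.
    have u1 := uqn a b c q; have i1 := inj q c; have i2 := inj q d.
    rewrite /cyc in u1; lia.
  by rewrite !cards2 -!val_eqE /=; lia.
have F1 (i : nat) (x y : 'I_n) : i <> (w d).+1 ->
    x < y -> y < i -> i <= w x -> i <= w y -> False.
  move=> ik h1 h2 h3 h4; have [b1 [b2 [/uqn]]] := cut2_cyc h1 h2 h3 h4; lia.
have F1' (i : nat) (x y : 'I_n) : i <> (w d).+1 ->
    x < y -> i <= x -> w x < i -> w y < i -> False.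
  move=> ik h1 h2 h3 h4; have [b1 [b2 [/uqn]]] := cocut2_cyc h1 h2 h3 h4; lia.
split=> //; split=> //.
- move=> i i1 i2.
  case: (boolP [forall x : 'I_n, (x < i) ==> (w x <= i)]) => [/forallP H|].
    by left => x xi; have := H x; rewrite xi.
  rewrite negb_forall => /existsP[p Hp]; right => q iq.
  rewrite leqNgt; apply/negP => wq.
  have ln : i < n by have := ltn_ord q; lia.
  have [m mE] : exists m : 'I_n, m = i :> nat by exists (Ordinal ln).
  have := tri p m q; have := F1 i.+1 p m; have := F1' i m q.
  have := inj m p; have := inj m q.
  rewrite /cyc; lia.
- move=> x xk; have := uqn x a c d; have := uqn a x c d.
  have := inj x a.
  rewrite /cyc; lia.
- move=> q qk; have := uqn a b c q; have := inj q d.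
  rewrite /cyc; lia.
Qed.

(** These are the products of distinct simple transpositions, that is, the permutations avoiding 321
    and 3412; their inversion graph is a forest. *)
Definition boolean_perm w : Prop :=
  (forall (i : nat) (a a' : 'I_n),
     a < a' -> a' < i -> i <= w a -> i <= w a' -> False) /\
  (forall a b c : 'I_n, a < b -> b < c -> w c < w b -> w b < w a -> False).

(* [c] is the shorter of [v] and [tperm x0 x1 o v]. *)
Lemma K22_boundsW (v c : 'S_n) (x0 x1 p0 p1 : 'I_n) :
  K22_bounds v x0 -> x1 = x0.+1 :> nat -> c p0 = x0 -> c p1 = x1 -> p0 < p1 ->
  v = c \/ v = (c * tperm x0 x1)%g -> boolean_perm c.
Proof.
move=> [B1 B2 B3 B4] x01 cp0 cp1 p01 vE.
have inj := @perm_nE c.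
have {}cp0 : c p0 = x0 :> nat by rewrite cp0.
have {}cp1 : c p1 = x1 :> nat by rewrite cp1.
have vc y : v y = c y :> nat \/
   (c y = x0 :> nat /\ v y = x1 :> nat) \/ (c y = x1 :> nat /\ v y = x0 :> nat).
  case: vE => ->; first by left.
  by rewrite permM; case: tpermP => [->|->|]; [right; left|right; right|left].
have C1 (i : nat) (x y : 'I_n) : i <> x0.+1 ->
    x < y -> y < i -> i <= c x -> i <= c y -> False.
  by move=> i0; have := B1 i x y i0; have := vc x; have := vc y; lia.
have C1' (i : nat) (x y : 'I_n) : i <> x0.+1 ->
    x < y -> i <= x -> c x < i -> c y < i -> False.
  move=> ik h1 h2 h3 h4; have [b1 [b2 []]] := cocut2_cyc h1 h2 h3 h4.
  by rewrite /cyc => ? ? ? ?; apply: (C1 i b1 b2); lia.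
have C2 (i : nat) (x y : 'I_n) : x < y -> y < i -> i <= c x -> i <= c y -> False.
  have [->|] := eqVneq i x0.+1; last by move=> h; apply: C1; lia.
  move=> h1 h2 h3 h4; have [b1 [b2 []]] := cut2_cyc h1 h2 h3 h4.
  rewrite /cyc => *.
  (* If [p1] were not one of the two elements crossing the cut after [x0], both would cross the next
     cut as well. Symmetrically [p0] is one of those crossing back, so [p1 <= x0 < p0], against
     [p0 < p1]. *)
  have p1x : p1 <= x0.
    by have := C1 x0.+2 x y; have := inj p1 x; have := inj p1 y; lia.
  have p0b : x0 < p0.
    by have := C1' x0 b1 b2; have := inj p0 b1; have := inj p0 b2; lia.
  lia.
have C2' (i : nat) (x y : 'I_n) : x < y -> i <= x -> c x < i -> c y < i -> False.
  move=> h1 h2 h3 h4; have [b1 [b2 []]] := cocut2_cyc h1 h2 h3 h4.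
  by rewrite /cyc => ? ? ? ?; apply: (C2 i b1 b2); lia.
split=> // x y z xy yz zy yx.
(* The middle of a 321 is a fixed point. The last two bounds exclude the fixed points [x0] and
   [x0 + 1], the second bound all others. *)
have cy : c y = y :> nat by have := C2' y y z; have := C2 y.+1 x y; lia.
have [yk|yk] := eqVneq (y : nat) x0.
  by have := B3 x; have := vc x; have := C2 x0 p0 p1; have := inj x p1; lia.
have [yk1|yk1] := eqVneq (y : nat) x0.+1.
  by have := B4 z; have := vc z; have := C2' x0.+2 p0 p1; have := inj z p0; lia.
have [/(_ x)|/(_ z)] := B2 y (elimN eqP yk) (elimN eqP yk1);
  have := vc x; have := vc z; lia.
Qed.
End Comb.

End InversionGraph.

Section FlagVariety.
Set Implicit Arguments.
Unset Strict Implicit.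
Unset Printing Implicit Defensive.
Import GRing.Theory.
Local Open Scope ring_scope.

(** * Torus equations on an acyclic inversion graph *)

Section Forest.
Variables (K : fieldType) (n : nat).

(* In a set of vertices of the inversion graph, one maximizing [min x (c x)] has at most one
   neighbour. *)
Lemma forest_solve (c : 'S_n) (l : 'I_n -> 'I_n -> K) :
  boolean_perm c -> (forall a b, l a b != 0) ->
  exists2 t : 'I_n -> K, (forall i, t i != 0) &
    forall a b : 'I_n, (a < b)%N -> (c b < c a)%N -> t b = l a b * t a.
Proof.
move=> [C1 C2] l0.
have C1' (i : nat) (x y : 'I_n) :
    (x < y)%N -> (i <= x)%N -> (c x < i)%N -> (c y < i)%N -> False.
  move=> h1 h2 h3 h4; have [b1 [b2 []]] := cocut2_cyc h1 h2 h3 h4.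
  by rewrite /cyc => ? ? ? ?; apply: (C1 i b1 b2); lia.
suff: forall k (S : {set 'I_n}), #|S| = k ->
    exists2 t : 'I_n -> K, (forall i, t i != 0) &
    forall a b : 'I_n, a \in S -> b \in S ->
       (a < b)%N -> (c b < c a)%N -> t b = l a b * t a.
  move=> /(_ _ [set: 'I_n] erefl) [t t0 tP]; exists t => // a b.
  by apply: tP; rewrite !inE.
elim=> [|k IH] S Sk.
  exists (fun=> 1) => [i|a b]; first exact: oner_neq0.
  by rewrite (cards0_eq Sk) inE.
have [x0 x0S] : exists x, x \in S by apply/set0Pn; rewrite -cards_eq0 Sk.
pose m (x : 'I_n) := minn x (c x).
have [x xS xmax] : exists2 x, x \in S & forall y, y \in S -> (m y <= m x)%N.
  by case: (arg_maxnP m x0S) => x xS xm; exists x.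
have [t t0 tP] := IH (S :\ x) ltac:(by move: (cardsD1 x S); rewrite xS Sk => -[]).
pose nb (y : 'I_n) := (y \in S) && (((y < x) && (c x < c y)) || ((x < y) && (c y < c x)))%N.
have nb_uniq y z : nb y -> nb z -> y = z.
  wlog yz : y z / (y < z)%N => [wl|].
    have [h|h|/ord_inj//] := ltngtP y z; first exact: wl.
    by move=> h1 h2; rewrite (wl z y).
  move=> /andP[/xmax my ny] /andP[/xmax mz nz]; exfalso.
  have := perm_nE c x y; have := perm_nE c x z; have := perm_nE c y z.
  have := C2 y x z; have := C1 (c x).+1 y z; have := C1' x.+1 y z.
  rewrite /m in my mz *; lia.
pose v := if [pick y | nb y] is Some y then
   (if (y < x)%N then l y x * t y else (l x y)^-1 * t y) else 1.
exists (fun i => if i == x then v else t i) => [i|a b aS bS ab cab].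
  case: ifP => // _; rewrite /v; case: pickP => [y _|]; last by rewrite oner_neq0.
  by case: ifP => _; rewrite mulf_neq0 ?invr_neq0.
have [ax|ax] := eqVneq a x; have [bx|bx] := eqVneq b x.
- by move: ab; rewrite ax bx ltnn.
- have nbb : nb b by rewrite /nb bS -ax ab cab orbT.
  rewrite /v; case: pickP => [y /nb_uniq/(_ nbb) ->|/(_ b)]; last by rewrite nbb.
  by rewrite -ax ltnNge ltnW //= mulrA mulfV ?mul1r.
- have nba : nb a by rewrite /nb aS -bx ab cab.
  rewrite /v; case: pickP => [y /nb_uniq/(_ nba) ->|/(_ a)]; last by rewrite nba.
  by rewrite -bx ab.
- by apply: tP => //; rewrite !inE ?ax ?bx.
Qed.
End Forest.

(** * Algebras of functions *)

Section FunAlg.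
Variables (K : fieldType) (T : Type).

(** Instances: polynomials in one variable, polynomial functions on [GL], regular germs on [GL] and
    on the flag variety, polynomials in chart coordinates. Matrix products, determinants and
    evaluations are thus treated once. *)
Record fun_alg (C : (T -> K) -> Prop) : Prop := FunAlg {
  fa_cst : forall a, C (fun=> a);
  fa_add : forall f g, C f -> C g -> C (fun x => f x + g x);
  fa_mul : forall f g, C f -> C g -> C (fun x => f x * g x) }.

Variable C : (T -> K) -> Prop.
Hypothesis CA : fun_alg C.

Lemma fa_opp f : C f -> C (fun x => - f x).
Proof.
move=> Cf; rewrite (_ : (fun _ => _) = fun x => -1 * f x).
  by apply: (fa_mul CA) => //; apply: (fa_cst CA).
by apply/funext => x; rewrite mulN1r.
Qed.

Lemma fa_sub f g : C f -> C g -> C (fun x => f x - g x).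
Proof. by move=> Cf Cg; apply: (fa_add CA) => //; apply: fa_opp. Qed.

Lemma fa_sum I (r : seq I) (P : pred I) (F : I -> T -> K) :
  (forall i, P i -> C (F i)) -> C (fun x => \sum_(i <- r | P i) F i x).
Proof.
move=> CF; elim: r => [|i r IH].
  by rewrite (_ : (fun _ => _) = fun=> 0); [apply: (fa_cst CA)|apply/funext => x; rewrite big_nil].
case Pi: (P i); last first.
  by under eq_fun do rewrite big_cons Pi.
by under eq_fun do rewrite big_cons Pi; apply: (fa_add CA) => //; apply: CF.
Qed.

Lemma fa_prod I (r : seq I) (P : pred I) (F : I -> T -> K) :
  (forall i, P i -> C (F i)) -> C (fun x => \prod_(i <- r | P i) F i x).
Proof.
move=> CF; elim: r => [|i r IH].
  by rewrite (_ : (fun _ => _) = fun=> 1); [apply: (fa_cst CA)|apply/funext => x; rewrite big_nil].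
case Pi: (P i); last first.
  by under eq_fun do rewrite big_cons Pi.
by under eq_fun do rewrite big_cons Pi; apply: (fa_mul CA) => //; apply: CF.
Qed.

Lemma fa_exp f k : C f -> C (fun x => f x ^+ k).
Proof.
move=> Cf; elim: k => [|k IH]; first by under eq_fun do rewrite expr0; apply: (fa_cst CA).
by under eq_fun do rewrite exprS; apply: (fa_mul CA).
Qed.

Lemma fa_mulmx m k l (A : T -> 'M[K]_(m, k)) (B : T -> 'M[K]_(k, l)) :
  (forall i j, C (fun x => A x i j)) -> (forall i j, C (fun x => B x i j)) ->
  forall i j, C (fun x => (A x *m B x) i j).
Proof.
move=> CfA CB i j; under eq_fun do rewrite mxE.
by apply: fa_sum => r _; apply: (fa_mul CA).
Qed.

Lemma fa_det m (A : T -> 'M[K]_m) :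
  (forall i j, C (fun x => A x i j)) -> C (fun x => \det (A x)).
Proof.
move=> CfA; rewrite /determinant; apply: fa_sum => s _; apply: (fa_mul CA).
  exact: fa_cst.
by apply: fa_prod.
Qed.

Lemma fa_meval m (F : 'I_m -> T -> K) (p : mpoly m K) :
  (forall i, C (F i)) -> C (fun x => meval (fun i => F i x) p).
Proof.
move=> CF; under eq_fun do rewrite mevalE.
by apply: fa_sum => i _; apply: (fa_mul CA); [apply: (fa_cst CA)|apply: fa_prod => j _; apply: fa_exp].
Qed.
End FunAlg.

(** * Elimination with triangular matrices *)

Section Triangular.
Variables (K : fieldType) (n : nat).
Implicit Types (h : 'I_n -> nat) (A B : 'M[K]_n).

(** Triangular for the ordering of the basis by [h]: upper triangular for the identity, lower
    triangular for [n - i], and a Borel subgroup containing the torus for an arbitrary injective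
    [h]. *)
Definition htri h A := forall i j, (h j < h i)%N -> A i j = 0.

Lemma htri1 h : htri h 1%:M.
Proof.
by move=> i j hij; rewrite mxE; case: eqP => // ij; move: hij; rewrite ij ltnn.
Qed.

Lemma htri_mul h A B : htri h A -> htri h B -> htri h (A *m B).
Proof.
move=> hA hB i j hij; rewrite mxE big1 // => l _.
have [h1|h1] := ltnP (h l) (h i); first by rewrite hA ?mul0r.
by rewrite hB ?mulr0 //; apply: leq_trans hij h1.
Qed.

(** A nonzero term of the Leibniz formula has [h i <= h (s i)] for all [i]. Both sides have the same
    sum over [i], so all are equalities and [s] is the identity. *)
Lemma htri_det h A : injective h -> htri h A -> \det A = \prod_i A i i.
Proof.
move=> hinj hA; rewrite /determinant (bigD1 1%g) //= odd_perm1 expr0 mul1r.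
rewrite [X in _ + X]big1 ?addr0; first by apply: eq_bigr => i _; rewrite perm1.
move=> s s1; have [/forallP P|] := boolP [forall i, A i (s i) != 0]; last first.
  rewrite negb_forall => /existsP[k]; rewrite negbK => /eqP As.
  by rewrite (bigD1 k) //= As mul0r mulr0.
case/eqP: s1; apply/permP => i; rewrite perm1.
have le i' : (h i' <= h (s i') ?= iff (h i' == h (s i')))%N.
  split=> //; rewrite leqNgt; apply/negP => lt; have := P i'.
  by rewrite hA ?eqxx.
have [_] := @leqif_sum _ xpredT _ _ _ (fun i _ => le i).
rewrite [X in X == _](reindex_inj (@perm_inj _ s)) eqxx => /esym/forallP/(_ i) /=.
by move=> /eqP/hinj.
Qed.

Lemma htri_unitE h A : injective h -> htri h A ->
  (A \in unitmx) = [forall i, A i i != 0].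
Proof.
move=> hinj hA; rewrite unitmxE unitfE (htri_det hinj hA) prodf_seq_neq0.
apply/allP/forallP => H i; first by apply: (H i); rewrite mem_index_enum.
by move=> _; apply: H.
Qed.

(** In a column [j] of the inverse with a forbidden nonzero entry, take the nonzero entry with [h i]
    maximal. Then [A i i] times it is the only term left in the entry [(i, j)] of the identity,
    although [i != j]. *)
Lemma htri_inv h A : injective h -> htri h A -> A \in unitmx -> htri h (invmx A).
Proof.
move=> hinj hA uA i0 j hij; apply/eqP/negPn/negP => Bij.
have diag l : A l l != 0 by move: uA; rewrite (htri_unitE hinj hA) => /forallP.
case: (@arg_maxnP _ i0 (fun i => invmx A i j != 0) h Bij) => i Bi imax.
have ij : i != j.
  by apply: contraTneq (imax _ Bij) => ->; rewrite -ltnNge.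
have := mulmxV uA => /matrixP/(_ i j); rewrite !mxE (negbTE ij).
rewrite (bigD1 i) //= big1 ?addr0 => [/eqP|l li].
  by rewrite mulf_eq0 (negbTE (diag i)) (negbTE Bi).
have [->|Bl] := eqVneq (invmx A l j) 0; first by rewrite mulr0.
rewrite hA ?mul0r // ltn_neqAle; apply/andP; split; last exact: imax.
by apply: contraNneq li => /hinj ->.
Qed.

Lemma htri_diagM h A B i : injective h -> htri h A -> htri h B ->
  (A *m B) i i = A i i * B i i.
Proof.
move=> hinj hA hB; rewrite mxE (bigD1 i) //= big1 ?addr0 // => l li.
have [lt|lt|/hinj e] := ltngtP (h l) (h i).
- by rewrite hA ?mul0r.
- by rewrite hB ?mulr0.
- by rewrite e eqxx in li.
Qed.

Definition upper A := htri (@nat_of_ord n) A.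

Lemma unit_col_neq0 A k : A \in unitmx -> exists i, A i k != 0.
Proof.
move=> uA; apply: contrapT => H; have := mulVmx uA => /matrixP/(_ k k).
rewrite !mxE eqxx big1 => [/eqP|i _]; first by rewrite eq_sym oner_eq0.
have [->|h] := eqVneq (A i k) 0; first by rewrite mulr0.
by case: H; exists i.
Qed.

(** Column elimination with pivot [(r, k)]. Only columns from [k] on change, by multiples of column
    [k], so the multiplier is upper triangular. *)
Lemma elim_step A (k r : 'I_n) : A r k != 0 ->
  exists2 b, upper b /\ b \in unitmx & forall i j,
    (A *m b) i j = if j == k then A i k / A r k else
      if (k < j)%N then A i j - A i k * (A r j / A r k) else A i j.
Proof.
move=> Ark; pose b : 'M[K]_n := \matrix_(i, j)
  if i == k then (if j == k then (A r k)^-1 else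
    if (k < j)%N then - (A r j / A r k) else 0) else (i == j)%:R.
have ub : upper b.
  move=> i j; rewrite !mxE; have [->|ik] := eqVneq i k => ij.
    have [e|_] := eqVneq j k; first by rewrite e ltnn in ij.
    by rewrite ltnNge ltnW.
  by case: eqP => // e; rewrite e ltnn in ij.
exists b; first split => //.
  rewrite (htri_unitE (@ord_inj n) ub); apply/forallP => i; rewrite mxE eqxx.
  by case: (i == k); rewrite ?invr_eq0 ?oner_neq0.
move=> i j; rewrite mxE (bigD1 k) //= {1}/b mxE eqxx.
have -> : \sum_(l | l != k) A i l * b l j = if j == k then 0 else A i j.
  have [->|jk] := eqVneq j k.
    by rewrite big1 // => l lk; rewrite mxE (negbTE lk) mulr0.
  rewrite (bigD1 j) //= big1 ?addr0 => [|l /andP[lk lj]].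
    by rewrite mxE (negbTE jk) eqxx mulr1.
  by rewrite mxE (negbTE lk) (negbTE lj) mulr0.
have [_|jk] := eqVneq j k; first by rewrite addr0.
by case: ifP => _; rewrite ?mulrN ?mulr0 ?add0r // addrC.
Qed.

Lemma ord_ltS (j : 'I_n) k (kn : (k < n)%N) :
  (j < k.+1)%N -> (j < k)%N \/ j = Ordinal kn.
Proof.
rewrite ltnS leq_eqVlt => /orP[/eqP e|]; last by left.
by right; apply: ord_inj.
Qed.

Definition perm_mxK (v : 'S_n) : 'M[K]_n := \matrix_(i, j) (i == v j)%:R.

Lemma perm_mxKE (v : 'S_n) A i j : (perm_mxK v *m A) (v i) j = A i j.
Proof.
rewrite mxE (bigD1 i) //= mxE eqxx mul1r big1 ?addr0 // => l li.
by rewrite mxE (inj_eq perm_inj) eq_sym (negbTE li) mul0r.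
Qed.

(** The products of the permutation matrix of [v] with these matrices represent each flag of the
    Schubert cell of [v] once. *)
Definition inv_unip (v : 'S_n) A :=
  forall i j, A i j = if i == j then 1 else
     if (j < i)%N && (v i < v j)%N then A i j else 0.

Definition lower_unip A := forall i j : 'I_n, (i <= j)%N -> A i j = (i == j)%:R.

(** Bruhat decomposition by column reduction. The pivot of each column is its lowest nonzero entry;
    zeros below the pivots and to their right leave free only the entries at inversions of [v]. *)
Lemma canonical_form A : A \in unitmx ->
  exists v : 'S_n, exists u b, [/\ upper b, b \in unitmx, inv_unip v u &
    A *m b = perm_mxK v *m u].
Proof.
move=> uA.
have H k : (k <= n)%N -> exists p : 'I_n -> 'I_n, exists2 b, upper b /\ b \in unitmx &
  forall j : 'I_n, (j < k)%N -> [/\ (A *m b) (p j) j = 1,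
    forall j' : 'I_n, (j < j')%N -> (A *m b) (p j) j' = 0 &
    forall i : 'I_n, (p j < i)%N -> (A *m b) i j = 0].
  elim: k => [|k IH] kn.
    by exists id; exists 1%:M => //; split; [exact: htri1|exact: unitmx1].
  have [p [b [ub b_unit] bP]] := IH (ltnW kn).
  pose k' := Ordinal kn; set M := A *m b in bP.
  have uM : M \in unitmx by rewrite unitmx_mul uA.
  have [r0 r0P] := unit_col_neq0 k' uM.
  case: (@arg_maxnP _ r0 (fun r => M r k' != 0) (@nat_of_ord n) r0P) => r rP rmax.
  have [e [ue e_unit] eE] := elim_step rP.
  exists (fun j => if j == k' then r else p j); exists (b *m e).
    by split; [exact: htri_mul|rewrite unitmx_mul b_unit].
  rewrite mulmxA -/M => j /(ord_ltS kn)[jk|->]; last first.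
    rewrite eqxx; split=> [|j' kj'|i ri]; rewrite !eE.
    - by rewrite eqxx mulfV.
    - have -> : (j' == k') = false by apply/eqP => ?; subst; rewrite ltnn in kj'.
      by rewrite kj' mulrCA mulfV // mulr1 subrr.
    - rewrite eqxx; have [->|/rmax] := eqVneq (M i k') 0; first by rewrite mul0r.
      by move=> h; have := leq_trans ri h; rewrite ltnn.
  have jk' : (j == k') = false by apply/eqP => ?; subst; rewrite ltnn in jk.
  have kj : (k' < j)%N = false by rewrite ltnNge ltnW.
  have [h1 h2 h3] := bP _ jk; rewrite jk'; split=> [|j' jj'|i pji]; rewrite !eE ?jk' ?kj //.
  - have -> : M (p j) k' = 0 by apply: h2.
    by rewrite !mul0r subr0 h2 // if_same; case: ifP.
  - exact: h3.
have [p [b [ub b_unit] bP]] := H n (leqnn n).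
set M := A *m b in bP.
have pinj : injective p.
  move=> i j pij; have [lt|lt|/ord_inj//] := ltngtP i j.
    have [_ /(_ _ lt) + _] := bP i (ltn_ord i); have [+ _ _] := bP j (ltn_ord j).
    by rewrite pij => -> /eqP; rewrite oner_eq0.
  have [_ /(_ _ lt) + _] := bP j (ltn_ord j); have [+ _ _] := bP i (ltn_ord i).
  by rewrite pij => -> /eqP; rewrite oner_eq0.
exists (perm pinj), (\matrix_(i, j) M (p i) j), b; split=> //; last first.
  apply/matrixP => i j.
  by rewrite -(permKV (perm pinj) i) perm_mxKE [RHS]mxE permE.
move=> i j; rewrite mxE !permE; case: eqP => [->|/eqP ij].
  by have [] := bP j (ltn_ord j).
case: ifP => // /negbT; rewrite negb_and -!leqNgt => /orP[le|le].
  have [_ h _] := bP i (ltn_ord i); apply: h.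
  by rewrite ltn_neqAle le andbT; apply: contraNneq ij => /ord_inj ->.
have [_ _ h] := bP j (ltn_ord j); apply: h.
rewrite ltn_neqAle le andbT; apply: contraNneq ij => /ord_inj /pinj -> //.
Qed.

Lemma lower_unip_of A :
  (forall j : 'I_n, A j j = 1 /\ forall j' : 'I_n, (j < j')%N -> A j j' = 0) ->
  lower_unip A.
Proof.
move=> H i j; rewrite leq_eqVlt => /orP[/eqP/ord_inj ->|ij].
  by rewrite eqxx; case: (H j).
have [_ ->//] := H i; case: eqP => // e; by rewrite e ltnn in ij.
Qed.

(** LU elimination in which a zero pivot is repaired first. The rows above vanish in that column, so
    some lower row does not, and adding it to the pivot row is an upper triangular operation on the
    left. *)
Lemma big_cell_translate A : A \in unitmx ->
  exists a b u, [/\ upper a /\ a \in unitmx, upper b /\ b \in unitmx, lower_unip u &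
    a *m A *m b = u].
Proof.
move=> uA.
have H k : (k <= n)%N -> exists a b, [/\ upper a /\ a \in unitmx, upper b /\ b \in unitmx &
  forall j : 'I_n, (j < k)%N -> (a *m A *m b) j j = 1 /\
    forall j' : 'I_n, (j < j')%N -> (a *m A *m b) j j' = 0].
  elim: k => [|k IH] kn.
    by exists 1%:M, 1%:M; split => //; split; try exact: htri1; exact: unitmx1.
  have [a [b [[ua a_unit] [ub b_unit] bP]]] := IH (ltnW kn).
  pose k' := Ordinal kn; set M := a *m A *m b in bP.
  have uM : M \in unitmx by rewrite !unitmx_mul a_unit uA.
  have [a' [ua' a'_unit] [a'P a'k]] : exists2 a', upper a' /\ a' \in unitmx &
     (forall j : 'I_n, (j < k)%N -> forall i, (a' *m M) j i = M j i) /\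
     (a' *m M) k' k' != 0.
    have [M0|M0] := eqVneq (M k' k') 0; last first.
      exists 1%:M; first by split; [exact: htri1|exact: unitmx1].
      by rewrite mul1mx; split.
    have [r rP] := unit_col_neq0 k' uM.
    have kr : (k' < r)%N.
      rewrite ltnNge leq_eqVlt; apply/negP => /orP[/eqP/ord_inj e|lt].
        by rewrite e M0 eqxx in rP.
      by have [_ h] := bP r lt; rewrite h ?eqxx in rP.
    have utri : upper (1%:M + delta_mx k' r).
      move=> i j ij; rewrite !mxE; case: eqP => [e|_]; first by rewrite e ltnn in ij.
      rewrite add0r; case: eqP => // ik; case: eqP => // jr.
      by rewrite ik jr in ij; have := ltn_trans kr ij; rewrite ltnn.
    exists (1%:M + delta_mx k' r); first split => //.
      rewrite (htri_unitE (@ord_inj n) utri); apply/forallP => i; rewrite !mxE eqxx.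
      have [ik|_] := eqVneq i k'; have [ir|_] := eqVneq i r; rewrite ?addr0 ?oner_neq0 //.
      by rewrite -ik ir ltnn in kr.
    have E (N : 'M[K]_n) i j :
        ((1%:M + delta_mx k' r) *m N) i j = N i j + (i == k')%:R * N r j.
      rewrite mulmxDl mul1mx !mxE (bigD1 r) //= mxE eqxx andbT big1 ?addr0 // => l lr.
      by rewrite mxE (negbTE lr) andbF mul0r.
    split=> [j jk i|]; rewrite E; last by rewrite eqxx M0 add0r mul1r.
    case: eqP => [e|_]; last by rewrite mul0r addr0.
    by rewrite e ltnn in jk.
  have [e [ue e_unit] eE] := elim_step a'k.
  exists (a' *m a), (b *m e); split.
  - by split; [exact: htri_mul|rewrite unitmx_mul a'_unit].
  - by split; [exact: htri_mul|rewrite unitmx_mul b_unit].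
  have -> : a' *m a *m A *m (b *m e) = a' *m M *m e by rewrite /M !mulmxA.
  move=> j /(ord_ltS kn)[jk|->]; last first.
    split=> [|j' kj']; rewrite !eE; first by rewrite eqxx mulfV.
    have -> : (j' == k') = false by apply/eqP => ?; subst; rewrite ltnn in kj'.
    by rewrite kj' mulrCA mulfV // mulr1 subrr.
  have jk' : (j == k') = false by apply/eqP => ?; subst; rewrite ltnn in jk.
  have kj : (k' < j)%N = false by rewrite ltnNge ltnW.
  have [h1 h2] := bP _ jk; split=> [|j' jj']; rewrite !eE ?jk' ?kj !(a'P j) //.
  have -> : M j k' = 0 by apply: h2.
  by rewrite !mul0r subr0 h2 // if_same; case: ifP.
have [a [b [ha hb bP]]] := H n (leqnn n).
exists a, b, (a *m A *m b); split=> //.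
by apply: lower_unip_of => j; apply: bP.
Qed.
End Triangular.

Local Open Scope quotient_scope.
Local Open Scope classical_set_scope.
Local Open Scope ring_scope.

(** * Polynomial and regular functions *)

Section Cofinite.
Variable K : closedFieldType.

(** Serves as [for generic x]: stable under finite conjunctions, and satisfiable by [cofin_ex]. *)
Definition cofin (P : K -> Prop) := exists s : seq K, forall x, x \notin s -> P x.
Definition pfun (f : K -> K) := exists p : {poly K}, forall x, f x = p.[x].

Lemma cofinI P Q : cofin P -> cofin Q -> cofin (fun x => P x /\ Q x).
Proof.
move=> [s sP] [r rQ]; exists (s ++ r) => x; rewrite mem_cat negb_or => /andP[xs xr].
by split; auto.
Qed.

Lemma cofin_sub (P Q : K -> Prop) : (forall x, P x -> Q x) -> cofin P -> cofin Q.
Proof. by move=> PQ [s sP]; exists s => x /sP /PQ. Qed.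

Lemma cofin_all (I : finType) (P : I -> K -> Prop) :
  (forall i, cofin (P i)) -> cofin (fun x => forall i, P i x).
Proof.
move=> /choice[s sP]; exists (flatten [seq s i | i <- enum I]) => x xs i.
apply: sP; apply: contraNN xs => xs; apply/flattenP; exists (s i) => //.
by apply: map_f; rewrite mem_enum.
Qed.

Lemma cofin_inv P : cofin P -> cofin (fun x => P x^-1).
Proof.
move=> [s sP]; exists [seq x^-1 | x <- s] => x xs; apply: sP.
by apply: contraNN xs => xs; rewrite -[x]invrK; apply: map_f.
Qed.

Lemma cofin_neq a : cofin (fun x => x != a).
Proof. by exists [:: a] => x; rewrite inE. Qed.

Lemma cofin_ex P : cofin P -> exists x, P x.
Proof.
(* A root of this polynomial avoids the list. The extra factor at 0 keeps it nonconstant for an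
   empty list. *)
move=> [s sP]; pose p : {poly K} := \prod_(a <- 0 :: s) ('X - a%:P) + 1.
have sp : size p != 1%N.
  by rewrite size_polyDl size_prod_XsubC ?size_polyC ?oner_neq0 //= ltnS.
have /closed_rootP [x /rootP] := sp.
rewrite hornerD hornerC => /eqP; rewrite addrC addr_eq0 => /eqP px; exists x; apply: sP.
apply/negP => xs; have : root (\prod_(a <- 0 :: s) ('X - a%:P)) x.
  by rewrite root_prod_XsubC inE xs orbT.
by move=> /rootP p0; move: px; rewrite p0 oppr0 => /eqP; rewrite oner_eq0.
Qed.

Lemma pfun_alg : fun_alg pfun.
Proof.
split=> [a|f g [p pf] [q qg]|f g [p pf] [q qg]].
- by exists a%:P => x; rewrite hornerC.
- by exists (p + q) => x; rewrite hornerD pf qg.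
- by exists (p * q) => x; rewrite hornerM pf qg.
Qed.

Lemma pfun_id : pfun id. Proof. by exists 'X => x; rewrite hornerX. Qed.

Lemma poly_cofin (p : {poly K}) : p != 0 -> cofin (fun x => p.[x] != 0).
Proof.
move=> p0; have [r rE] := closed_field_poly_normal p; exists r => x xr.
apply: contraNneq xr => /rootP; rewrite rE rootZ ?lead_coef_eq0 //.
by rewrite root_prod_XsubC.
Qed.

Lemma pfun_cofin f a : pfun f -> f a != 0 -> cofin (fun x => f x != 0).
Proof.
move=> [p pf] fa; have p0 : p != 0 by apply: contraNneq fa => p0; rewrite pf p0 horner0.
by have := poly_cofin p0; apply: cofin_sub => x; rewrite pf.
Qed.
End Cofinite.

Section GLpoly.
Variables (K : fieldType) (n : nat).
Local Notation GL := (GL K n).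
Implicit Types (g h b : GL) (f : GL -> K).

Definition gl_poly f := exists p, forall g, f g = gl_eval p g.

Lemma gl_poly_alg : fun_alg gl_poly.
Proof.
split=> [a|f g [p pf] [q qg]|f g [p pf] [q qg]].
- by exists (mpolyC _ a) => x; rewrite /gl_eval mevalC.
- by exists (p + q) => x; rewrite /gl_eval mevalD pf qg.
- by exists (p * q) => x; rewrite /gl_eval mevalM pf qg.
Qed.

Lemma gl_poly_entry i j : gl_poly (fun g => glmx g i j).
Proof.
exists (mpolyX _ (mnm1 (mxvec_index i j))) => g.
by rewrite /gl_eval mevalXU mxvecE.
Qed.

Lemma gl_poly_comp (A : GL -> GL) f :
  (forall i j, gl_poly (fun g => glmx (A g) i j)) -> gl_poly f ->
  gl_poly (fun g => f (A g)).
Proof.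
move=> pA [p pf]; under eq_fun do rewrite pf /gl_eval.
apply: (fa_meval gl_poly_alg) => k; case/mxvec_indexP: k => i j.
by under eq_fun do rewrite mxvecE.
Qed.

Lemma gl_poly_lmul h f : gl_poly f -> gl_poly (fun g => f (h * g)%g).
Proof.
apply: gl_poly_comp; apply: (fa_mulmx gl_poly_alg) => i j; last exact: gl_poly_entry.
exact: (fa_cst gl_poly_alg).
Qed.

Lemma gl_poly_rmul h f : gl_poly f -> gl_poly (fun g => f (g * h)%g).
Proof.
apply: gl_poly_comp; apply: (fa_mulmx gl_poly_alg) => i j; first exact: gl_poly_entry.
exact: (fa_cst gl_poly_alg).
Qed.

Lemma gl_poly_adj i j : gl_poly (fun g => (\adj (glmx g)) i j).
Proof.
under eq_fun do rewrite mxE /cofactor.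
apply: (fa_mul gl_poly_alg); first exact: (fa_cst gl_poly_alg).
apply: (fa_det gl_poly_alg) => k l; under eq_fun do rewrite !mxE.
exact: gl_poly_entry.
Qed.

Lemma nbhs_glP g (A : set GL) :
  nbhs g A <-> exists2 f, gl_poly f & f g != 0 /\ (forall h, f h != 0 -> A h).
Proof.
rewrite nbhsE; split=> [[U [oU Ug] UA]|[f [p pf] [fg fA]]].
  have [p pg pU] := oU g Ug.
  exists (gl_eval p); first by exists p.
  by split=> // h ph; apply: UA; apply: pU.
exists [set h | f h != 0] => //; split=> //.
change (zariski_open [set h | f h != 0]) => h /= fh; exists p; rewrite -?pf //.
by move=> k /=; rewrite -pf.
Qed.

Lemma near_gl_neq0 g f : gl_poly f -> f g != 0 -> \forall h \near g, f h != 0.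
Proof. by move=> pf fg; apply/nbhs_glP; exists f. Qed.

Lemma closed_gl_eq0 (I : Type) (F : I -> GL -> K) :
  (forall i, gl_poly (F i)) -> closed [set g | forall i, F i g = 0].
Proof.
move=> pF g gcl i; apply/eqP/negPn/negP => Fg.
have /gcl[h [Fh]] := near_gl_neq0 (pF i) Fg.
by rewrite Fh eqxx.
Qed.

Lemma gl_regular_poly g f : gl_poly f -> gl_regular g f.
Proof.
move=> [p pf]; exists p, 1; near=> h.
by rewrite /gl_eval meval1 oner_neq0 divr1 pf.
Unshelve. all: by end_near.
Qed.

Lemma gl_regular_neq0 g f : gl_regular g f -> f g != 0 -> \forall h \near g, f h != 0.
Proof.
move=> [p [q pq]] fg; have [qg fE] := nbhs_singleton pq.
have pg : gl_eval p g != 0.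
  by apply: contraNneq fg => pg; rewrite fE pg mul0r.
have npg : \forall h \near g, gl_eval p h != 0.
  by apply: near_gl_neq0 => //; exists p.
near=> h; have [qh ->] : gl_eval q h != 0 /\ f h = gl_eval p h / gl_eval q h by near: h.
by rewrite mulf_neq0 ?invr_eq0 //; near: h.
Unshelve. all: by end_near.
Qed.

Lemma gl_regular_alg g : fun_alg (gl_regular g).
Proof.
split=> [a|f1 f2 [p1 [q1 H1]] [p2 [q2 H2]]|f1 f2 [p1 [q1 H1]] [p2 [q2 H2]]].
- by apply: gl_regular_poly; exact: (fa_cst gl_poly_alg).
- exists (p1 * q2 + p2 * q1), (q1 * q2); near=> h.
  have [h1 ->] : gl_eval q1 h != 0 /\ f1 h = gl_eval p1 h / gl_eval q1 h by near: h.
  have [h2 ->] : gl_eval q2 h != 0 /\ f2 h = gl_eval p2 h / gl_eval q2 h by near: h.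
  by rewrite /gl_eval mevalD !mevalM -!/(gl_eval _ _) mulf_neq0 // addf_div.
- exists (p1 * p2), (q1 * q2); near=> h.
  have [h1 ->] : gl_eval q1 h != 0 /\ f1 h = gl_eval p1 h / gl_eval q1 h by near: h.
  have [h2 ->] : gl_eval q2 h != 0 /\ f2 h = gl_eval p2 h / gl_eval q2 h by near: h.
  by rewrite /gl_eval !mevalM -!/(gl_eval _ _) mulf_neq0 // mulf_div.
Unshelve. all: by end_near.
Qed.

Lemma gl_regular_inv g f : gl_regular g f -> f g != 0 -> gl_regular g (fun h => (f h)^-1).
Proof.
move=> rf fg; have nf := gl_regular_neq0 rf fg; have [p [q pq]] := rf.
exists q, p; near=> h.
have [qh fE] : gl_eval q h != 0 /\ f h = gl_eval p h / gl_eval q h by near: h.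
have fh : f h != 0 by near: h.
rewrite fE invf_div; split=> //; apply: contraNneq fh => ph.
by rewrite fE ph mul0r.
Unshelve. all: by end_near.
Qed.

Lemma gl_regular_near g f f' : gl_regular g f -> (\forall h \near g, f h = f' h) ->
  gl_regular g f'.
Proof.
move=> [p [q pq]] ff'; exists p, q; near=> h.
have <- : f h = f' h by near: h.
by near: h.
Unshelve. all: by end_near.
Qed.
End GLpoly.

(** * Topology and regular functions of the flag variety *)

Section Flag.
Variables (K : fieldType) (n : nat).
Local Notation GL := (GL K n).
Local Notation Fl := (Fl K n).
Implicit Types (g h b : GL) (f : Fl -> K) (x y : Fl).

Lemma upper_borelE b : upper_borel b <-> upper (glmx b).
Proof.
split=> [/is_trig_mxP H i j ij|H].
  by have := H j i ij; rewrite mxE.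
by apply/is_trig_mxP => i j ij; rewrite mxE; apply: H.
Qed.

Lemma upper_borel1 : upper_borel (1%g : GL).
Proof. by apply/upper_borelE; exact: htri1. Qed.

Lemma upper_borelM b h : upper_borel b -> upper_borel h -> upper_borel (b * h)%g.
Proof. by move=> /upper_borelE ub /upper_borelE uh; apply/upper_borelE; exact: htri_mul. Qed.

Lemma upper_borelV b : upper_borel b -> upper_borel b^-1%g.
Proof.
move=> /upper_borelE ub; apply/upper_borelE; apply: htri_inv => //; first exact: ord_inj.
exact: glmxP.
Qed.

Lemma flag_of_eq g h : flag_of g = flag_of h <-> exists2 b, upper_borel b & h = (g * b)%g.
Proof.
rewrite flag_ofP; split=> [e|[b ub ->]].
  have : coset_upper_borel h h by exists 1%g; rewrite ?mulg1 //; exact: upper_borel1.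
  by rewrite -e => -[b ub <-]; exists b.
apply/seteqP; split=> _ [c uc <-].
  exists (b^-1 * c)%g; last by rewrite mulgA mulgK.
  by apply: upper_borelM => //; exact: upper_borelV.
by exists (b * c)%g; rewrite ?mulgA //; exact: upper_borelM.
Qed.

Lemma flag_of_mulB g b : upper_borel b -> flag_of (g * b)%g = flag_of g.
Proof. by move=> ub; apply/esym/flag_of_eq; exists b. Qed.

Lemma flag_ofK x : flag_of (repr (x : {eq_quot @same_coset_equiv K n})) = x.
Proof. exact: reprK. Qed.

Lemma flag_ofW (P : Fl -> Prop) : (forall g, P (flag_of g)) -> forall x, P x.
Proof. by move=> Pg x; rewrite -(flag_ofK x). Qed.

Lemma flag_of_continuous : continuous (@flag_of K n).
Proof. exact: pi_continuous. Qed.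

(** The projection is open: the preimage of the image of an open set is the union of its right
    translates by the Borel group. *)
Lemma nbhs_flag_of g (A : set GL) : nbhs g A -> nbhs (flag_of g) (@flag_of K n @` A).
Proof.
rewrite nbhsE => -[U [oU Ug] UA].
apply: (filterS (@image_subset _ _ (@flag_of K n) _ _ UA)).
apply: open_nbhs_nbhs; split; last by exists g.
change (zariski_open (@flag_of K n @^-1` (@flag_of K n @` U))) => h [a Ua /flag_of_eq[b ub hab]].
have [p pa pU] := oU a Ua.
have [q qE] : gl_poly (fun k => gl_eval p (k * b^-1)%g).
  by apply: gl_poly_rmul; exists p.
exists q; first by rewrite -qE hab mulgK.
move=> k /=; rewrite -qE => /pU Uk; exists (k * b^-1)%g => //.
by apply: flag_of_mulB; exact: upper_borelV.
Qed.

Lemma near_flag_of g (P : Fl -> Prop) :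
  (\forall h \near g, P (flag_of h)) <-> \forall y \near flag_of g, P y.
Proof.
split=> [/nbhs_flag_of|]; last exact: flag_of_continuous.
by apply: filterS => _ [h ? <-].
Qed.

Lemma flag_regular_gl g f : flag_regular (flag_of g) f -> gl_regular g (f \o @flag_of K n).
Proof. by move=> /nbhs_singleton; apply. Qed.

Lemma flag_regular_alg x : fun_alg (flag_regular x).
Proof.
split=> [a|f1 f2 H1 H2|f1 f2 H1 H2]; rewrite /flag_regular /=.
- by near=> y => g gy; exact: (fa_cst (gl_regular_alg _)).
- near=> y => g gy; apply: (fa_add (gl_regular_alg _)).
    by move: g gy; near: y; exact: H1.
  by move: g gy; near: y; exact: H2.
- near=> y => g gy; apply: (fa_mul (gl_regular_alg _)).
    by move: g gy; near: y; exact: H1.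
  by move: g gy; near: y; exact: H2.
Unshelve. all: by end_near.
Qed.

Lemma flag_regular_neq0 x f : flag_regular x f -> f x != 0 -> \forall y \near x, f y != 0.
Proof.
elim/flag_ofW: x => g /flag_regular_gl rf fg.
by apply/near_flag_of; exact: (gl_regular_neq0 rf fg).
Qed.

Lemma flag_regular_inv x f : flag_regular x f -> f x != 0 ->
  flag_regular x (fun y => (f y)^-1).
Proof.
move=> rf fx; have nf := flag_regular_neq0 rf fx; rewrite /flag_regular /=.
near=> y => g gy.
have h1 : gl_regular g (f \o @flag_of K n) by move: g gy; near: y; exact: rf.
apply: (gl_regular_inv h1); rewrite /= gy; near: y; exact: nf.
Unshelve. all: by end_near.
Qed.

Definition flag_quot (P Q : GL -> K) (x : Fl) : K :=
  let g := repr (x : {eq_quot @same_coset_equiv K n}) in P g / Q g.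

(** [P] and [Q] behave like sections of one line bundle on the flag variety, so that their quotient
    descends to it. *)
Definition same_weight (P Q : GL -> K) := forall g b, upper_borel b ->
  exists2 chi : K, chi != 0 & P (g * b)%g = chi * P g /\ Q (g * b)%g = chi * Q g.

Lemma flag_quotE P Q g : same_weight P Q -> flag_quot P Q (flag_of g) = P g / Q g.
Proof.
move=> PQ; rewrite /flag_quot; set h := repr _.
have /esym/flag_of_eq[b ub ->] : flag_of h = flag_of g by rewrite /h flag_ofK.
have [chi chi0 [-> ->]] := PQ g b ub.
by rewrite -mulf_div divff // mul1r.
Qed.

Lemma flag_quot_regular P Q g : gl_poly P -> gl_poly Q -> same_weight P Q ->
  Q g != 0 -> flag_regular (flag_of g) (flag_quot P Q).
Proof.
move=> pP pQ PQ Qg; apply/near_flag_of.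
have H : \forall h \near g, Q h != 0 by exact: near_gl_neq0.
apply: filterS H => h Qh k kh.
have Qk : Q k != 0.
  have /flag_of_eq[b ub ->] := esym kh.
  by have [chi chi0 [_ ->]] := PQ h b ub; rewrite mulf_neq0.
apply: (@gl_regular_near _ _ _ (fun a => P a * (Q a)^-1)).
  apply: (fa_mul (gl_regular_alg _)); first exact: gl_regular_poly.
  by apply: gl_regular_inv => //; exact: gl_regular_poly.
by near=> a; rewrite /= flag_quotE.
Unshelve. all: by end_near.
Qed.

Lemma flag_act_continuous g : continuous (flag_act g).
Proof.
apply/quotient_continuous => h U.
rewrite [X in nbhs X](_ : _ = flag_of (g * h)%g); last exact: flag_actE.
move=> /flag_of_continuous /nbhs_glP[f pf [fgh fU]].
apply/nbhs_glP; exists (fun k => f (g * k)%g); first exact: gl_poly_lmul.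
split=> // k /fU; rewrite /= => Uk; rewrite -[_ (\pi k)]/(flag_act g (flag_of k)).
by rewrite flag_actE.
Qed.

Lemma flag_act1 x : flag_act 1%g x = x.
Proof. by elim/flag_ofW: x => g; rewrite flag_actE mul1g. Qed.

Lemma flag_actM g h x : flag_act (g * h)%g x = flag_act g (flag_act h x).
Proof. by elim/flag_ofW: x => k; rewrite !flag_actE mulgA. Qed.
End Flag.

(** * Minors and the big cell *)

Section Minor.
Variables (K : fieldType) (n : nat).
Implicit Types (A B u : 'M[K]_n) (v : 'S_n).

Definition top_ord (a : 'I_n) (i : 'I_a.+1) : 'I_n := widen_ord (ltn_ord a) i.
Definition minor_row v (b a : 'I_n) (i : 'I_a.+1) : 'I_n :=
  v (if (i : nat) == a then b else top_ord i).

(* Rows [v 0, ..., v (a - 1), v b] and columns [0, ..., a]. *)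
Definition minor v (b a : 'I_n) A : K :=
  \det (\matrix_(i < a.+1, j < a.+1) A (minor_row v b i) (top_ord j)).
Definition top_det (a : 'I_n) A : K :=
  \det (\matrix_(i < a.+1, j < a.+1) A (top_ord i) (top_ord j)).

Lemma minor_poly v b a : gl_poly (fun g : GL K n => minor v b a (glmx g)).
Proof.
apply: (fa_det (@gl_poly_alg K n)) => i j.
by under eq_fun do rewrite mxE; exact: gl_poly_entry.
Qed.

(** As [B] is upper triangular, the first [a + 1] columns of the product involve only the first
    [a + 1] columns of [A]. Such minors are therefore semi-invariant for the Borel group on the
    right. *)
Lemma minor_rmul v b a A B : upper B -> minor v b a (A *m B) = minor v b a A * top_det a B.
Proof.
move=> uB; rewrite /minor /top_det -det_mulmx; congr (\det _).
apply/matrixP => i j; rewrite !mxE.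
rewrite (bigID (fun l : 'I_n => (l < a.+1)%N)) /= [X in _ + X]big1 ?addr0.
  rewrite (big_ord_narrow (ltn_ord a)); apply: eq_bigr => l _.
  by rewrite !mxE.
move=> l; rewrite -leqNgt => al; rewrite uB ?mulr0 //=.
exact: leq_trans (ltn_ord j) al.
Qed.

Lemma top_det_neq0 a B : upper B -> B \in unitmx -> top_det a B != 0.
Proof.
move=> uB; rewrite (htri_unitE (@ord_inj n) uB) => /forallP B0.
rewrite /top_det (@htri_det _ _ (@nat_of_ord _)) //; last 2 first.
- exact: ord_inj.
- by move=> i j ij; rewrite mxE; apply: uB.
by apply/prodf_neq0 => i _; rewrite mxE.
Qed.

Lemma minor_lmul v b a (t : 'I_n -> K) A B :
  (forall i j, B i j = t i * A i j) ->
  minor v b a B = (\prod_(i < a) t (v (widen_ord (ltnW (ltn_ord a)) i))) * t (v b) *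
                  minor v b a A.
Proof.
move=> BE.
pose d : 'rV[K]_a.+1 := \row_i t (minor_row v b i).
have -> : minor v b a B = \det (diag_mx d) * minor v b a A.
  rewrite /minor -det_mulmx mul_diag_mx; congr (\det _).
  by apply/matrixP => i j; rewrite !mxE BE.
rewrite det_diag big_ord_recr /=; congr (_ * _ * _).
  apply: eq_bigr => i _; rewrite mxE /minor_row /= ltn_eqF //; congr (t (v _)).
  exact: ord_inj.
by rewrite mxE /minor_row /= eqxx.
Qed.

(** The submatrix is triangular with diagonal [1, ..., 1, u b a]. *)
Lemma minor_unip v u (b a : 'I_n) : lower_unip u -> (a <= b)%N ->
  minor v b a (perm_mxK K v *m u) = u b a.
Proof.
move=> lu ab.
rewrite /minor det_trig; last first.
  apply/is_trig_mxP => i j ij; rewrite mxE perm_mxKE lu; last first.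
    by case: ifP => [/eqP|_]; [have := ltn_ord j; lia|exact: ltnW].
  case: ifP => [/eqP|_]; first by have := ltn_ord j; lia.
  by rewrite -val_eqE /= ltn_eqF.
rewrite big_ord_recr /= big1 ?mul1r => [|i _].
  by rewrite mxE perm_mxKE eqxx; congr (u _ _); apply: ord_inj.
rewrite mxE perm_mxKE /= ltn_eqF // lu //.
by rewrite (_ : (_ == _) = true) //; apply/eqP; apply: ord_inj.
Qed.

Lemma perm_mxK1 : perm_mxK K (1%g : 'S_n) = 1%:M.
Proof. by apply/matrixP => i j; rewrite !mxE perm1. Qed.

Lemma minor1_unip u (b a : 'I_n) : lower_unip u -> (a <= b)%N -> minor 1%g b a u = u b a.
Proof. by move=> lu ab; rewrite -[u in LHS]mul1mx -perm_mxK1 minor_unip. Qed.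

Lemma lower_unip_htri u : lower_unip u -> htri (fun i : 'I_n => (n - i)%N) u.
Proof.
move=> lu i j ij; have lt : (i < j)%N by have := ltn_ord i; have := ltn_ord j; lia.
by rewrite (lu _ _ (ltnW lt)) -val_eqE /= ltn_eqF.
Qed.

Lemma rev_inj : injective (fun i : 'I_n => (n - i)%N).
Proof. by move=> i j e; apply: ord_inj; have := ltn_ord i; have := ltn_ord j; lia. Qed.

Lemma lower_unip_unit u : lower_unip u -> u \in unitmx.
Proof.
move=> lu; rewrite (htri_unitE rev_inj (lower_unip_htri lu)).
by apply/forallP => i; rewrite lu // eqxx oner_neq0.
Qed.

Lemma lower_unip_inv u : lower_unip u -> lower_unip (invmx u).
Proof.
move=> lu; have uu := lower_unip_unit lu; have hu := lower_unip_htri lu.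
have hV := htri_inv rev_inj hu uu.
move=> i j; rewrite leq_eqVlt => /orP[/eqP/ord_inj ->|ij].
  have := htri_diagM j rev_inj hu hV; rewrite mulmxV // lu // eqxx mul1r => <-.
  by rewrite mxE eqxx.
rewrite hV; last by have := ltn_ord i; have := ltn_ord j; lia.
by rewrite -val_eqE /= ltn_eqF.
Qed.

Lemma lu_of_minors A : A \in unitmx -> (forall a, minor 1%g a a A != 0) ->
  exists2 b, upper b /\ b \in unitmx & lower_unip (A *m b).
Proof.
move=> uA mA.
have H k : (k <= n)%N -> exists2 b, upper b /\ b \in unitmx &
  forall j : 'I_n, (j < k)%N -> (A *m b) j j = 1 /\
    forall j' : 'I_n, (j < j')%N -> (A *m b) j j' = 0.
  elim: k => [|k IH] kn.
    by exists 1%:M => //; split; [exact: htri1|exact: unitmx1].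
  have [b [ub b_unit] bP] := IH (ltnW kn).
  pose k' := Ordinal kn; set M := A *m b in bP.
  have Mkk : M k' k' != 0.
    have : minor 1%g k' k' M != 0.
      by rewrite /M minor_rmul // mulf_neq0 // top_det_neq0.
    rewrite /minor det_trig; last first.
      apply/is_trig_mxP => i j ij; rewrite mxE /minor_row perm1.
      have ik : (i < k)%N by have := ltn_ord j; rewrite /= in j ij *; lia.
      rewrite ifF; last by apply/negbTE; rewrite neq_ltn ik.
      by have [_] := bP (top_ord i) ik; apply.
    move=> /prodf_neq0/(_ ord_max isT); rewrite mxE /minor_row /= eqxx perm1.
    have -> : top_ord (ord_max : 'I_k'.+1) = k' by apply: ord_inj.
    by [].
  have [e [ue e_unit] eE] := elim_step Mkk.
  exists (b *m e); first by split; [exact: htri_mul|rewrite unitmx_mul b_unit].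
  rewrite mulmxA -/M => j /(ord_ltS kn)[jk|->]; last first.
    split=> [|j' kj']; rewrite !eE; first by rewrite eqxx mulfV.
    have -> : (j' == k') = false by apply/eqP => ?; subst; rewrite ltnn in kj'.
    by rewrite kj' mulrCA mulfV // mulr1 subrr.
  have jk' : (j == k') = false by apply/eqP => ?; subst; rewrite ltnn in jk.
  have kj : (k' < j)%N = false by rewrite ltnNge ltnW.
  have [h1 h2] := bP _ jk; split=> [|j' jj']; rewrite !eE ?jk' ?kj //.
  have -> : M j k' = 0 by apply: h2.
  by rewrite !mul0r subr0 h2 // if_same; case: ifP.
have [b hb bP] := H n (leqnn n).
by exists b => //; apply: lower_unip_of => j; apply: bP.
Qed.
End Minor.

Section Schubert.
Variables (K : fieldType) (n : nat).
Local Notation GL := (GL K n).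
Local Notation Fl := (Fl K n).
Variable w : 'S_n.
Implicit Types (g h b : GL) (x y : Fl).

Lemma schubert_cell b : upper_borel b -> schubert K w (flag_of (b * weyl K w)%g).
Proof. by move=> ub; apply: subset_closure; exists b; rewrite // flag_actE. Qed.

Lemma schubert_poly0 g (f : GL -> K) : schubert K w (flag_of g) -> gl_poly f ->
  (forall b b', upper_borel b -> upper_borel b' -> f (b * weyl K w * b')%g = 0) -> f g = 0.
Proof.
move=> Xg pf f0; apply/eqP/negPn/negP => fg.
have := nbhs_flag_of (near_gl_neq0 pf fg).
move=> /Xg [_ [[b ub <-] [h fh]]].
by rewrite flag_actE => /esym/flag_of_eq[b' ub' hE]; rewrite hE f0 ?eqxx in fh.
Qed.

Lemma schubert_closed_act p :
  (forall b, upper_borel b -> schubert K w (flag_of (p * b * weyl K w)%g)) ->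
  forall x, schubert K w x -> schubert K w (flag_act p x).
Proof.
move=> H x Xx.
have cl : closed (flag_act p @^-1` schubert K w).
  apply: preimage_closed; first by move=> *; exact: flag_act_continuous.
  exact: closed_closure.
have : closure (flag_act p @^-1` schubert K w) x.
  move: x Xx; apply: closureS => _ [b ub <-] /=.
  by rewrite !flag_actE mulgA; apply: H.
by move/cl.
Qed.

Lemma borel_stable b x : upper_borel b -> schubert K w x -> schubert K w (flag_act b x).
Proof.
move=> ub; apply: schubert_closed_act => c uc.
by apply: schubert_cell; apply: upper_borelM.
Qed.
End Schubert.

(** * Equations of Schubert varieties *)

Section Equations.
Variables (K : fieldType) (n : nat).
Local Notation GL := (GL K n).
Variable w : 'S_n.
Implicit Types (g h b : GL).

Lemma bruhat_entry (A B : 'M[K]_n) j i :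
  (A *m perm_mxK K w *m B) j i = \sum_a A j (w a) * B a i.
Proof.
rewrite mxE; apply: eq_bigr => a _; congr (_ * _).
rewrite mxE (bigD1 (w a)) //= mxE eqxx mulr1 big1 ?addr0 // => l lw.
by rewrite mxE (negbTE lw) mulr0.
Qed.

Lemma invmx_perm_mxK (v : 'S_n) : invmx (perm_mxK K v) = (perm_mxK K v)^T.
Proof.
have e : perm_mxK K v *m (perm_mxK K v)^T = 1%:M.
  apply/matrixP => i j; rewrite -(permKV v i) perm_mxKE !mxE permKV.
  by rewrite eq_sym.
have [uv _] := mulmx1_unit e.
by rewrite -[RHS](mulKmx uv) e mulmx1.
Qed.

Lemma glmxV g : glmx g^-1%g = invmx (glmx g). Proof. by []. Qed.
Lemma glmxM g h : glmx (g * h)%g = glmx g *m glmx h. Proof. by []. Qed.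
Lemma glmx_weyl (v : 'S_n) : glmx (weyl K v) = perm_mxK K v. Proof. by []. Qed.
Lemma glmx_inj g h : glmx g = glmx h -> g = h. Proof. by move=> e; apply: val_inj. Qed.

(** On the cell the entry is the sum of the [b j (w a) * b' a i], whose nonzero terms need
    [j <= w a] and [a <= i]. *)
Lemma schubert_entry0 g (j i : 'I_n) : schubert K w (flag_of g) ->
  (forall a : 'I_n, (a <= i)%N -> (w a < j)%N) -> glmx g j i = 0.
Proof.
move=> Xg wij; apply: (schubert_poly0 Xg (@gl_poly_entry K n j i)) => b b' ub ub'.
rewrite !glmxM glmx_weyl bruhat_entry big1 // => a _.
have [ai|ia] := leqP a i.
  by have /upper_borelE -> := ub; rewrite ?mul0r // wij.
by have /upper_borelE -> := ub'; rewrite ?mulr0.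
Qed.

Lemma schubert_inv0 g (j i : 'I_n) : schubert K w (flag_of g) ->
  (forall l : 'I_n, (j <= l)%N -> (i < w l)%N) -> invmx (glmx g) j i = 0.
Proof.
move=> Xg wij.
have E h : glmx h^-1%g j i = (\det (glmx h))^-1 * (\adj (glmx h)) j i.
  by rewrite glmxV /invmx glmxP !mxE.
(* The adjugate is polynomial in the entries, so its vanishing passes from the cell to the closure;
   it differs from the inverse by a unit. *)
have adj0 : (\adj (glmx g)) j i = 0; last by rewrite -glmxV E adj0 mulr0.
apply: (schubert_poly0 Xg (@gl_poly_adj K n j i)) => b b' ub ub'.
suff : glmx (b * weyl K w * b')^-1%g j i = 0.
  rewrite E => /eqP; rewrite mulf_eq0 invr_eq0 => /orP[/eqP d0|/eqP//].
  by have := glmxP (b * weyl K w * b')%g; rewrite unitmxE d0 unitr0.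
rewrite !invgM !glmxM !glmxV glmx_weyl invmx_perm_mxK mulmxA mxE.
apply: big1 => l _.
have [lt|le] := ltnP i l.
  have /upper_borelE ubV := upper_borelV ub.
  by rewrite -[invmx (glmx b)]glmxV ubV ?mulr0.
rewrite [X in X * _]mxE big1 ?mul0r // => k _; rewrite !mxE; case: eqP => [lk|]; last by rewrite mulr0.
have /upper_borelE ubV := upper_borelV ub'.
rewrite -[invmx (glmx b')]glmxV ubV ?mul0r // ltnNge; apply/negP => /wij.
by rewrite -lk ltnNge le.
Qed.

(** At most one [a] crosses the cut, so on the cell the corner with rows from [p] on and columns
    before [q] is a product of a column and a row. *)
Lemma schubert_minor2 g (p q : nat) (r1 r2 c1 c2 : 'I_n) :
  schubert K w (flag_of g) ->
  (forall a a' : 'I_n, (a < a')%N -> (a' < q)%N -> (p <= w a)%N -> (p <= w a')%N -> False) ->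
  (p <= r1)%N -> (p <= r2)%N -> (c1 < q)%N -> (c2 < q)%N ->
  glmx g r1 c1 * glmx g r2 c2 = glmx g r1 c2 * glmx g r2 c1.
Proof.
move=> Xg wpq r1p r2p c1q c2q; apply/eqP; rewrite -subr_eq0; apply/eqP.
apply: (schubert_poly0 (f := fun g => glmx g r1 c1 * glmx g r2 c2 - glmx g r1 c2 * glmx g r2 c1) Xg).
  apply: (fa_sub (@gl_poly_alg K n)); apply: (fa_mul (@gl_poly_alg K n));
    exact: gl_poly_entry.
move=> b b' /upper_borelE ub /upper_borelE ub'.
have zero (a r c : 'I_n) : (p <= r)%N -> (c < q)%N -> ~~ ((a < q) && (p <= w a))%N ->
    glmx b r (w a) * glmx b' a c = 0.
  move=> pr cq; rewrite negb_and -leqNgt -ltnNge => /orP[qa|wa].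
    by rewrite ub' ?mulr0 //; exact: leq_trans cq qa.
  by rewrite ub ?mul0r //; exact: leq_trans wa pr.
rewrite !glmxM glmx_weyl.
have [[a Pa]|nP] := pselect (exists a : 'I_n, (a < q) && (p <= w a))%N; last first.
  have z (r c : 'I_n) : (p <= r)%N -> (c < q)%N -> (glmx b *m perm_mxK K w *m glmx b') r c = 0.
    move=> pr cq; rewrite bruhat_entry big1 // => a _; apply: zero => //.
    by apply/negP => Pa; apply: nP; exists a.
  by rewrite !z // !mul0r subrr.
have one (r c : 'I_n) : (p <= r)%N -> (c < q)%N ->
    (glmx b *m perm_mxK K w *m glmx b') r c = glmx b r (w a) * glmx b' a c.
  move=> pr cq; rewrite bruhat_entry (bigD1 a) //= big1 ?addr0 // => a' aa'.
  apply: zero => //; apply/negP => Pa'; move/andP: Pa => [a1 a2]; move/andP: Pa' => [a3 a4].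
  have [lt|lt|/ord_inj e] := ltngtP a a'.
  - exact: (wpq a a').
  - exact: (wpq a' a).
  - by rewrite e eqxx in aa'.
rewrite !one //; apply/eqP; rewrite subr_eq0; apply/eqP.
by rewrite mulrACA [RHS]mulrACA [X in _ = _ * X]mulrC.
Qed.

(** The entries [(v a, a)] of [g] and [(a, v a)] of its inverse equal 1. A violated bound would make
    one of them vanish, or make a corner of rank one contain a nonzero 2 x 2 minor. *)
Lemma schubert_K22_bounds g (v : 'S_n) (u : 'M[K]_n) k : schubert K w (flag_of g) ->
  glmx g = perm_mxK K v *m u -> lower_unip u -> K22_bounds w k -> K22_bounds v k.
Proof.
move=> Xg gE lu [B1 B2 B3 B4].
have gd a : glmx g (v a) a = 1 by rewrite gE perm_mxKE lu // eqxx.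
have giE a : invmx (glmx g) a (v a) = 1.
  have -> : invmx (glmx g) = invmx u *m (perm_mxK K v)^T.
    have -> : g = (weyl K v * MkGL (lower_unip_unit lu))%g by apply: glmx_inj.
    by rewrite -glmxV invgM -invmx_perm_mxK.
  rewrite mxE (bigD1 a) //= !mxE eqxx mulr1 (lower_unip_inv lu) // eqxx big1 ?addr0 // => l la.
  by rewrite !mxE (inj_eq perm_inj) eq_sym (negbTE la) mulr0.
have up (i : nat) (j a : 'I_n) : (a < i)%N ->
    (forall a : 'I_n, (a < i)%N -> (w a < j)%N) -> v a = j -> False.
  move=> ai H vj; have := gd a; rewrite vj (schubert_entry0 Xg) => [/eqP|a' aa'].
    by rewrite eq_sym oner_eq0.
  by apply: H; exact: leq_ltn_trans ai.
have dn (i : nat) (j a : 'I_n) : (i <= a)%N ->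
    (forall a : 'I_n, (i <= a)%N -> (j < w a)%N) -> v a = j -> False.
  move=> ai H vj; have := giE a; rewrite vj (schubert_inv0 Xg) => [/eqP|a' aa'].
    by rewrite eq_sym oner_eq0.
  by apply: H; exact: leq_trans aa'.
split.
- move=> i a a' ik aa' a'i va va'.
  have := schubert_minor2 Xg (fun a a' => B1 i a a' ik) va va' (ltn_trans aa' a'i) a'i.
  rewrite !gd gE perm_mxKE (lu _ _ (ltnW aa')) -val_eqE /= ltn_eqF // mul0r mulr1.
  by move/eqP; rewrite oner_eq0.
- move=> i i1 i2; have [H|H] := B2 i i1 i2; [left=> a ai|right=> a ai]; rewrite leqNgt; apply/negP => lt.
    apply: (@up i (v a) a) => // a' a'i; exact: leq_ltn_trans (H a' a'i) lt.
  apply: (@dn i.+1 (v a) a) => // a' a'i; exact: leq_trans (H a' a'i).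
- move=> a ak; rewrite ltnNge; apply/negP => lt.
  apply: (@up k (v a) a) => // a' a'k; exact: leq_trans (B3 a' a'k) lt.
- move=> a ak; rewrite leqNgt; apply/negP => lt.
  apply: (@dn k.+2 (v a) a) => // a' a'k; exact: leq_trans lt (B4 a' a'k).
Qed.
End Equations.

(** * Root groups and diagonal matrices *)

Section Elementary.
Variables (K : fieldType) (n : nat).
Local Notation GL := (GL K n).
Implicit Types (g h b : GL) (t : 'I_n -> K).

Definition toGL (M : 'M[K]_n) : GL := insubd (1%g : GL) M.
Lemma toGLE M : M \in unitmx -> glmx (toGL M) = M.
Proof. by move=> uM; rewrite -[LHS]/(val _) insubdK. Qed.

Definition elem_mx (i j : 'I_n) (a : K) : 'M[K]_n := 1%:M + a *: delta_mx i j.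
Definition elem_gl i j a : GL := toGL (elem_mx i j a).

Lemma elem_mx_mull i j a (A : 'M[K]_n) k l :
  (elem_mx i j a *m A) k l = A k l + (k == i)%:R * (a * A j l).
Proof.
rewrite mulmxDl mul1mx mxE -scalemxAl mxE mxE (bigD1 j) //= mxE eqxx andbT big1.
  by rewrite addr0 mulrCA.
by move=> l' lj; rewrite mxE (negbTE lj) andbF mul0r.
Qed.

Lemma elem_mx_mulr i j a (A : 'M[K]_n) k l :
  (A *m elem_mx i j a) k l = A k l + (l == j)%:R * (a * A k i).
Proof.
rewrite mulmxDr mulmx1 mxE -scalemxAr mxE mxE (bigD1 i) //= mxE eqxx /= big1.
  by congr (_ + _); rewrite addr0 mulrA mulrC.
by move=> l' lj; rewrite mxE (negbTE lj) mulr0.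
Qed.

Lemma elem_mx_unit i j a : i != j -> elem_mx i j a \in unitmx.
Proof.
move=> ij; have e : elem_mx i j a *m elem_mx i j (- a) = 1%:M.
  apply/matrixP => k l; rewrite elem_mx_mull !mxE [j == i]eq_sym (negbTE ij).
  rewrite /= mulr0 addr0; case: (k == i); rewrite /= ?mul1r ?mul0r ?addr0 //.
    by rewrite [j == l]eq_sym; case: (l == j); rewrite ?mulr1 ?mulr0 ?addr0 // addrNK.
  by rewrite mulr0 addr0.
by have [] := mulmx1_unit e.
Qed.

Lemma elem_glE i j a : i != j -> glmx (elem_gl i j a) = elem_mx i j a.
Proof. by move=> ij; rewrite toGLE ?elem_mx_unit. Qed.

Lemma elem_gl0 i j : elem_gl i j 0 = 1%g.
Proof.
by apply: glmx_inj; rewrite toGLE /elem_mx scale0r addr0 ?unitmx1.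
Qed.

Lemma elem_glD i j a c : i != j -> (elem_gl i j a * elem_gl i j c)%g = elem_gl i j (a + c).
Proof.
move=> ij; apply: glmx_inj; rewrite glmxM !elem_glE //; apply/matrixP => k l.
rewrite elem_mx_mull !mxE [j == i]eq_sym (negbTE ij) /= mulr0 addr0 eq_sym.
by case: (k == i); rewrite /= ?mul0r ?mul1r ?mulr0 ?addr0 // mulrDl addrAC addrA [j == l]eq_sym.
Qed.

Lemma elem_glV i j a : i != j -> ((elem_gl i j a)^-1)%g = elem_gl i j (- a).
Proof.
move=> ij; apply: (mulgI (elem_gl i j a)); rewrite mulgV elem_glD // subrr elem_gl0 //.
Qed.

Lemma elem_upper (i j : 'I_n) a : (i < j)%N -> upper_borel (elem_gl i j a).
Proof.
move=> ij; have ne : i != j by rewrite -val_eqE /= neq_ltn ij.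
apply/upper_borelE => k l lk; rewrite elem_glE // !mxE.
case: eqP => [e|_]; first by rewrite e ltnn in lk.
case: eqP => [ki|_]; last by rewrite mulr0 addr0.
case: eqP => [lj|_]; last by rewrite mulr0 addr0.
by rewrite ki lj ltnNge ltnW in lk.
Qed.

Definition diag_gl t : GL := toGL (diag_mx (\row_i t i)).
Lemma diag_glE t : (forall i, t i != 0) -> glmx (diag_gl t) = diag_mx (\row_i t i).
Proof.
move=> t0; rewrite toGLE // unitmxE unitfE det_diag; apply/prodf_neq0 => i _.
by rewrite mxE.
Qed.

Lemma diag_gl_torus t : (forall i, t i != 0) -> torus (diag_gl t).
Proof. by move=> t0; rewrite /torus /= diag_glE // diag_mx_is_diag. Qed.

Lemma torus_diag_gl g : torus g -> exists2 t, (forall i, t i != 0) & g = diag_gl t.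
Proof.
move=> /is_diag_mxP gd; have gE : glmx g = diag_mx (\row_i glmx g i i).
  apply/matrixP => i j; rewrite !mxE; case: eqP => [->//|/eqP ij].
  by rewrite mulr0n gd.
have t0 i : glmx g i i != 0.
  have : diag_mx (\row_i glmx g i i) \in unitmx by rewrite -gE glmxP.
  by rewrite unitmxE unitfE det_diag => /prodf_neq0/(_ i isT); rewrite mxE.
by exists (fun i => glmx g i i) => //; apply: glmx_inj; rewrite diag_glE.
Qed.

Lemma diag_gl_mull t g i j : (forall i, t i != 0) -> glmx (diag_gl t * g)%g i j = t i * glmx g i j.
Proof. by move=> t0; rewrite glmxM diag_glE // mul_diag_mx !mxE. Qed.

Lemma diag_gl_mulr t g i j : (forall i, t i != 0) -> glmx (g * diag_gl t)%g i j = glmx g i j * t j.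
Proof. by move=> t0; rewrite glmxM diag_glE // mul_mx_diag !mxE. Qed.

Lemma diag_glV t : (forall i, t i != 0) -> ((diag_gl t)^-1)%g = diag_gl (fun i => (t i)^-1).
Proof.
move=> t0; have t0' i : (t i)^-1 != 0 by rewrite invr_eq0.
apply: (mulgI (diag_gl t)); rewrite mulgV; apply/glmx_inj/matrixP => i j.
rewrite diag_gl_mull // diag_glE // !mxE; case: eqP => [->|]; rewrite ?mulr0n ?mulr0 //.
by rewrite mulr1n mulfV.
Qed.

Lemma diag_gl_conj t g i j : (forall i, t i != 0) ->
  glmx (diag_gl t * g * (diag_gl t)^-1)%g i j = t i * glmx g i j / t j.
Proof.
by move=> t0; rewrite diag_glV // diag_gl_mulr ?diag_gl_mull // => k; rewrite invr_eq0.
Qed.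

Lemma torus_upper g : torus g -> upper_borel g.
Proof.
move=> /is_diag_mxP gd; apply/upper_borelE => i j ij.
by apply: gd; rewrite neq_ltn ij orbT.
Qed.
End Elementary.

(** * Stabilizers and normal forms *)

Section Curves.
Variables (K : closedFieldType) (n : nat).
Local Notation GL := (GL K n).
Implicit Types (g h b : GL).

Definition curve (c : K -> GL) := forall i j, pfun (fun s => glmx (c s) i j).

Lemma curve_poly c f : curve c -> gl_poly f -> pfun (fun s => f (c s)).
Proof.
move=> pc [p pf]; under eq_fun do rewrite pf /gl_eval.
apply: (fa_meval (pfun_alg K)) => k; case/mxvec_indexP: k => i j.
by under eq_fun do rewrite mxvecE; exact: pc.
Qed.

Lemma curve_cst g : curve (fun=> g).
Proof. by move=> i j; exact: (fa_cst (pfun_alg K)). Qed.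

Lemma curveM c d : curve c -> curve d -> curve (fun s => c s * d s)%g.
Proof. by move=> pc pd; apply: (fa_mulmx (pfun_alg K)). Qed.

Lemma curve_elem i j : i != j -> curve (elem_gl i j : K -> GL).
Proof.
move=> ij k l; under eq_fun do rewrite elem_glE // !mxE.
apply: (fa_add (pfun_alg K)); first exact: (fa_cst (pfun_alg K)).
apply: (fa_mul (pfun_alg K)); first exact: pfun_id.
exact: (fa_cst (pfun_alg K)).
Qed.

(** A polynomial nonzero at [c a] is nonzero at [c s] for almost all [s], so every neighbourhood of
    the limit meets [Z]. *)
Lemma curve_closure c (Z : set (Fl K n)) a : curve c ->
  cofin (fun s => Z (flag_of (c s))) -> closure Z (flag_of (c a)).
Proof.
move=> pc cZ B nB.
have /nbhs_glP[f pf [fc fB]] : nbhs (c a) (@flag_of K n @^-1` B).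
  exact: flag_of_continuous.
have [s [Zs fs]] := cofin_ex (cofinI cZ (pfun_cofin (curve_poly pc pf) fc)).
by exists (flag_of (c s)); split=> //; apply: fB.
Qed.
End Curves.

Section Stabilizer.
Variables (K : closedFieldType) (n : nat).
Local Notation GL := (GL K n).
Variables (w : 'S_n) (x0 x1 : 'I_n).
Hypothesis x01 : x1 = x0.+1 :> nat.
Implicit Types (g h b p : GL).

Let ne01 : x0 != x1. Proof. by rewrite -val_eqE /= x01 neq_ltn ltnSn. Qed.
Let ne10 : x1 != x0. Proof. by rewrite eq_sym ne01. Qed.

(** The minimal parabolic subgroup of the simple root [(x0, x1)]. *)
Definition parab p := forall i j : 'I_n, (j < i)%N -> ~~ ((i == x1) && (j == x0)) ->
  glmx p i j = 0.

Lemma weyl_elem (v : 'S_n) i j (a : K) : i != j ->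
  (weyl K v * elem_gl i j a)%g = (elem_gl (v i) (v j) a * weyl K v)%g.
Proof.
move=> ij; have vij : v i != v j by rewrite (inj_eq perm_inj).
apply/glmx_inj/matrixP => k l; rewrite !glmxM !elem_glE // elem_mx_mull elem_mx_mulr.
rewrite !mxE !(inj_eq perm_inj); congr (_ + _).
by rewrite mulrCA [RHS]mulrCA; congr (_ * _); rewrite mulrC [j == l]eq_sym.
Qed.

Lemma parab_decomp p : parab p -> glmx p x1 x1 != 0 ->
  exists2 b, upper_borel b & exists a, p = (b * elem_gl x1 x0 a)%g.
Proof.
move=> pp p11; set a := glmx p x1 x0 / glmx p x1 x1.
exists (p * elem_gl x1 x0 (- a))%g; last first.
  by exists a; rewrite -mulgA elem_glD // addNr elem_gl0 mulg1.
apply/upper_borelE => i j ji; rewrite glmxM elem_glE // elem_mx_mulr.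
have [/andP[/eqP -> /eqP ->]|nij] := boolP ((i == x1) && (j == x0)).
  by rewrite eqxx mul1r mulNr divfK // subrr.
rewrite pp // add0r; have [jx|] := eqVneq j x0; last by rewrite mul0r.
rewrite jx in ji nij *; rewrite mul1r pp ?mulr0 //.
  by move: nij; rewrite eqxx andbT -val_eqE /=; lia.
by rewrite [x1 == x0]eq_sym (negbTE ne01) andbF.
Qed.

Hypothesis wdesc : ((w^-1)%g x1 < (w^-1)%g x0)%N.

(** Since [w] takes the value [x1] before [x0], moving the lower root element across [w] makes it
    upper triangular, and the projection absorbs it. *)
Lemma parab_cell p : parab p -> glmx p x1 x1 != 0 ->
  exists2 b, upper_borel b & flag_of (p * weyl K w)%g = flag_of (b * weyl K w)%g.
Proof.
move=> pp p11; have [b ub [a ->]] := parab_decomp pp p11; exists b => //.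
rewrite -mulgA -[in elem_gl x1 x0 a](permKV w x1) -[in elem_gl _ x0 a](permKV w x0).
rewrite -weyl_elem ?(inj_eq perm_inj) // mulgA //.
by apply: flag_of_mulB; exact: elem_upper.
Qed.

(** [parab_cell] misses the elements whose [(x1, x1)] entry is zero. They are reached as limits
    along a curve having one good point. *)
Lemma parab_curve c a s : curve c -> (forall s, parab (c s)) -> glmx (c a) x1 x1 != 0 ->
  schubert K w (flag_of (c s * weyl K w)%g).
Proof.
move=> pc pp ca; apply: (@curve_closure _ _ (fun s => c s * weyl K w)%g).
  exact: curveM (curve_cst _).
apply: cofin_sub (pfun_cofin (pc x1 x1) ca) => t ct.
have [b ub ->] := parab_cell (pp t) ct.
by exists b => //; rewrite flag_actE.
Qed.

Lemma elem_parab a b : upper_borel b -> parab (elem_gl x1 x0 a * b)%g.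
Proof.
move=> /upper_borelE ub i j ji nij; rewrite glmxM elem_glE // elem_mx_mull ub // add0r.
case: eqP => [ix|_]; last by rewrite mul0r.
rewrite ub ?mulr0 ?mul1r //; move: nij; rewrite ix eqxx -val_eqE /=.
by move: ji; rewrite ix; lia.
Qed.

Definition swap_gl : GL := weyl K (tperm x0 x1).

Lemma swap_glE p i j : glmx (swap_gl * p)%g i j = glmx p (tperm x0 x1 i) j.
Proof.
rewrite glmxM -[LHS]/((perm_mxK K (tperm x0 x1) *m glmx p) i j).
by rewrite -{1}(tpermK x0 x1 i) perm_mxKE.
Qed.

Lemma swap_gl_invol : (swap_gl * swap_gl = 1)%g.
Proof.
apply/glmx_inj/matrixP => i j; rewrite swap_glE !mxE (inj_eq perm_inj) //.
Qed.

Lemma swap_parab b : upper_borel b -> parab (swap_gl * b)%g.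
Proof.
move=> /upper_borelE ub i j ji nij; rewrite swap_glE; apply: ub.
case: tpermP => [ix|ix|//]; last by move: nij; rewrite ix eqxx -val_eqE /=; move: ji; rewrite ix; lia.
by rewrite x01 -ix ltnW.
Qed.

Lemma elem_stable a x : schubert K w x -> schubert K w (flag_act (elem_gl x1 x0 a) x).
Proof.
apply: schubert_closed_act => b ub.
apply: (@parab_curve (fun s => elem_gl x1 x0 s * b)%g 0).
- by apply: curveM; [exact: curve_elem|exact: curve_cst].
- by move=> s; exact: elem_parab.
- rewrite elem_gl0 mul1g; have := glmxP b; have /upper_borelE ub' := ub.
  by rewrite (htri_unitE (@ord_inj n) ub') => /forallP.
Qed.

Lemma swap_stable x : schubert K w x -> schubert K w (flag_act swap_gl x).
Proof.
apply: schubert_closed_act => b ub; have /upper_borelE ub' := ub.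
have b11 : glmx b x1 x1 != 0.
  by have := glmxP b; rewrite (htri_unitE (@ord_inj n) ub') => /forallP.
have ue s : upper_borel (elem_gl x0 x1 s * b)%g.
  by apply: upper_borelM => //; apply: elem_upper; rewrite x01.
have -> : (swap_gl * b)%g = (swap_gl * (elem_gl x0 x1 0 * b))%g by rewrite elem_gl0 mul1g.
have E s : glmx (swap_gl * (elem_gl x0 x1 s * b))%g x1 x1 = glmx b x0 x1 + s * glmx b x1 x1.
  by rewrite swap_glE tpermR glmxM elem_glE // elem_mx_mull eqxx mul1r.
(* At parameter 0 the required entry may vanish; as [b x1 x1] is nonzero, parameter 1 then works. *)
have [a aP] : exists a, glmx b x0 x1 + a * glmx b x1 x1 != 0.
  have [z|nz] := eqVneq (glmx b x0 x1) 0; first by exists 1; rewrite z add0r mul1r.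
  by exists 0; rewrite mul0r addr0.
apply: (@parab_curve (fun s => swap_gl * (elem_gl x0 x1 s * b))%g a).
- apply: curveM; first exact: curve_cst.
  by apply: curveM; [exact: curve_elem|exact: curve_cst].
- by move=> s; exact: swap_parab.
- by rewrite E.
Qed.

Lemma stabilizerP g : (forall x, schubert K w x -> schubert K w (flag_act g x)) ->
  (forall x, schubert K w x -> schubert K w (flag_act (g^-1)%g x)) ->
  stabilizer flag_act (schubert K w) g.
Proof.
move=> Hg Hg'; apply/seteqP; split=> [_ [x Xx <-]|x Xx]; first exact: Hg.
by exists (flag_act (g^-1)%g x); [exact: Hg'|rewrite -flag_actM mulgV flag_act1].
Qed.

Lemma borel_stabilizer b : upper_borel b -> stabilizer flag_act (schubert K w) b.
Proof.
by move=> ub; apply: stabilizerP => x; apply: borel_stable => //; exact: upper_borelV.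
Qed.

Lemma elem_stabilizer a : stabilizer flag_act (schubert K w) (elem_gl x1 x0 a).
Proof. by apply: stabilizerP => x; rewrite ?elem_glV //; exact: elem_stable. Qed.
End Stabilizer.

(** * Normal forms and finiteness of the orbits *)

Section Orbits.
Variables (K : closedFieldType) (n : nat).
Local Notation GL := (GL K n).
Implicit Types (g h b p : GL) (c : 'S_n).

Definition std_mx (S : {ffun 'I_n * 'I_n -> bool}) : 'M[K]_n :=
  \matrix_(i, j) if i == j then 1 else (S (i, j))%:R.
Definition std_rep c S : GL := toGL (perm_mxK K c *m std_mx S).

Lemma inv_unip_lower c (u : 'M[K]_n) : inv_unip c u -> lower_unip u.
Proof.
move=> iu i j ij; rewrite iu; case: eqP => // /eqP ne.
by rewrite ltnNge ij.
Qed.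

Lemma perm_mxK_unit c : perm_mxK K c \in unitmx.
Proof. exact: (glmxP (weyl K c)). Qed.

(** [forest_solve] writes each nonzero [u b a] as [t b / t a], so [u] is the conjugate by [t] of a
    matrix of zeros and ones. The right factor lies in the Borel group, the left one crosses [c]
    with permuted entries. *)
Lemma torus_std c (u : 'M[K]_n) : boolean_perm c -> inv_unip c u ->
  exists2 t, torus t & exists S, forall g, glmx g = perm_mxK K c *m u ->
    flag_of g = flag_act t (flag_of (std_rep c S)).
Proof.
move=> cB iu; have lu := inv_unip_lower iu.
pose S : {ffun 'I_n * 'I_n -> bool} := [ffun p => u p.1 p.2 != 0].
pose l (a b : 'I_n) := if u b a == 0 then 1 else u b a.
have l0 (a b : 'I_n) : l a b != 0 by rewrite /l; case: ifP => [_|/negbT//]; rewrite oner_neq0.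
have [t t0 tP] := forest_solve cB l0.
have t0' i : t i != 0 by [].
pose t' (i : 'I_n) := t ((c^-1)%g i).
have t'0 i : t' i != 0 by apply: t0.
exists (diag_gl t'); first exact: diag_gl_torus.
exists S => g gE; rewrite flag_actE.
have lS : lower_unip (std_mx S).
  move=> i j ij; rewrite mxE; case: eqP => // /eqP ne.
  by rewrite ffunE /= lu // (negbTE ne) eqxx.
have sE : glmx (std_rep c S) = perm_mxK K c *m std_mx S.
  by rewrite toGLE // unitmx_mul perm_mxK_unit lower_unip_unit.
apply/flag_of_eq; exists (diag_gl t); first exact/torus_upper/diag_gl_torus.
apply/glmx_inj/matrixP => i j; rewrite diag_gl_mull // diag_gl_mulr // gE sE.
rewrite -(permKV c i) !perm_mxKE /t' permK; move: ((c^-1)%g i) => {}i.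
rewrite mxE ffunE /= /=; case: eqP => [->|/eqP ne].
  by rewrite lu // eqxx mul1r mulr1.
have [uij|uij] := eqVneq (u i j) 0; first by rewrite uij mulr0 mul0r.
have /andP[ji cij] : (j < i)%N && (c i < c j)%N.
  by apply: contraNT uij => /negbTE h; rewrite iu (negbTE ne) h.
by rewrite (tP j i) // /l (negbTE uij) mulr1.
Qed.

Variables (w : 'S_n) (x0 x1 : 'I_n).
Hypothesis x01 : x1 = x0.+1 :> nat.
Hypothesis wB : K22_bounds w x0.

Let ne01 : x0 != x1. Proof. by rewrite -val_eqE /= x01 neq_ltn ltnSn. Qed.
Let ne10 : x1 != x0. Proof. by rewrite eq_sym ne01. Qed.

Lemma swap_torus t : torus t -> torus (swap_gl K x0 x1 * t * swap_gl K x0 x1)%g.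
Proof.
move=> /torus_diag_gl[t' t0 ->].
have t0' i : t' (tperm x0 x1 i) != 0 by [].
suff -> : (swap_gl K x0 x1 * diag_gl t' * swap_gl K x0 x1)%g = diag_gl (fun i => t' (tperm x0 x1 i)).
  exact: diag_gl_torus.
apply/glmx_inj/matrixP => i j; rewrite -mulgA swap_glE diag_gl_mull // diag_glE // !mxE.
by rewrite (inj_eq perm_inj); case: eqP => _; rewrite ?mulr1 ?mulr0.
Qed.

Lemma schubert_normal x : schubert K w x ->
  exists s t c S e, torus t /\
    x = flag_act (elem_gl x0 x1 s * t)%g
          (flag_of ((if e then swap_gl K x0 x1 else 1) * std_rep c S)%g).
Proof.
elim/flag_ofW: x => g0.
have [v [u [b [ub b_unit iu gE]]]] := canonical_form (glmxP g0).
have [g [-> {}gE]] : exists g : GL, flag_of g0 = flag_of g /\ glmx g = perm_mxK K v *m u.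
  exists (g0 * MkGL b_unit)%g; split=> //.
  by rewrite flag_of_mulB //; apply/upper_borelE.
move=> Xg {g0 b ub b_unit}.
have lu := inv_unip_lower iu.
have vB := schubert_K22_bounds Xg gE lu wB.
have [lt|le] := ltnP ((v^-1)%g x0) ((v^-1)%g x1).
  have vb : boolean_perm v.
    by apply: (K22_boundsW vB x01 (permKV v x0) (permKV v x1) lt); left.
  have [t Tt [S gS]] := torus_std vb iu.
  exists 0, t, v, S, false; split=> //.
  by rewrite elem_gl0 !mul1g; exact: gS.
have {}lt : ((v^-1)%g x1 < (v^-1)%g x0)%N.
  by rewrite ltn_neqAle le andbT val_eqE (inj_eq perm_inj).
set a0 := (v^-1)%g x1 in lt; set d0 := (v^-1)%g x0 in lt.
have va : v a0 = x1 by rewrite permKV.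
have vd : v d0 = x0 by rewrite permKV.
pose c := (v * tperm x0 x1)%g.
have vc : v = (c * tperm x0 x1)%g by rewrite /c -mulgA tperm2 mulg1.
have ca : c a0 = x0 by rewrite permM va tpermR.
have cd : c d0 = x1 by rewrite permM vd tpermL.
have cb : boolean_perm c.
  by apply: (K22_boundsW vB x01 ca cd lt); right.
(* The root group kills the coordinate on the edge [(a0, d0)], the one inversion of [v] lost in [c].
   What remains is supported on the inversions of [c]. *)
pose s := u d0 a0; pose u1 := elem_mx d0 a0 (- s) *m u.
have dane : d0 != a0 by rewrite -val_eqE neq_ltn lt orbT.
have iu1 : inv_unip c u1.
  have uz (i j : 'I_n) : i != j -> ~~ ((j < i)%N && (v i < v j)%N) -> u i j = 0.
    by move=> ne /negbTE h; rewrite iu (negbTE ne) h.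
  have cvE (y : 'I_n) : (c y = v y :> nat /\ (v y <> x0 :> nat) /\ (v y <> x1 :> nat)) \/
      (c y = x1 :> nat /\ v y = x0 :> nat) \/ (c y = x0 :> nat /\ v y = x1 :> nat).
    rewrite permM; case: tpermP => [->|->|h1 h2]; [by right; left|by right; right|left].
    by split=> //; split=> /ord_inj.
  move=> i j; case: eqP => [<-|/eqP ne].
    rewrite elem_mx_mull lu // eqxx; case: eqP => [->|_]; last by rewrite mul0r addr0.
    by rewrite lu ?(ltnW lt) // [a0 == d0]eq_sym (negbTE dane) !mulr0 addr0.
  case: ifP => // /negbT nij; rewrite elem_mx_mull.
  have vinj := perm_nE v.
  have [id|id] := eqVneq i d0; last first.
    rewrite mul0r addr0 uz //; apply: contraNN nij => /andP[-> vij] /=.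
    have := cvE i; have := cvE j; have := vinj i d0; rewrite vd.
    by move: id; rewrite -val_eqE /=; lia.
  rewrite mul1r; have [->|ja] := eqVneq j a0.
    by rewrite id (lu a0 a0 (leqnn _)) eqxx mulr1 subrr.
  have vj : v j <> x1 :> nat.
    by rewrite -va => /vinj/ord_inj e; rewrite e eqxx in ja.
  have cid : c i = x1 by rewrite id.
  rewrite !uz ?mulr0 ?addr0 // ?[a0 == j]eq_sym //.
    apply: contraNN nij => /andP[jlt vij]; rewrite cid.
    by have := cvE j; move: jlt vij; rewrite va ?id; lia.
  apply: contraNN nij => /andP[-> vij]; rewrite cid.
  by have := cvE j; move: vij; rewrite id vd; lia.
have uu1 : u1 \in unitmx by apply/lower_unip_unit/inv_unip_lower/iu1.
have {}uu1 : perm_mxK K c *m u1 \in unitmx by rewrite unitmx_mul perm_mxK_unit.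
have [t Tt [S gS]] := torus_std cb iu1.
exists s, (swap_gl K x0 x1 * t * swap_gl K x0 x1)%g, c, S, true; split; first exact: swap_torus.
have gE1 : (elem_gl x0 x1 (- s) * g)%g = (swap_gl K x0 x1 * toGL (perm_mxK K c *m u1))%g.
  apply/glmx_inj/matrixP => i j; rewrite swap_glE toGLE //.
  rewrite glmxM elem_glE // elem_mx_mull gE -(permKV v i); move: ((v^-1)%g i) => {}i.
  have -> : (perm_mxK K v *m u) x1 j = u a0 j by rewrite -[in LHS]va perm_mxKE.
  have -> : tperm x0 x1 (v i) = c i by rewrite permM.
  rewrite !perm_mxKE elem_mx_mull; congr (_ + (_ : bool)%:R * _).
  by rewrite -[RHS](inj_eq (@perm_inj _ v)) vd.
have -> : flag_of g = flag_act (elem_gl x0 x1 s) (flag_of (elem_gl x0 x1 (- s) * g)%g).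
  by rewrite flag_actE mulgA elem_glD // addrN elem_gl0 mul1g.
rewrite gE1 flag_actM; congr flag_act.
rewrite flag_actE !mulgA -[(_ * _ * swap_gl K x0 x1 * swap_gl K x0 x1)%g]mulgA swap_gl_invol mulg1.
rewrite -mulgA -!flag_actE; congr flag_act; rewrite flag_actE -flag_actE; apply: gS.
by rewrite toGLE.
Qed.
End Orbits.

Section Subgroup.
Variables (G : groupType) (H : set G).
Hypothesis sH : is_subgroup H.

Lemma subgroup1 : H 1%g. Proof. by case: sH. Qed.
Lemma subgroupV x : H x -> H (x^-1)%g.
Proof. by move=> Hx; rewrite -[(x^-1)%g]mul1g; apply: (proj2 sH) => //; exact: subgroup1. Qed.
Lemma subgroupM x y : H x -> H y -> H (x * y)%g.
Proof. by move=> Hx Hy; rewrite -[y]invgK; apply: (proj2 sH) => //; exact: subgroupV. Qed.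
End Subgroup.

Section FiniteOrbits.
Variables (K : closedFieldType) (n : nat).
Local Notation GL := (GL K n).
Variables (w : 'S_n) (x0 x1 : 'I_n).
Hypothesis x01 : x1 = x0.+1 :> nat.
Hypothesis wB : K22_bounds w x0.
Hypothesis wdesc : ((w^-1)%g x1 < (w^-1)%g x0)%N.

Let ne01 : x0 != x1. Proof. by rewrite -val_eqE /= x01 neq_ltn ltnSn. Qed.
Let ne10 : x1 != x0. Proof. by rewrite eq_sym ne01. Qed.

Lemma orbit_eq (H : set GL) h y : is_subgroup H -> H h ->
  [set flag_act k (flag_act h y) | k in H] = [set flag_act k y | k in H].
Proof.
move=> sH Hh; apply/seteqP; split=> _ [k Hk <-].
  by exists (k * h)%g; rewrite ?flag_actM //; exact: subgroupM.
exists (k * h^-1)%g; first by apply: subgroupM => //; exact: subgroupV.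
by rewrite -flag_actM mulgKV.
Qed.

(** With the negative root group, the normal form is applied to the image of the point under
    [swap_gl], which stabilizes the Schubert variety, and is then conjugated back. *)
Lemma orbits_finite (H : set GL) : is_subgroup H -> torus `<=` H ->
  (forall a, H (elem_gl x0 x1 a)) \/ (forall a, H (elem_gl x1 x0 a)) ->
  finitely_many_orbits flag_act H (schubert K w).
Proof.
move=> sH TH He.
pose T := ('S_n * {ffun 'I_n * 'I_n -> bool} * bool)%type.
pose pt (p : T) := flag_of ((if p.2 then swap_gl K x0 x1 else 1%g) * std_rep K p.1.1 p.1.2)%g.
pose orb y := [set flag_act h y | h in H].
case: He => He.
  apply: (@sub_finite_set _ _ [set orb (pt p) | p in [set: T]]); last first.
    by apply: finite_image; exact: finite_finset.
  move=> _ [x Xx ->].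
  have [s [t [c [S [e [Tt ->]]]]]] := schubert_normal x01 wB Xx.
  exists (c, S, e) => //; apply/esym/orbit_eq => //.
  by apply: subgroupM => //; exact: TH.
apply: (@sub_finite_set _ _ [set orb (flag_act (swap_gl K x0 x1) (pt p)) | p in [set: T]]);
  last by apply: finite_image; exact: finite_finset.
move=> _ [x Xx ->].
have [s [t [c [S [e [Tt E]]]]]] := schubert_normal x01 wB (swap_stable x01 wdesc Xx).
exists (c, S, e) => //.
have -> : x = flag_act (elem_gl x1 x0 s * (swap_gl K x0 x1 * t * swap_gl K x0 x1))%g
     (flag_act (swap_gl K x0 x1) (pt (c, S, e))).
  rewrite -[LHS]flag_act1 -(swap_gl_invol K x0 x1) flag_actM E -!flag_actM; congr flag_act.
  have -> : (swap_gl K x0 x1 * (elem_gl x0 x1 s * t) = elem_gl x1 x0 s * swap_gl K x0 x1 * t)%g.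
    by rewrite mulgA weyl_elem // tpermL tpermR.
  by rewrite -!mulgA swap_gl_invol mulg1.
apply/esym/orbit_eq => //; apply: subgroupM => //; apply: TH; exact: swap_torus.
Qed.
End FiniteOrbits.

Section ComplexityZero.
Variables (K : fieldType) (X : topologicalType) (reg : X -> set (X -> K)).
Variables (G : groupType) (act : G -> X -> X).
Variables (H : set G) (Y : set X).

(** An invariant function takes one value on each orbit, so it is a root of the product of the
    [X - v O] over the finitely many orbits and cannot be transcendental. *)
Lemma finitely_many_orbits_complexity0 : Y !=set0 -> is_subgroup H ->
  (forall x, act 1%g x = x) ->
  finitely_many_orbits act H Y -> complexity_is reg act H Y 0.
Proof.
move=> [y0 Yy0] sH act1 fin; split.
  have F : 'I_0 -> ratfun reg Y by case.
  exists F => [[]//|p /(_ y0 Yy0)].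
  have pE : p = mpolyC 0 (mcoeff mnm0 p).
    by apply/mpolyP => m; rewrite mcoeffC (_ : m = mnm0) ?eqxx ?mulr1 //; apply/mnmP; case.
  move=> H0; have : meval (fun i => ratval (F i) y0) p = 0 by apply: H0; case.
  by rewrite pE mevalC => ->; rewrite mpolyC0.
move=> [//|m] f fH find; exfalso.
pose g := f ord0; pose orb x := [set act h x | h in H].
have /choice[v vP] : forall O : set X, exists v : K,
    forall x, Y x -> Defs.dom g x -> O = orb x -> ratval g x = v.
  move=> O; have [[x [Yx gx Ox]]|nO] := pselect (exists x, [/\ Y x, Defs.dom g x & O = orb x]).
    exists (ratval g x) => y Yy gy Oy.
    have : orb y y by exists 1%g => //; exact: subgroup1.
    rewrite -Oy Ox => -[h Hh hxy].
    by rewrite -hxy in gy *; exact: (fH ord0).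
  by exists 0 => x Yx gx Ox; case: nO; exists x.
have [s sE] := (finite_seqP _).1 fin.
pose p : mpoly m.+1 K := \prod_(O <- s) (mpolyX K (mnm1 ord0) - mpolyC _ (v O)).
have p0 : p = 0.
  apply: find => x Yx dx; rewrite /p rmorph_prod /=.
  have Os : orb x \in s.
    by have : [set` s] (orb x) by rewrite -sE; exists x.
  rewrite (perm_big _ (perm_to_rem Os)) big_cons /= mevalB mevalXU mevalC.
  by rewrite (vP (orb x) x) ?subrr ?mul0r //; exact: dx.
have /eqP := p0; rewrite /p prodf_seq_eq0 => /hasP[O _ /= /eqP /(congr1 (mcoeff (mnm1 ord0)))].
rewrite mcoeffB mcoeff0 mcoeffX eqxx mcoeffC mnm1_eq0 mulr0 subr0 => /eqP.
by rewrite oner_eq0.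
Qed.
End ComplexityZero.

(** * Levi and Borel subgroups *)

Section Levi.
Variables (K : closedFieldType) (n : nat).
Local Notation GL := (GL K n).
Variables (i0 j0 : 'I_n).
Hypothesis ij : i0 != j0.
Implicit Types (g h u : GL) (A B : 'M[K]_n).

Let ji : j0 != i0. Proof. by rewrite eq_sym. Qed.

Definition blocky A := forall i j, i \in [:: i0; j0] -> j \notin [:: i0; j0] -> A i j = 0.


Let i0in : i0 \in [:: i0; j0]. Proof. by rewrite inE eqxx. Qed.
Let j0in : j0 \in [:: i0; j0]. Proof. by rewrite !inE eqxx orbT. Qed.

Lemma blocky_mul A B i j : blocky A -> i \in [:: i0; j0] ->
  (A *m B) i j = A i i0 * B i0 j + A i j0 * B j0 j.
Proof.
move=> bA ii; rewrite mxE (bigD1 i0) //= (bigD1 j0) //= big1 ?addr0 // => l /andP[l1 l2].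
by rewrite bA ?mul0r // !inE negb_or l1.
Qed.

(* A nilpotent matrix stabilizing the plane spanned by the rows [i0] and [j0] has only
   the eigenvalue [0] on it. *)
Lemma blocky_nilp A k : blocky A -> A ^+ k = 0 ->
  A i0 i0 + A j0 j0 = 0 /\ A i0 i0 * A j0 j0 = A i0 j0 * A j0 i0.
Proof.
move=> bA Ak; set x := A i0 i0; set q := A i0 j0; set r := A j0 i0; set s := A j0 j0.
have root0 l : l ^+ 2 = (q * r - x * s) + (x + s) * l -> l = 0.
  move=> rl.
  (* A left eigenvector of the block for [l]: [(r, l - x)] or [(l - s, q)], unless both vanish and
     the block is scalar. *)
  have [al [be [ab0 e1 e2]]] : exists al be, [/\ (al, be) <> (0, 0),
      al * x + be * r = l * al & al * q + be * s = l * be].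
    have [nz|/negPn/andP[/eqP r0 /eqP lx]] := boolP (~~ ((r == 0) && (l - x == 0))).
      exists r, (l - x); split; first by case=> r0 lx; rewrite r0 lx eqxx in nz.
        by ring.
      by rewrite mulrBr -expr2 rl; ring.
    have [nz|/negPn/andP[/eqP ls /eqP q0]] := boolP (~~ ((l - s == 0) && (q == 0))).
      exists (l - s), q; split; first by case=> r0' lx'; rewrite r0' lx' eqxx in nz.
        by rewrite mulrBr -expr2 rl; ring.
      by ring.
    exists 1, 0; split; first by case=> /eqP; rewrite oner_eq0.
      by rewrite mul0r addr0 mul1r mulr1; apply/esym/eqP; rewrite -subr_eq0 lx.
    by rewrite q0 !mulr0 mul0r addr0.
  pose v : 'rV[K]_n := al *: delta_mx 0 i0 + be *: delta_mx 0 j0.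
  have vA j : (v *m A) 0 j = al * A i0 j + be * A j0 j.
    rewrite mulmxDl -!scalemxAl !mxE; congr (_ * _ + _ * _).
      rewrite (bigD1 i0) //= mxE !eqxx mul1r big1 ?addr0 // => m mi.
      by rewrite mxE (negbTE mi) andbF mul0r.
    rewrite (bigD1 j0) //= mxE !eqxx mul1r big1 ?addr0 // => m mi.
    by rewrite mxE (negbTE mi) andbF mul0r.
  have vE : v *m A = l *: v.
    apply/rowP => j; rewrite vA !mxE !eqxx /=.
    have [->|ji0] := eqVneq j i0.
      by rewrite (negbTE ij) mulr1 mulr0 addr0.
    have [->|jj0] := eqVneq j j0; first by rewrite mulr1 mulr0 add0r.
    by rewrite !bA ?mulr0 ?addr0 ?mulr0 // !inE negb_or ji0.
  have vk : v *m (A ^+ k) = l ^+ k *: v.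
    elim: (k) => [|m IH]; first by rewrite !expr0 mulmx1 scale1r.
    by rewrite exprS -[A * _]/(A *m _) mulmxA vE -scalemxAl IH scalerA -exprS.
  have : l ^+ k *: v = 0 by rewrite -vk Ak mulmx0.
  move=> /eqP; rewrite scaler_eq0 => /orP[|/eqP v0].
    by rewrite expf_eq0 => /andP[_ /eqP].
  case: ab0; congr (_, _).
    by move/rowP: v0 => /(_ i0); rewrite !mxE !eqxx (negbTE ij) /= mulr1 mulr0 addr0.
  by move/rowP: v0 => /(_ j0); rewrite !mxE !eqxx (negbTE ji) /= mulr1 mulr0 add0r.
(* The characteristic polynomial of the block. Its root is 0, which kills the determinant; then the
   trace is also a root. *)
pose P (i : nat) := if i == 0%N then q * r - x * s else x + s.
have [l lP] := @solve_monicpoly K 2 P isT.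
have l2 : l ^+ 2 = (q * r - x * s) + (x + s) * l.
  by rewrite lP big_ord_recl big_ord1 /P /= expr0 mulr1 expr1.
have l0 := root0 l l2; rewrite l0 expr0n mulr0 addr0 /= in l2.
split; first by apply: root0; rewrite -l2; ring.
by apply/esym/eqP; rewrite -subr_eq0 -l2.
Qed.

(** All blocks of elements of [U] have trace 2, in particular those of [u] times its conjugates. A
    torus conjugate gives [q * r * (c - 1) ^+ 2 = 0], hence diagonal entries 1; the two elementary
    conjugates then give [r ^+ 2 = 0] and [q ^+ 2 = 0]. *)
Lemma unipotent_block (U : set GL) : is_subgroup U -> is_unipotent U ->
  (forall u, U u -> blocky (glmx u)) ->
  (forall u a, U u -> U (u ^ elem_gl i0 j0 a)%g) ->
  (forall u a, U u -> U (u ^ elem_gl j0 i0 a)%g) ->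
  (forall u t, U u -> torus t -> U (u ^ t)%g) ->
  forall u, U u -> [/\ glmx u i0 i0 = 1, glmx u j0 j0 = 1, glmx u i0 j0 = 0 & glmx u j0 i0 = 0].
Proof.
move=> sU uU bU Uij Uji UT.
have nil u : U u -> glmx u i0 i0 + glmx u j0 j0 = 2 /\
    (glmx u i0 i0 - 1) * (glmx u j0 j0 - 1) = glmx u i0 j0 * glmx u j0 i0.
  move=> Uu; have [k uk] := uU u Uu.
  have bu : blocky (glmx u - 1).
    move=> i j hi hj; rewrite !mxE bU //; case: eqP hj => [<-|]; first by rewrite hi.
    by rewrite subr0.
  have [] := blocky_nilp bu uk; rewrite !mxE !eqxx (negbTE ij) (negbTE ji) /= !subr0.
  by move=> h1 h2; split=> //; apply/eqP; rewrite -subr_eq0 -h1; apply/eqP; ring.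
have tr u v : U u -> U v -> glmx u i0 i0 * glmx v i0 i0 + glmx u i0 j0 * glmx v j0 i0 +
   (glmx u j0 i0 * glmx v i0 j0 + glmx u j0 j0 * glmx v j0 j0) = 2.
  move=> Uu Uv; have [<- _] := nil _ (subgroupM sU Uu Uv).
  by rewrite glmxM !blocky_mul //; exact: bU.
move=> u Uu; have [n1 n2] := nil u Uu.
set p := glmx u i0 i0 in n1 n2 *; set s := glmx u j0 j0 in n1 n2 *.
set q := glmx u i0 j0 in n1 n2 *; set r := glmx u j0 i0 in n1 n2 *.
have sE : s = 2 - p by rewrite -n1; ring.
have qr : q * r = - (p - 1) ^+ 2 by rewrite -n2 sE; ring.
have [c [c0 c1]] : exists c : K, c != 0 /\ c != 1.
  exact: cofin_ex (cofinI (cofin_neq 0) (cofin_neq 1)).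
pose t (i : 'I_n) := if i == i0 then c^-1 else 1.
have t0 i : t i != 0 by rewrite /t; case: ifP => _; rewrite ?invr_eq0 ?oner_neq0.
have ut i j : glmx (u ^ (diag_gl t)^-1)%g i j = t i * glmx u i j / t j.
  by rewrite conjgE invgK mulgA diag_gl_conj.
have tT : torus (diag_gl t)^-1%g.
  by rewrite diag_glV //; apply: diag_gl_torus => i; rewrite invr_eq0.
have e1 : p * p + q * (r * c) + (r * (c^-1 * q) + s * s) = 2.
  rewrite -(tr _ _ Uu (UT _ _ Uu tT)) !ut /t eqxx (negbTE ji) -/p -/q -/r -/s.
  by rewrite !invrK !invr1 !mul1r !mulr1 mulrAC mulVf ?mul1r.
have qr0 : q * r = 0.
  have : q * r * (c - 1) ^+ 2 = 0.
    transitivity (c * (p * p + q * (r * c) + (r * (c^-1 * q) + s * s) - 2) -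
       2 * c * (q * r + (p - 1) ^+ 2)); first by rewrite sE; field.
    by rewrite e1 qr; ring.
  by move/eqP; rewrite mulf_eq0 expf_eq0 /= subr_eq0 (negbTE c1) orbF => /eqP.
have p1 : p = 1.
  by apply/eqP; rewrite -subr_eq0 -sqrf_eq0 -[X in X == _]opprK -qr qr0 oppr0.
have s1 : s = 1 by rewrite sE p1; ring.
have conjE (i j : 'I_n) (ne : i != j) k l : glmx (u ^ elem_gl i j 1)%g k l =
    glmx u k l + (l == j)%:R * glmx u k i -
    (k == i)%:R * (glmx u j l + (l == j)%:R * glmx u j i).
  rewrite conjgE elem_glV // !glmxM !elem_glE // mulmxA elem_mx_mulr !elem_mx_mull.
  by case: (k == i); case: (l == j); ring.
have := tr _ _ Uu (Uij _ 1 Uu); rewrite !conjE // !eqxx (negbTE ij) (negbTE ji) -/p -/q -/r -/s.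
have := tr _ _ Uu (Uji _ 1 Uu); rewrite !conjE // !eqxx (negbTE ij) (negbTE ji) -/p -/q -/r -/s.
rewrite p1 s1 => e2 e3; split=> //.
  apply/eqP; rewrite -sqrf_eq0; apply/eqP.
  transitivity (2 + 2 * (q * r) - 2 : K); last by rewrite qr0; ring.
  by rewrite -[X in _ - X]e2 /=; ring.
apply/eqP; rewrite -sqrf_eq0; apply/eqP.
transitivity (2 + 2 * (q * r) - 2 : K); last by rewrite qr0; ring.
by rewrite -[X in _ - X]e3 /=; ring.
Qed.
End Levi.

Section LeviElem.
Variables (K : closedFieldType) (n : nat).
Local Notation GL := (GL K n).
Implicit Types (g h u : GL) (A B : 'M[K]_n).

Lemma diag_exp (A : 'M[K]_n) i k : (forall j, j != i -> A i j = 0) ->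
  (A ^+ k) i i = A i i ^+ k.
Proof.
move=> Ai; elim: k => [|k IH]; first by rewrite !expr0 mxE eqxx.
rewrite !exprS -IH -[A * _]/(A *m _) mxE (bigD1 i) //= big1 ?addr0 // => j ji.
by rewrite Ai ?mul0r.
Qed.

Lemma conj_elem (t : 'I_n -> K) i j a : i != j -> (forall k, t k != 0) ->
  (diag_gl t * elem_gl i j a * (diag_gl t)^-1)%g = elem_gl i j (t i * a / t j).
Proof.
move=> ij t0; apply/glmx_inj/matrixP => k l; rewrite diag_gl_conj // !elem_glE // !mxE.
case: eqP => [->|_]; rewrite /= ?mulr0n ?mulr1n ?add0r.
  case: eqP => [->|_] /=; last by rewrite !mulr0 !addr0 mulr1 mulfV.
  by rewrite (negbTE ij) !mulr0 !addr0 mulr1 mulfV.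
case: eqP => [->|_] /=; last by rewrite !mulr0 mul0r.
by case: eqP => [->|_] /=; rewrite ?mulr1 ?mulr0 ?mul0r.
Qed.

Lemma levi_root_group (P L : set GL) i0 j0 a : i0 != j0 ->
  is_levi_subgroup P L -> torus `<=` L ->
  (forall a, P (elem_gl i0 j0 a)) -> (forall a, P (elem_gl j0 i0 a)) ->
  L (elem_gl i0 j0 a).
Proof.
move=> ij [sL _ LP [U [[[[sU _ _] UP nPU uU] _] LU1 LUP]]] TL Pij Pji.
have ji : j0 != i0 by rewrite eq_sym.
(* The centralizer of the kernel of the root in the torus. Its intersection [V] with the unipotent
   radical is normalized by both root groups and by the torus. *)
pose C (u : GL) := forall t : 'I_n -> K, (forall k, t k != 0) -> t i0 = t j0 ->
    (u ^ (diag_gl t)^-1)%g = u.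
pose V := [set u : GL | U u /\ C u].
have [c [c0 c1]] : exists c : K, c != 0 /\ c != 1.
  exact: cofin_ex (cofinI (cofin_neq 0) (cofin_neq 1)).
have VE u i j : C u -> i != j -> ~~ ((i \in [:: i0; j0]) && (j \in [:: i0; j0])) ->
    glmx u i j = 0.
  move=> Hu ne nin.
  (* An index outside the block that is exactly one of [i], [j]: the torus element equal to [c]
     there and 1 elsewhere multiplies the entry by [c] or its inverse. *)
  have [k [kin ks]] : exists k, k \notin [:: i0; j0] /\ (k == i) (+) (k == j).
    move: nin; rewrite negb_and => /orP[ni|nj].
      by exists i; rewrite eqxx (negbTE ne).
    by exists j; rewrite eqxx eq_sym (negbTE ne).
  pose t (l : 'I_n) := if l == k then c else 1.
  have t0 l : t l != 0 by rewrite /t; case: ifP; rewrite ?oner_neq0.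
  have tij : t i0 = t j0.
    move: kin; rewrite /t !inE negb_or ![k == _]eq_sym => /andP[/negbTE -> /negbTE ->] //.
  have := congr1 (fun g => glmx g i j) (Hu t t0 tij).
  rewrite conjgE invgK mulgA diag_gl_conj // /t.
  rewrite ![_ == k]eq_sym; move: ks; case: (k == i); case: (k == j) => //= _.
    rewrite invr1 mulr1 => /eqP; rewrite -subr_eq0 -{2}[glmx u i j]mul1r -mulrBl.
    by rewrite mulf_eq0 subr_eq0 (negbTE c1) => /eqP.
  rewrite mul1r => /eqP; rewrite -subr_eq0 -{2}[glmx u i j]mulr1 -mulrBr.
  rewrite mulf_eq0 subr_eq0 => /orP[/eqP //|/eqP cV].
  by move: c1; rewrite -[c]invrK cV invr1 eqxx.
have Celem i j b : i != j -> (i \in [:: i0; j0]) -> (j \in [:: i0; j0]) -> C (elem_gl i j b).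
  move=> ne hi hj t t0 tij; rewrite conjgE invgK mulgA conj_elem //.
  have -> : t i = t j.
    by move: hi hj; rewrite !inE => /orP[] /eqP -> /orP[] /eqP ->.
  by rewrite mulrAC mulfV ?mul1r.
have Ctorus t : torus t -> C t.
  move=> /torus_diag_gl[t' t0' ->] t0 t00 _; rewrite conjgE invgK mulgA.
  apply/glmx_inj/matrixP => i j; rewrite diag_gl_conj // diag_glE // !mxE.
  by case: eqP => [->|_]; rewrite ?mulr0 ?mul0r // mulrAC mulfV ?mul1r.
have CJ x y : C x -> C y -> C (x ^ y)%g.
  by move=> Cx Cy t t0 tij; rewrite conjJg Cx ?Cy.
have i0in : i0 \in [:: i0; j0] by rewrite inE eqxx.
have j0in : j0 \in [:: i0; j0] by rewrite !inE eqxx orbT.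
have sV : is_subgroup V.
  split=> [|x y [Ux Cx] [Uy Cy]].
    by split=> [|t _ _]; [exact: subgroup1|rewrite conj1g].
  split; first by apply: subgroupM => //; exact: subgroupV.
  by move=> t t0 tij; rewrite conjMg conjVg Cx ?Cy.
have TP t : torus t -> P t by move=> /TL/LP.
have VJ p u : P p -> C p -> V u -> V (u ^ p)%g.
  by move=> Pp Cp [Uu Cu]; split; [exact: nPU|exact: CJ].
have Vblk : forall u, V u -> [/\ glmx u i0 i0 = 1, glmx u j0 j0 = 1, glmx u i0 j0 = 0 & glmx u j0 i0 = 0].
  apply: (unipotent_block ij sV).
  - by move=> u [/uU].
  - move=> u [_ Cu] i j hi hj; apply: VE => //; first by apply: contraNneq hj => <-.
    by rewrite hi.
  - by move=> u b Vu; apply: VJ => //; apply: Celem.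
  - by move=> u b Vu; apply: VJ => //; apply: Celem.
  - by move=> u t Vu Tt; apply: VJ => //; [exact: TP|exact: Ctorus].
have V1 u : V u -> u = 1%g.
  move=> Vu; have [h1 h2 h3 h4] := Vblk u Vu; have [Uu Cu] := Vu.
  have off i j : i != j -> glmx u i j = 0.
    move=> ne; have [/andP[]|] := boolP ((i \in [:: i0; j0]) && (j \in [:: i0; j0])); last exact: VE.
    rewrite !inE => /orP[] /eqP ei /orP[] /eqP ej; rewrite ei ej ?eqxx // in ne *.
  apply/glmx_inj/matrixP => i j; rewrite !mxE; case: eqP => [<-|/eqP /off //].
  have [k /(congr1 (fun A => A i i))] := uU u Uu.
  rewrite diag_exp => [|l li]; last by rewrite !mxE [i == l]eq_sym (negbTE li) subr0 off // eq_sym.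
  rewrite !mxE eqxx => /eqP; rewrite expf_eq0 subr_eq0 => /andP[_ /eqP ->] //.
have [l Ll [u Uu lu]] : [set (l * u)%g | l in L & u in U] (elem_gl i0 j0 a) by rewrite LUP.
suff u1 : u = 1%g by rewrite -lu u1 mulg1.
apply: V1; split=> // t t0 tij.
have dT : L (diag_gl t)^-1%g by apply: subgroupV => //; apply: TL; exact: diag_gl_torus.
(* Conjugation by [t] fixes [l * u], so the defects of [l] and of [u] agree and lie in the trivial
   intersection of [L] and [U]. *)
have := Celem i0 j0 a ij i0in j0in t t0 tij; rewrite -lu conjMg => e.
have Lx : L ((l ^ (diag_gl t)^-1)^-1 * l)%g.
  apply: subgroupM => //; apply: subgroupV => //; rewrite conjgE.
  by apply: subgroupM => //; [exact: subgroupV|apply: subgroupM].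
have xE : ((l ^ (diag_gl t)^-1)^-1 * l = u ^ (diag_gl t)^-1 * u^-1)%g.
  apply: (mulgI (l ^ (diag_gl t)^-1)%g).
  by rewrite mulgA mulgV mul1g mulgA e mulgK.
have : (L `&` U) (u ^ (diag_gl t)^-1 * u^-1)%g.
  split; first by rewrite -xE.
  apply: subgroupM => //; last exact: subgroupV.
  by apply: nPU => //; apply: LP.
rewrite LU1 => /= e1.
by rewrite -[LHS](mulgKV u) e1 mul1g.
Qed.
End LeviElem.

(** * Triangularity of connected solvable groups containing the torus *)

Section Derived.
Variable G : groupType.
Implicit Types (A H : set G).

Lemma generated_subgroup A : is_subgroup (Defs.generated A).
Proof.
split=> [H sH _|x y Ax Ay H sH AH]; first exact: subgroup1.
by apply: subgroupM => //; [exact: Ax|apply: subgroupV => //; exact: Ay].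
Qed.

Lemma sub_generated A : A `<=` Defs.generated A.
Proof. by move=> x Ax H _; apply. Qed.

Lemma derived_subgroup_is H k : is_subgroup H -> is_subgroup (iter k (@derived_subgroup G) H).
Proof. by move=> sH; case: k => [//|k]; exact: generated_subgroup. Qed.

Lemma derived_subgroup_conj H k : is_subgroup H -> forall x h,
  iter k (@derived_subgroup G) H x -> H h -> iter k (@derived_subgroup G) H (x ^ h)%g.
Proof.
move=> sH; elim: k => [|k IH] x h.
  by move=> Hx Hh; rewrite /= conjgE; apply: subgroupM => //; [exact: subgroupV|exact: subgroupM].
move=> Dx Hh H' sH' DH'.
have : [set y | H' (y ^ h)%g] x.
  apply: Dx; first split=> [|y z Hy Hz] /=; first by rewrite conj1g; exact: subgroup1.
    by rewrite conjMg conjVg; apply: subgroupM => //; exact: subgroupV.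
  move=> _ [y Dy [z Dz <-]] /=; apply: DH'; rewrite conjRg.
  by exists (y ^ h)%g; [exact: IH|exists (z ^ h)%g => //; exact: IH].
by [].
Qed.

Lemma derived_subgroup_sub H H' : is_subgroup H' ->
  (forall x y, H x -> H y -> H' [~ x, y]%g) -> derived_subgroup H `<=` H'.
Proof. by move=> sH' HH' x; apply => // _ [y Hy [z Hz <-]]; exact: HH'. Qed.
End Derived.

Section Potential.
Variables (K : closedFieldType) (n : nat).
Local Notation GL := (GL K n).
Implicit Types (g h u : GL) (A B : 'M[K]_n).

Lemma open_gl_neq0 (f : GL -> K) : gl_poly f -> open [set g | f g != 0].
Proof.
move=> [p pf]; change (zariski_open [set g | f g != 0]) => g /= fg.
by exists p; rewrite -?pf // => h /=; rewrite -pf.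
Qed.

Lemma sum_exp_cofin (c : 'I_n -> K) l : c l != 0 ->
  cofin (fun s => \sum_k c k * s ^+ k != 0).
Proof.
move=> cl; have p0 : \sum_k c k *: 'X^k != 0 :> {poly K}.
  apply: contraNneq cl => /(congr1 (fun p : {poly K} => p`_l)).
  rewrite coef0 coef_sum (bigD1 l) //= coefZ coefXn eqxx mulr1 big1 ?addr0 => [-> //|k kl].
  by rewrite coefZ coefXn eq_sym -[_ == _]/(k == l) (negbTE kl) mulr0.
apply: cofin_sub (poly_cofin p0) => s.
by rewrite horner_sum; under eq_bigr do rewrite hornerZ hornerXn.
Qed.

Definition geo (s : K) (k : 'I_n) : K := s ^+ k.
Lemma geo_neq0 s : s != 0 -> forall k, geo s k != 0.
Proof. by move=> s0 k; rewrite /geo expf_neq0. Qed.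

(** The entry is a polynomial in [s] whose coefficients are the [A i l * B l k], so different [l]
    cannot cancel identically. *)
Lemma geo_generic A B : cofin (fun s => forall p : 'I_n * 'I_n,
  (exists l, A p.1 l * B l p.2 != 0) ->
  (A *m diag_mx (\row_k geo s k) *m B) p.1 p.2 != 0).
Proof.
apply: cofin_all => -[i k] /=.
have [[l nz]|no] := pselect (exists l, A i l * B l k != 0); last by exists [::].
apply: cofin_sub (@sum_exp_cofin (fun l => A i l * B l k) l nz) => s sP _.
rewrite mxE (eq_bigr (fun l => A i l * B l k * s ^+ l)) // => m _.
by rewrite mul_mx_diag !mxE mulrAC.
Qed.

Section Solvable.
Variable H : set GL.
Hypotheses (sH : is_subgroup H) (cH : connected H) (solvH : is_solvable H) (TH : torus `<=` H).

Definition diag_nz g := forall i, glmx g i i != 0.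

(* For generic [t] in the torus there is no cancellation in the entries of [g * t * h], so the
   elements with nonzero diagonal and largest support dominate all those with nonzero diagonal;
   the latter form a neighbourhood of 1, hence generate the connected group H. *)
Lemma dominating_elt : exists g, [/\ H g, diag_nz g,
   (forall i j k, glmx g i j != 0 -> glmx g j k != 0 -> glmx g i k != 0) &
   (forall h i j, H h -> glmx h i j != 0 -> glmx g i j != 0)].
Proof.
pose supp g := [set p : 'I_n * 'I_n | glmx g p.1 p.2 != 0]%SET.
pose Q m := `[< exists g, [/\ H g, diag_nz g & #|supp g| = m] >].
have exQ : exists m, Q m.
  exists #|supp 1%g|; apply/asboolP; exists 1%g; split=> //; first exact: subgroup1.
  by move=> i; rewrite mxE eqxx oner_neq0.
have ubQ m : Q m -> (m <= #|{: 'I_n * 'I_n}|)%N.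
  by move=> /asboolP[g [_ _ <-]]; exact: max_card.
case: (ex_maxnP exQ ubQ) => m /asboolP[g [Hg dgz gm]] mmax.
have comb h i k : H h -> diag_nz h -> (exists l, glmx g i l * glmx h l k != 0) ->
    glmx g i k != 0.
  move=> Hh dh [l nz].
  have [s [s0 sP]] := cofin_ex (cofinI (cofin_neq 0) (geo_generic (glmx g) (glmx h))).
  pose x := (g * diag_gl (geo s) * h)%g.
  have xE : glmx x = glmx g *m diag_mx (\row_k geo s k) *m glmx h.
    by rewrite !glmxM diag_glE //; exact: geo_neq0.
  have Hx : H x.
    by do 2?[apply: subgroupM => //]; apply: TH; apply: diag_gl_torus; exact: geo_neq0.
  have xP i' k' : (exists l, glmx g i' l * glmx h l k' != 0) -> glmx x i' k' != 0.
    by rewrite xE => e; exact: (sP (i', k')).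
  have dx : diag_nz x by move=> j; apply: xP; exists j; rewrite mulf_neq0.
  have sub : supp g \subset supp x.
    by apply/fintype.subsetP => -[a b]; rewrite !inE /= => ab; apply: xP; exists b; rewrite mulf_neq0.
  have : supp g = supp x.
    apply/eqP; rewrite eqEcard sub gm; apply: mmax; apply/asboolP; by exists x.
  move=> /setP/(_ (i, k)); rewrite !inE /= => ->; apply: xP; by exists l.
exists g; split=> //.
  by move=> i j k gij gjk; apply: (comb g) => //; exists j; rewrite mulf_neq0.
have gtrans i j k : glmx g i j != 0 -> glmx g j k != 0 -> glmx g i k != 0.
  by move=> gij gjk; apply: (comb g) => //; exists j; rewrite mulf_neq0.
have omega h i j : H h -> diag_nz h -> glmx h i j != 0 -> glmx g i j != 0.
  by move=> Hh dh hij; apply: (comb h) => //; exists i; rewrite mulf_neq0.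
move=> h i j Hh; apply: contraNneq => gij.
(* The equations for [h] to preserve the span of the basis vectors [e_b] with [g b j != 0]. This
   span contains [e_j] but not [e_i]. *)
pose F (p : 'I_n * 'I_n) (h : GL) :=
  if (glmx g p.2 j != 0) && (glmx g p.1 j == 0) then glmx h p.1 p.2 else 0.
pose HS := [set h | H h /\ forall p, F p h = 0].
have FM x y : (forall p, F p x = 0) -> (forall p, F p y = 0) -> forall p, F p (x * y)%g = 0.
  move=> Fx Fy [a b]; rewrite /F /=; case: ifP => // /andP[gb ga].
  rewrite ?glmxM mxE big1 // => l _.
  have [gl|gl] := eqVneq (glmx g l j) 0.
    by have := Fy (l, b); rewrite /F /= gb gl eqxx /= => ->; rewrite mulr0.
  by have := Fx (a, l); rewrite /F /= ga gl /= => ->; rewrite mul0r.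
have Fomega y : H y -> diag_nz y -> forall p, F p y = 0.
  move=> Hy dy [a b]; rewrite /F /=; case: ifP => // /andP[gb ga].
  apply/eqP; apply: contraTT ga => yab; apply: (gtrans a b j) => //.
  exact: (omega y).
have F1 : forall p, F p 1%g = 0.
  apply: Fomega; first exact: subgroup1.
  by move=> k; rewrite mxE eqxx oner_neq0.
have pF p : gl_poly (F p).
  rewrite /F; case: (_ && _); first exact: gl_poly_entry.
  exact: (fa_cst (@gl_poly_alg K n)).
have HSE : HS = H.
  apply: cH.
  - by exists 1%g; split=> //; exact: subgroup1.
  (* Around each [x] in [HS], the translate by [x] of the elements with nonzero diagonal stays in
     [HS], which is thus open in [H]; being cut out by equations it is also closed. *)
  - have op (x : GL) : open [set y : GL | \prod_k glmx (x^-1 * y)%g k k != 0].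
      apply: open_gl_neq0; apply: (fa_prod (@gl_poly_alg K n)) => k _.
      by apply: (@gl_poly_lmul K n (x^-1)%g (fun g => glmx g k k)); exact: gl_poly_entry.
    exists (\bigcup_(x in HS) [set y : GL | \prod_k glmx (x^-1 * y)%g k k != 0]).
      by apply: bigcup_open => x _; exact: op.
    apply/seteqP; split=> [x [Hx Fx]|y [Hy [x [Hx Fx] xy]]].
      split=> //; exists x => //.
      suff : \prod_k glmx (x^-1 * x)%g k k != 0 by [].
      by rewrite mulVg; apply/prodf_neq0 => k _; rewrite mxE eqxx oner_neq0.
    split=> //; rewrite -[y](mulKVg x); apply: FM => //; apply: Fomega.
      by apply: subgroupM => //; exact: subgroupV.
    by move=> k; have /prodf_neq0 := xy; apply.
  - exists [set y | forall p, F p y = 0]; first exact: closed_gl_eq0.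
    by apply/seteqP; split=> y [].
have [_ /(_ (i, j))] : HS h by rewrite HSE.
by rewrite /F /= dgz gij eqxx /= => ->.
Qed.
End Solvable.
End Potential.

Section Commutator.
Variables (K : closedFieldType) (n : nat).
Local Notation GL := (GL K n).
Implicit Types (g h u : GL) (A B : 'M[K]_n).

Lemma mul_delta_mid A B k r l : (A *m delta_mx k k *m B) r l = A r k * B k l.
Proof.
rewrite mxE (bigD1 k) //= big1 ?addr0.
  congr (_ * _); rewrite mxE (bigD1 k) //= mxE !eqxx mulr1 big1 ?addr0 // => m mk.
  by rewrite mxE (negbTE mk) mulr0.
move=> m mk; rewrite mxE big1 ?mul0r // => m' _.
by rewrite mxE (negbTE mk) andbF mulr0.
Qed.

Definition tw i j (s : K) (k : 'I_n) : K := if k == i then s else if k == j then s^-1 else 1.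
(* [s * tw i j s], which is polynomial in [s] *)
Definition twp i j (s : K) (k : 'I_n) : K := if k == i then s ^+ 2 else if k == j then 1 else s.
Definition twm i j s : 'M[K]_n := diag_mx (\row_k twp i j s k).

(** A commutator of [g] with its conjugate by a value of the coroot of [(i, j)]. Derived subgroups
    are normalized by the torus, so it lies one step further in the derived series than [g]. *)
Definition tcomm i j g s : GL :=
  ((diag_gl (tw i j s) * g * (diag_gl (tw i j s))^-1) * g *
   (diag_gl (tw i j s) * g^-1 * (diag_gl (tw i j s))^-1) * g^-1)%g.

Lemma tw_neq0 i j s : s != 0 -> forall k, tw i j s k != 0.
Proof. by move=> s0 k; rewrite /tw; do 2?case: ifP; rewrite ?invr_eq0 ?oner_neq0. Qed.

Lemma tw_sym i j s : i != j -> diag_gl (tw i j s^-1) = diag_gl (tw j i s).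
Proof.
move=> ij; congr diag_gl; apply/funext => k; rewrite /tw invrK.
by case: eqP => // ->; rewrite (negbTE ij).
Qed.

Lemma twE i j s : s != 0 -> i != j -> glmx (diag_gl (tw i j s)) = s^-1 *: twm i j s.
Proof.
move=> s0 ij; rewrite diag_glE; last exact: tw_neq0.
apply/matrixP => k l; rewrite !mxE; case: eqP => _; last by rewrite mulr0n mulr0.
rewrite /tw /twp !mulr1n; case: eqP => _; first by rewrite expr2 mulKf.
by case: eqP => _; rewrite ?mulr1 ?mulVf.
Qed.

Lemma twVE i j s : s != 0 -> i != j -> glmx (diag_gl (tw i j s))^-1%g = s^-1 *: twm j i s.
Proof.
move=> s0 ij; rewrite diag_glV; last exact: tw_neq0.
rewrite diag_glE => [|k]; last by rewrite invr_eq0 tw_neq0.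
apply/matrixP => k l; rewrite !mxE; case: eqP => _; last by rewrite mulr0n mulr0.
rewrite /tw /twp !mulr1n; have [->|ki] := eqVneq k i.
  by rewrite (negbTE ij) mulr1.
case: eqP => _; first by rewrite invrK expr2 mulKf.
by rewrite invr1 mulVf.
Qed.

Lemma pfun_twm i j k l : pfun (fun s => twm i j s k l).
Proof.
under eq_fun do rewrite mxE mxE; case: (k == l); last first.
  by under eq_fun do rewrite mulr0n; exact: (fa_cst (pfun_alg K)).
under eq_fun do rewrite mulr1n /twp; case: (_ == i).
  exact: (fa_exp (pfun_alg K) 2 (pfun_id K)).
by case: (_ == j); [exact: (fa_cst (pfun_alg K))|exact: pfun_id].
Qed.

Lemma twm0 i j : i != j -> twm i j 0 = delta_mx j j.
Proof.
move=> ij; apply/matrixP => k l; rewrite !mxE /twp expr0n /=.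
have [->|kl] := eqVneq k l; last first.
  by rewrite mulr0n; case: eqP => // kj; case: eqP => // lj; rewrite kj lj eqxx in kl.
rewrite mulr1n andbb; case: eqP => [->|_]; first by rewrite (negbTE ij).
by case: eqP.
Qed.

Lemma tcomm_generic i j g y : i != j ->
  (forall a b, a \in [:: i; j] -> b \in [:: i; j] -> glmx g a b != 0 /\ glmx g^-1%g a b != 0) ->
  y \in [:: i; j] ->
  cofin (fun s => glmx (tcomm i j g s) j y != 0 /\ glmx (tcomm i j g s)^-1%g y i != 0).
Proof.
move=> ij gP yin; have ji : j != i by rewrite eq_sym.
have iin : i \in [:: i; j] by rewrite inE eqxx.
have jin : j \in [:: i; j] by rewrite !inE eqxx orbT.
pose g' := glmx g^-1%g.
(* [s ^+ 4] times the commutator and its inverse, one [s] for each torus factor. At [s = 0] the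
   torus factors become elementary projectors. *)
pose Phi s := twm i j s *m glmx g *m twm j i s *m glmx g *m twm i j s *m g' *m twm j i s *m g'.
pose Psi s := glmx g *m twm i j s *m glmx g *m twm j i s *m g' *m twm i j s *m g' *m twm j i s.
have scale4 s (A : 'M[K]_n) : s^-1 *: (s^-1 *: (s^-1 *: (s^-1 *: A))) = s ^- 4 *: A.
  by rewrite !scalerA -!invfM; congr (_^-1 *: _); ring.
have E1 s : s != 0 -> glmx (tcomm i j g s) = s ^- 4 *: Phi s.
  move=> s0; rewrite -scale4 /tcomm !glmxM twVE // twE // !mulmxA.
  by do ?[rewrite -?scalemxAl -?scalemxAr].
have E2 s : s != 0 -> glmx (tcomm i j g s)^-1%g = s ^- 4 *: Psi s.
  move=> s0; rewrite -scale4 /tcomm !invgM !invgK !mulgA !glmxM twVE // twE //.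
  by do ?[rewrite -?scalemxAl -?scalemxAr].
have pc A : forall k l, pfun (fun s : K => A k l) by move=> *; exact: (fa_cst (pfun_alg K)).
have p1 := pfun_twm i j; have p2 := pfun_twm j i.
have g1 a b : a \in [:: i; j] -> b \in [:: i; j] -> glmx g a b != 0.
  by move=> ha hb; have [] := gP a b ha hb.
have g2 a b : a \in [:: i; j] -> b \in [:: i; j] -> g' a b != 0.
  by move=> ha hb; have [] := gP a b ha hb.
have C1 : cofin (fun s => Phi s j y != 0).
  apply: (@pfun_cofin _ (fun s => Phi s j y) 0).
    by do 7! [apply: (fa_mulmx (pfun_alg K)) => // ? ?].
  rewrite /Phi !twm0 // !mul_delta_mid -[delta_mx j j]mul1mx mul_delta_mid mxE eqxx mul1r.
  by rewrite !mulf_neq0 ?g1 ?g2.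
have C2 : cofin (fun s => Psi s y i != 0).
  apply: (@pfun_cofin _ (fun s => Psi s y i) 0).
    by do 7! [apply: (fa_mulmx (pfun_alg K)) => // ? ?].
  rewrite /Psi !twm0 // -[_ *m delta_mx i i]mulmx1 !mul_delta_mid mxE eqxx mulr1.
  by rewrite !mulf_neq0 ?g1 ?g2.
apply: cofin_sub (cofinI (cofin_neq 0) (cofinI C1 C2)) => s [s0 [h1 h2]].
have scE (A : 'M[K]_n) k l : (s ^- 4 *: A) k l = s ^- 4 * A k l by rewrite mxE.
have s4 : s ^- 4 != 0 by rewrite invr_eq0 expf_neq0.
by rewrite E1 // E2 // !scE; split; rewrite mulf_neq0.
Qed.

(** The identity lacks this property, while commutators can inherit it; it is the obstruction to
    solvability. *)
Definition quad i j g := forall a b, a \in [:: i; j] -> b \in [:: i; j] ->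
  glmx g a b != 0 /\ glmx g^-1%g a b != 0.

(* Up to a power of [s], the entries of the commutator are polynomials in [s] and in [s^-1];
   their constant terms are products of entries of [g] and [g^-1] with indices [i], [j]. *)
Lemma quad_tcomm i j g : i != j -> quad i j g -> exists2 s, s != 0 & quad i j (tcomm i j g s).
Proof.
move=> ij qg; have ji : j != i by rewrite eq_sym.
have iin : i \in [:: i; j] by rewrite inE eqxx.
have jin : j \in [:: i; j] by rewrite !inE eqxx orbT.
have qg' : quad j i g.
  by move=> a b ha hb; apply: qg; rewrite !inE orbC; move: ha hb; rewrite !inE.
have iin' : i \in [:: j; i] by rewrite !inE eqxx orbT.
have jin' : j \in [:: j; i] by rewrite !inE eqxx.
(* Inverting [s] exchanges [i] and [j], which supplies the row and the column that [tcomm_generic]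
   leaves out. *)
have sym s : tcomm i j g s^-1 = tcomm j i g s by rewrite /tcomm tw_sym.
have A1 := tcomm_generic ij qg iin; have A2 := tcomm_generic ij qg jin.
have B1 := cofin_inv (tcomm_generic ji qg' iin'); have B2 := cofin_inv (tcomm_generic ji qg' jin').
have [s [s0 [[a1 a2] [[a3 a4] [[b1 b2] [b3 b4]]]]]] :=
  cofin_ex (cofinI (cofin_neq 0) (cofinI A1 (cofinI A2 (cofinI B1 B2)))).
exists s => //; rewrite -!sym !invrK in b1 b2 b3 b4.
by move=> a b; rewrite !inE => /orP[] /eqP -> /orP[] /eqP ->.
Qed.

Variable H : set GL.
Hypotheses (sH : is_subgroup H) (cH : connected H) (solvH : is_solvable H) (TH : torus `<=` H).

Lemma quad_derived i j k g : i != j -> H g -> quad i j g ->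
  exists2 x, iter k (@derived_subgroup GL) H x & quad i j x.
Proof.
move=> ij Hg qg; elim: k => [|k [x Dx qx]]; first by exists g.
have [s s0 qs] := quad_tcomm ij qx; exists (tcomm i j x s) => //.
have Ht : H (diag_gl (tw i j s)) by apply: TH; apply: diag_gl_torus; exact: tw_neq0.
have sD := derived_subgroup_is k sH.
apply: sub_generated.
exists ((diag_gl (tw i j s) * x^-1 * (diag_gl (tw i j s))^-1))%g.
  have -> : (diag_gl (tw i j s) * x^-1 * (diag_gl (tw i j s))^-1 = x^-1 ^ (diag_gl (tw i j s))^-1)%g.
    by rewrite conjgE invgK mulgA.
  by apply: derived_subgroup_conj => //; exact: subgroupV.
exists x^-1%g; first exact: subgroupV.
by rewrite /commg conjgE /tcomm !invgM !invgK !mulgA.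
Qed.

(** The support of the dominating element is a reflexive transitive relation, antisymmetric by
    solvability. Any linear extension of this order gives [h]. *)
Lemma borel_potential : exists h : 'I_n -> nat, injective h /\
  forall g, H g -> htri h (glmx g).
Proof.
have [g [Hg dg0 gtr gdom]] := dominating_elt sH cH TH.
have anti i j : i != j -> glmx g i j != 0 -> glmx g j i != 0 -> False.
  move=> ij gij gji.
  have gin a b : a \in [:: i; j] -> b \in [:: i; j] -> glmx g a b != 0.
    by rewrite !inE => /orP[] /eqP -> /orP[] /eqP ->.
  have Hg' : H g^-1%g by exact: subgroupV.
  (* Some [l] contributes to the entry [(b, b)] of [g * g^-1]. Transitivity carries its first factor
     from row [b] to row [a], so a generic conjugate of a torus element has a full block. *)
  have nz a b : a \in [:: i; j] -> b \in [:: i; j] ->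
      exists l, glmx g a l * glmx g^-1%g l b != 0.
    move=> ha hb; apply: contrapT => no.
    have := congr1 (fun x => glmx x b b) (mulgV g); rewrite glmxM !mxE eqxx big1.
      by move/eqP; rewrite eq_sym oner_eq0.
    move=> l _; apply/eqP/negPn/negP => nz; apply: no; exists l.
    move: nz; rewrite !mulf_eq0 !negb_or => /andP[gbl ->]; rewrite andbT.
    exact: gtr (gin a b ha hb) gbl.
  have G := geo_generic (glmx g) (glmx g^-1%g).
  have [s [s0 [sP sP']]] := cofin_ex (cofinI (cofin_neq 0) (cofinI G (cofin_inv G))).
  pose x := (g * diag_gl (geo s) * g^-1)%g.
  have qx : quad i j x.
    move=> a b ha hb; split.
      rewrite /x !glmxM diag_glE; last exact: geo_neq0.
      exact: (sP (a, b) (nz a b ha hb)).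
    rewrite /x !invgM invgK mulgA diag_glV; last exact: geo_neq0.
    rewrite (_ : diag_gl (fun k => (geo s k)^-1) = diag_gl (geo s^-1 : 'I_n -> K)); last first.
      by congr diag_gl; apply: funext => k; rewrite /geo exprVn.
    rewrite !glmxM diag_glE; last by apply: geo_neq0; rewrite invr_eq0.
    exact: (sP' (a, b) (nz a b ha hb)).
  have Hx : H x.
    by do 2?[apply: subgroupM => //]; apply: TH; apply: diag_gl_torus; exact: geo_neq0.
  have [k Dk] := solvH.
  have [y Dy qy] := quad_derived k ij Hx qx.
  rewrite Dk in Dy; have [] := qy i j; rewrite ?inE ?eqxx ?orbT // Dy mxE (negbTE ij).
  by rewrite eqxx.
pose d i := #|[set l | glmx g l i != 0]%SET|.
have dlt i j : i != j -> glmx g i j != 0 -> (d i < d j)%N.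
  move=> ij gij; apply: proper_card; apply/properP; split.
    by apply/fintype.subsetP => l; rewrite !inE => gli; exact: gtr gli gij.
  exists j; first by rewrite inE.
  by rewrite inE negbK; apply/eqP; apply: contrapT => /eqP; exact: anti ij gij.
have hlt i j : (d i < d j)%N -> (d i * n + i < d j * n + j)%N.
  by move=> dij; have := ltn_ord i; have := leq_mul dij (leqnn n); rewrite mulSn; lia.
(* Order by the number of predecessors, with ties broken by the index. *)
exists (fun i => d i * n + i)%N; split=> [i j|x Hx i j hij].
  have [lt|lt|e] := ltngtP (d i) (d j).
  - by move=> e; have := hlt _ _ lt; rewrite e ltnn.
  - by move=> e; have := hlt _ _ lt; rewrite e ltnn.
  - by rewrite e => /addnI/ord_inj.
apply/eqP; apply: contraTT hij => xij; rewrite -leqNgt.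
have [->//|ij] := eqVneq i j.
by apply: ltnW; apply: hlt; apply: dlt => //; exact: gdom xij.
Qed.
End Commutator.

(** * Solvability and connectedness of triangular groups *)

Section SolvableTri.
Variables (K : fieldType) (n : nat).
Local Notation GL := (GL K n).
Implicit Types (g u x y : GL) (A B : 'M[K]_n).
Variable h : 'I_n -> nat.
Hypothesis hinj : injective h.

Definition gap c A := forall i j, (h j < h i + c)%N -> A i j = 0.

Lemma gapM c c' A B : gap c A -> gap c' B -> gap (c + c') (A *m B).
Proof.
move=> gA gB i j lt; rewrite mxE big1 // => l _.
have [h1|h1] := ltnP (h l) (h i + c); first by rewrite gA ?mul0r.
by rewrite gB ?mulr0 //; lia.
Qed.

Lemma gapB c A B : gap c A -> gap c B -> gap c (A - B).
Proof. by move=> gA gB i j lt; rewrite !mxE gA ?gB ?subr0. Qed.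

Lemma gap0 A : htri h A <-> gap 0 A.
Proof. by split=> H i j; move: (H i j); rewrite addn0. Qed.

Lemma gapW c c' A : (c' <= c)%N -> gap c A -> gap c' A.
Proof. by move=> le gA i j lt; apply: gA; lia. Qed.

Lemma htri_GLV g : htri h (glmx g) -> htri h (glmx g^-1%g).
Proof. by move=> hg; apply: htri_inv => //; exact: glmxP. Qed.

Definition gap_group c : set GL := [set g | htri h (glmx g) /\ gap c (glmx g - 1)].

Lemma gap_group_subgroup c : is_subgroup (gap_group c).
Proof.
split=> [|x y [hx gx] [hy gy]].
  by split; [exact: htri1|rewrite subrr => i j _; rewrite mxE].
have hyV := htri_GLV hy; split; first exact: htri_mul.
have -> : glmx (x * y^-1)%g - 1 = (glmx x - 1 - (glmx y - 1)) *m glmx y^-1%g.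
  by rewrite opprB addrA subrK mulmxBl -[glmx y *m _]/(glmx (y * y^-1)%g) mulgV.
by rewrite -[c]addn0; apply: gapM; [exact: gapB|exact/gap0].
Qed.

(** [[x, y] - 1] is [(y x)^-1 (x y - y x)]. For positive [c] the last factor is the Lie bracket of
    [x - 1] and [y - 1], of gap [2c]; for [c = 0] the diagonals of [x y] and [y x] agree. *)
Lemma gap_group_comm c x y : gap_group c x -> gap_group c y -> gap_group c.+1 [~ x, y]%g.
Proof.
move=> Gx Gy; have sc := gap_group_subgroup c.
have [hc _] : gap_group c [~ x, y]%g.
  by rewrite /commg conjgE; do ?[apply: subgroupM => //]; exact: subgroupV.
split=> //; have [[hx gx] [hy gy]] := (Gx, Gy).
have e1 : ([~ x, y] = (y * x)^-1 * (x * y))%g by rewrite invgM /commg conjgE !mulgA.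
have -> : glmx [~ x, y]%g - 1 = glmx (y * x)^-1%g *m (glmx (x * y)%g - glmx (y * x)%g).
  by rewrite mulmxBr -!glmxM mulVg e1.
rewrite -[c.+1]add0n; apply: gapM; first by apply/gap0/htri_GLV; exact: htri_mul.
case: c gx gy {Gx Gy sc} => [|c] gx gy.
  have subE A B i j : (A - B) i j = A i j - B i j by rewrite !mxE.
  move=> i j; rewrite addn1 ltnS leq_eqVlt subE !glmxM => /orP[/eqP/hinj ->|lt].
    by rewrite !(htri_diagM _ hinj) // mulrC subrr.
  by rewrite !(htri_mul _ _ lt) // subrr.
have -> : glmx (x * y)%g - glmx (y * x)%g =
   (glmx x - 1) *m (glmx y - 1) - (glmx y - 1) *m (glmx x - 1).
  rewrite !mulmxBl !mulmxBr -[1]/(1%:M) !mulmx1 !mul1mx !glmxM.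
  rewrite !opprB !addrA; set p := glmx x *m glmx y; set q := glmx y *m glmx x.
  set X := glmx x; set Y := glmx y.
  apply/matrixP => i j; rewrite !mxE; ring.
by apply: gapB; apply: (@gapW (c.+1 + c.+1)); try lia; exact: gapM.
Qed.

Lemma htri_solvable (H : set GL) : is_subgroup H -> (forall g, H g -> htri h (glmx g)) ->
  is_solvable H.
Proof.
move=> sH hH; pose k := (\max_i h i).+1; exists k.
have sub m : iter m (@derived_subgroup GL) H `<=` gap_group m.
  elim: m => [|m IH] /=.
    move=> g Hg; have hg := hH g Hg; split=> //.
    by apply: gapB; [exact/gap0|apply/gap0; exact: htri1].
  apply: derived_subgroup_sub; first exact: gap_group_subgroup.
  by move=> x y /IH Gx /IH Gy; exact: gap_group_comm.
apply/seteqP; split=> [g /sub[_ gg]|_ ->]; last exact: subgroup1 (derived_subgroup_is k sH).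
apply/glmx_inj/matrixP => i j; apply/eqP; rewrite -subr_eq0.
have := gg i j; rewrite !mxE => -> //.
by rewrite /k; have := @leq_bigmax _ h j; lia.
Qed.
End SolvableTri.

Section Connected.
Variables (K : closedFieldType) (n : nat).
Local Notation GL := (GL K n).
Implicit Types (g u x y : GL) (A B : 'M[K]_n) (H : set GL).

(** The curve takes values in all matrices because it may leave the group at finitely many
    parameters. *)
Definition linked H x y := exists c : K -> 'M[K]_n, exists a b, [/\
  forall i j, pfun (fun s => c s i j), c a = glmx x, c b = glmx y &
  cofin (fun s => exists2 g, H g & glmx g = c s)].

Lemma linked_sym H x y : linked H x y -> linked H y x.
Proof. by move=> [c [a [b [? ? ? ?]]]]; exists c, b, a. Qed.

Lemma linked_open (c : K -> 'M[K]_n) a x (U : set GL) :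
  (forall i j, pfun (fun s => c s i j)) -> c a = glmx x -> open U -> U x ->
  cofin (fun s => forall g, glmx g = c s -> U g).
Proof.
move=> pc ca oU Ux.
have /nbhs_glP[f [p pf] [fx fU]] : nbhs x U by exact: open_nbhs_nbhs.
pose F (s : K) := meval (fun k => mxvec (c s) 0 k) p.
have pF : pfun F.
  apply: (fa_meval (pfun_alg K)) => k; case/mxvec_indexP: k => i j.
  by under eq_fun do rewrite mxvecE; exact: pc.
have Fa : F a != 0 by move: fx; rewrite pf /gl_eval -ca.
apply: cofin_sub (pfun_cofin pF Fa) => s Fs g gc; apply: fU.
by rewrite pf /gl_eval gc.
Qed.

(** If a relatively clopen set contained one end of a curve but not the other, a generic point of
    the curve in [H] would lie both in it and in its complement. *)
Lemma connected_linked H z : H z ->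
  (forall x, H x -> exists2 y, H y & linked H x y /\ linked H y z) -> connected H.
Proof.
move=> Hz lH B [b0 Bb0] [C oC BC] [D cD BD].
have step x y : H y -> linked H x y -> B x -> B y.
  move=> Hy [c [a [b [pc ca cb cH]]]] Bx; apply: contrapT => nBy.
  have Cx : C x by move: Bx; rewrite BC => -[].
  have nDy : (~` D) y by move=> Dy; apply: nBy; rewrite BD.
  have c1 := linked_open pc ca oC Cx.
  have c2 := linked_open pc cb (closed_openC cD) nDy.
  have [s [[g Hg gs] [h1 h2]]] := cofin_ex (cofinI cH (cofinI c1 c2)).
  have : B g by rewrite BC; split=> //; exact: h1.
  by rewrite BD => -[_]; exact: h2.
have HB x : B x -> H x by rewrite BC => -[].
apply/seteqP; split=> // x Hx.
have [y Hy [l1 l2]] := lH x Hx; have [y0 Hy0 [l3 l4]] := lH b0 (HB _ Bb0).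
have Bz : B z by apply: (step y0) => //; exact: step l3 _.
by apply: (step y) (linked_sym l1) _ => //; apply: (step z) (linked_sym l2) Bz.
Qed.

Variable h : 'I_n -> nat.
Hypothesis hinj : injective h.

(* Conjugation by [diag (s ^ h i)] contracts a triangular matrix to its diagonal. *)
Lemma htri_connected (L : set GL) : is_subgroup L -> torus `<=` L ->
  connected (L `&` [set g | htri h (glmx g)]).
Proof.
move=> sL TL.
have LT t : torus t -> (L `&` [set g | htri h (glmx g)]) t.
  move=> Tt; split; first exact: TL.
  move=> i j hij; have /is_diag_mxP := Tt; apply.
  by apply: contraTneq hij => /ord_inj ->; rewrite ltnn.
apply: (@connected_linked _ 1%g).
  by split; [exact: subgroup1|exact: htri1].
move=> x [Lx hx].
have x0 i : glmx x i i != 0.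
  by have := glmxP x; rewrite (htri_unitE hinj hx) => /forallP.
exists (diag_gl (fun i => glmx x i i)); first exact/LT/diag_gl_torus.
split.
  exists (fun s => \matrix_(i, j) (glmx x i j * s ^+ (h j - h i))), 1, 0; split.
  - move=> i j; under eq_fun do rewrite mxE.
    apply: (fa_mul (pfun_alg K)); first exact: (fa_cst (pfun_alg K)).
    exact: (fa_exp (pfun_alg K) _ (pfun_id K)).
  - by apply/matrixP => i j; rewrite !mxE expr1n mulr1.
  - rewrite diag_glE //; apply/matrixP => i j; rewrite !mxE expr0n subn_eq0.
    case: eqP => [->|/eqP ne]; first by rewrite leqnn mulr1 mulr1n.
    rewrite mulr0n; have [le|lt] := leqP (h j) (h i); last by rewrite mulr0.
    rewrite hx ?mul0r // ltn_neqAle le andbT.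
    by apply: contraNneq ne => /hinj ->.
  apply: cofin_sub (cofin_neq 0) => s s0.
  have t0 i : s ^+ h i != 0 by rewrite expf_neq0.
  pose l : GL := diag_gl (fun i => s ^+ h i).
  have Tl : torus l by exact: diag_gl_torus.
  have E i j : glmx (l^-1 * x * l)%g i j = glmx x i j * s ^+ (h j - h i).
    rewrite diag_glV // diag_gl_mulr // diag_gl_mull => [|k]; last by rewrite invr_eq0.
    have [le|lt] := leqP (h i) (h j); last by rewrite hx // !(mulr0, mul0r).
    rewrite -{1}(subnK le) exprD; move: (t0 i).
    by move: (s ^+ h i) (s ^+ (h j - h i)) => a b a0; field.
  exists (l^-1 * x * l)%g; last by apply/matrixP => i j; rewrite E mxE.
  split.
    by do ?[apply: subgroupM => //]; [apply: subgroupV => //|]; exact: TL.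
  by move=> i j hij; rewrite E hx ?mul0r.
exists (fun s => diag_mx (\row_i (1 + s * (glmx x i i - 1)))), 1, 0; split.
- move=> i j; under eq_fun do rewrite mxE mxE; case: (i == j).
    under eq_fun do rewrite mulr1n; apply: (fa_add (pfun_alg K)); first exact: (fa_cst (pfun_alg K)).
    apply: (fa_mul (pfun_alg K)); first exact: pfun_id.
    exact: (fa_cst (pfun_alg K)).
  by under eq_fun do rewrite mulr0n; exact: (fa_cst (pfun_alg K)).
- rewrite diag_glE //; apply/matrixP => i j; rewrite !mxE mul1r addrC subrK //.
- by apply/matrixP => i j; rewrite !mxE mul0r addr0.
have cf : cofin (fun s => forall i, 1 + s * (glmx x i i - 1) != 0).
  apply: cofin_all => i; apply: (@pfun_cofin _ (fun s => 1 + s * (glmx x i i - 1)) 0).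
    apply: (fa_add (pfun_alg K)); first exact: (fa_cst (pfun_alg K)).
    apply: (fa_mul (pfun_alg K)); first exact: pfun_id.
    exact: (fa_cst (pfun_alg K)).
  by rewrite mul0r addr0 oner_neq0.
apply: cofin_sub cf => s sP; exists (diag_gl (fun i => 1 + s * (glmx x i i - 1))).
  exact/LT/diag_gl_torus.
by rewrite diag_glE.
Qed.
End Connected.

Section BorelElem.
Variables (K : closedFieldType) (n : nat).
Local Notation GL := (GL K n).

Lemma borel_root_group (L BL : set GL) (i0 j0 : 'I_n) : i0 != j0 ->
  is_subgroup L -> closed L -> is_borel_subgroup L BL -> torus `<=` BL ->
  (forall a, L (elem_gl i0 j0 a)) -> (forall a, L (elem_gl j0 i0 a)) ->
  (forall a, BL (elem_gl i0 j0 a)) \/ (forall a, BL (elem_gl j0 i0 a)).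
Proof.
move=> ij sL cL [[[sB clB cnB] BsubL solB] Bmax] TB Lij Lji.
have ji : j0 != i0 by rewrite eq_sym.
have TL : torus `<=` L by move=> t /TB/BsubL.
have [h [hinj hB]] := borel_potential sB cnB solB TB.
pose H' : set GL := L `&` [set g | htri h (glmx g)].
have sT : is_subgroup [set g : GL | htri h (glmx g)].
  split=> [|x y hx hy]; first exact: htri1.
  by apply: htri_mul => //; exact: htri_GLV.
have sH' : is_subgroup H'.
  split=> [|x y [Lx hx] [Ly hy]]; first by split; exact: subgroup1.
  by split; [exact: (proj2 sL)|exact: (proj2 sT)].
have clT : closed [set g : GL | htri h (glmx g)].
  have -> : [set g : GL | htri h (glmx g)] =
     [set g | forall p : 'I_n * 'I_n, (if (h p.2 < h p.1)%N then glmx g p.1 p.2 else 0) = 0].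
    apply/seteqP; split=> g /= H; first by move=> [i j] /=; case: ifP => // /H.
    by move=> i j lt; have := H (i, j); rewrite /= lt.
  apply: (@closed_gl_eq0 _ _ _ (fun p (g : GL) => if (h p.2 < h p.1)%N then glmx g p.1 p.2 else 0)).
  move=> [i j] /=; case: (_ < _)%N; first exact: gl_poly_entry.
  exact: (fa_cst (@gl_poly_alg K n)).
have csH' : conn_solvable L H'.
  split; first split=> //; first exact: closedI.
  - exact: htri_connected.
  - by move=> g [].
  - by apply: (htri_solvable hinj sH') => g [].
have BE : H' = BL.
  by apply: Bmax => // g Bg; split; [exact: BsubL|exact: hB].
have tri i j a : i != j -> (h i < h j)%N -> htri h (glmx (elem_gl i j a)).
  move=> ne lt k l hlk; rewrite elem_glE // !mxE.
  case: eqP => [kl|_]; first by rewrite kl ltnn in hlk.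
  case: eqP => [ki|_]; case: eqP => [lj|_]; rewrite /= ?mulr0 ?addr0 //.
  by rewrite ki lj ltnNge ltnW in hlk.
rewrite -BE; have [lt|lt|/hinj e] := ltngtP (h i0) (h j0).
- by left=> a; split=> //; exact: tri.
- by right=> a; split=> //; exact: tri.
- by rewrite e eqxx in ij.
Qed.
End BorelElem.

(** * Torus invariants *)

Lemma digits_inj (N k : nat) (f g : 'I_k -> nat) :
  (forall i, f i < N)%N -> (forall i, g i < N)%N ->
  (\sum_i f i * N ^ i = \sum_i g i * N ^ i)%N -> f =1 g.
Proof.
elim: k f g => [|k IH] f g fN gN; first by move=> _ [].
have E (h : 'I_k.+1 -> nat) :
    (\sum_i h i * N ^ i = h ord0 + N * \sum_(i < k) h (lift ord0 i) * N ^ i)%N.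
  rewrite big_ord_recl expn0 muln1; congr (_ + _)%N; rewrite big_distrr /=.
  by apply: eq_bigr => i _; rewrite expnS mulnCA.
rewrite !E => e.
have e0 : f ord0 = g ord0.
  have := congr1 (modn^~ N) e; rewrite /= ![(_ + N * _)%N]addnC ![(N * _)%N]mulnC !modnMDl.
  by rewrite !modn_small.
have N0 : (0 < N)%N by exact: leq_ltn_trans (fN ord0).
move: e; rewrite e0 => /addnI/eqP; rewrite eqn_pmul2l // => /eqP e i.
have [j ->|->] := unliftP ord0 i; last exact: e0.
by apply: (IH (fun j => f (lift ord0 j)) (fun j => g (lift ord0 j))).
Qed.

(* Kronecker substitution [x_i := s ^ (N ^ i)] *)
Lemma mpoly_vanish (K : closedFieldType) m (p : mpoly m K) :
  (forall v, (forall i, v i != 0) -> meval v p = 0) -> p = 0.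
Proof.
move=> p0; pose N := msize p; pose e (a : multinom m) := (\sum_i a i * N ^ i)%N.
pose q : {poly K} := \sum_(a <- msupp p) mcoeff a p *: 'X^(e a).
have qs s : s != 0 -> q.[s] = 0.
  move=> s0; rewrite -(p0 (fun i : 'I_m => s ^+ (N ^ i))) => [|i]; last by rewrite expf_neq0.
  rewrite mevalE horner_sum; apply: eq_bigr => a _; rewrite hornerZ hornerXn; congr (_ * _).
  rewrite /e -prodrXr; apply: eq_bigr => i _.
  by rewrite mulnC exprM.
have q0 : q = 0.
  apply: contrapT => /eqP/poly_cofin cq.
  have [s [/qs -> /eqP]] := cofin_ex (cofinI (cofin_neq 0) cq).
  by [].
apply/mpolyP => a; rewrite mcoeff0.
have [asupp|/memN_msupp_eq0 //] := boolP (a \in msupp p).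
have small (b : multinom m) : b \in msupp p -> forall i, (b i < N)%N.
  move=> bs i; apply: leq_ltn_trans (msize_mdeg_lt bs).
  by rewrite mdegE (bigD1 i) //= leq_addr.
have := congr1 (fun r : {poly K} => r`_(e a)) q0; rewrite coef0 coef_sum.
rewrite (bigD1_seq a) ?msupp_uniq //= coefZ coefXn eqxx mulr1 big1_seq ?addr0 //.
move=> b /andP[ba bs]; rewrite coefZ coefXn; case: eqP => [eab|_]; last by rewrite mulr0.
case/eqP: ba; apply/mnmP; apply: fsym; apply: (@digits_inj N) => //; [exact: small|exact: small].
Qed.

Section RatFun.
Variables (K : fieldType) (n : nat).
Local Notation GL := (GL K n).
Local Notation Fl := (Fl K n).

Lemma flag_ratfun (Y : set Fl) (P Q : GL -> K) g0 :
  gl_poly P -> gl_poly Q -> same_weight P Q -> Y (flag_of g0) -> Q g0 != 0 ->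
  exists f : ratfun flag_regular Y,
    (forall g, Defs.dom f (flag_of g) <-> Q g != 0) /\
    (forall g, ratval f (flag_of g) = P g / Q g).
Proof.
move=> pP pQ PQ Yg0 Qg0.
pose D : set Fl := @flag_of K n @` [set g | Q g != 0].
have DE g : D (flag_of g) <-> Q g != 0.
  split=> [[h Qh /flag_of_eq[b ub ->]]|Qg]; last by exists g.
  by have [chi chi0 [_ ->]] := PQ h b ub; rewrite mulf_neq0.
have oD : open D.
  rewrite openE => _ [g Qg <-]; apply: nbhs_flag_of; exact: near_gl_neq0.
have D0 : Y `&` D !=set0 by exists (flag_of g0); split=> //; apply/DE.
have Dreg x : Y x -> D x -> regular_at flag_regular Y x (flag_quot P Q).
  move=> Yx [g Qg gx]; exists (flag_quot P Q); last by near=> y.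
  by rewrite -gx; exact: flag_quot_regular.
exists (RatFun oD D0 Dreg); split=> g //=.
exact: flag_quotE.
Unshelve. all: by end_near.
Qed.

Variable w : 'S_n.

Definition cell_mx (k : 'I_n -> 'I_n -> K) : 'M[K]_n :=
  \matrix_(i, j) if i == j then 1 else if (j < i)%N && (w i < w j)%N then k i j else 0.

Lemma cell_mx_inv k (i j : 'I_n) : (j < i)%N -> (w i < w j)%N -> cell_mx k i j = k i j.
Proof. by move=> ji wij; rewrite mxE ji wij -val_eqE /= gtn_eqF. Qed.

Lemma cell_mx_diag k i : cell_mx k i i = 1.
Proof. by rewrite mxE eqxx. Qed.

Definition cell_pt k : GL := toGL (perm_mxK K w *m cell_mx k).

Lemma cell_mx_lower k : lower_unip (cell_mx k).
Proof. by move=> i j ij; rewrite mxE; case: eqP => // _; rewrite ltnNge ij. Qed.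

Lemma cell_ptE k : glmx (cell_pt k) = perm_mxK K w *m cell_mx k.
Proof.
rewrite toGLE // unitmx_mul; apply/andP; split; first exact: (glmxP (weyl K w)).
exact/lower_unip_unit/cell_mx_lower.
Qed.

Lemma cell_pt_schubert k : schubert K w (flag_of (cell_pt k)).
Proof.
have -> : cell_pt k = ((cell_pt k * (weyl K w)^-1) * weyl K w)%g by rewrite mulgKV.
apply: schubert_cell; apply/upper_borelE => i j ji.
rewrite -(permKV w i) -(permKV w j) in ji *.
move: ((w^-1)%g i) ((w^-1)%g j) ji => {}i {}j ji.
rewrite glmxM glmxV invmx_perm_mxK cell_ptE mxE (bigD1 j) //= big1 ?addr0.
  rewrite perm_mxKE mxE; case: eqP => [e|_]; first by rewrite e ltnn in ji.
  by rewrite [(w i < w j)%N]ltnNge (ltnW ji) /= andbF mul0r.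
move=> l lj; rewrite [X in _ * X]mxE [X in _ * X]mxE (inj_eq perm_inj) eq_sym (negbTE lj) mulr0 //.
Qed.

Lemma cell_minor k (b a : 'I_n) : (a <= b)%N ->
  minor w b a (glmx (cell_pt k)) = cell_mx k b a.
Proof. by move=> ab; rewrite cell_ptE minor_unip //; exact: cell_mx_lower. Qed.

Lemma same_weight_minor v b b' a : same_weight (fun g => minor v b a (glmx g))
   (fun g : GL => minor v b' a (glmx g)).
Proof.
move=> g c /upper_borelE uc; exists (top_det a (glmx c)).
  by rewrite top_det_neq0 ?glmxP.
by rewrite !glmxM !minor_rmul // ![_ * top_det _ _]mulrC.
Qed.

Lemma same_weightM P Q P' Q' : same_weight P Q -> same_weight P' Q' ->
  same_weight (fun g => P g * P' g) (fun g : GL => Q g * Q' g).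
Proof.
move=> PQ PQ' g b ub; have [x x0 [-> ->]] := PQ g b ub; have [y y0 [-> ->]] := PQ' g b ub.
by exists (x * y); [rewrite mulf_neq0|split; rewrite mulrACA].
Qed.
End RatFun.

Section Invariants.
Variables (K : closedFieldType) (n : nat) (w : 'S_n).
Local Notation GL := (GL K n).
Local Notation Fl := (Fl K n).

(** The coordinate of the open cell on an edge [(a, b)] is the rational function
    [minor w b a / minor w a a]. These coordinates take arbitrary values, hence are independent. *)
Lemma dim_ge_inversions d :
  dim_is flag_regular (schubert K w) d -> (#|inversions w| <= d)%N.
Proof.
move=> [_ dmax].
pose e (i : 'I_#|inversions w|) := enum_val i.
have eP i : ((e i).1 < (e i).2)%N && (w (e i).2 < w (e i).1)%N.
  by have := enum_valP i; rewrite inE.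
have ex i : exists f : ratfun flag_regular (schubert K w), forall k,
    Defs.dom f (flag_of (cell_pt w k)) /\ ratval f (flag_of (cell_pt w k)) = k (e i).2 (e i).1.
  have /andP[h1 h2] := eP i.
  have Q1 (k : 'I_n -> 'I_n -> K) : minor w (e i).1 (e i).1 (glmx (cell_pt w k)) = 1.
    by rewrite cell_minor // mxE eqxx.
  have Q0 : minor w (e i).1 (e i).1 (glmx (cell_pt w (fun _ _ => 1 : K))) != 0.
    by rewrite Q1 oner_neq0.
  have [f [fd fv]] := flag_ratfun (@minor_poly K n w (e i).2 (e i).1)
     (@minor_poly K n w (e i).1 (e i).1) (@same_weight_minor K n w _ _ _)
     (@cell_pt_schubert K n w (fun _ _ => 1)) Q0.
  exists f => k; split; first by apply/fd; rewrite Q1 oner_neq0.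
  by rewrite fv Q1 divr1 cell_minor ?(ltnW h1) // cell_mx_inv.
have [f fP] := choice ex.
apply: (dmax _ f) => // p p0; apply: mpoly_vanish => v v0.
pose k i j := if [pick l | e l == (j, i)] is Some l then v l else 1.
have kE l : k (e l).2 (e l).1 = v l.
  rewrite /k; case: pickP => [l' /eqP el|/(_ l)]; last by rewrite -surjective_pairing eqxx.
  by congr v; apply: enum_val_inj; rewrite -/(e l') el -surjective_pairing.
have := p0 _ (@cell_pt_schubert K n w k) (fun i => proj1 (fP i k)).
by rewrite (meval_eq (v2 := v)) // => l; rewrite (proj2 (fP l k)) kE.
Qed.

Definition in_cyc (q : 'I_n * 'I_n * 'I_n * 'I_n) (x y : 'I_n) :=
  let: (a, b, c, d) := q in
  [&& (x == a) || (x == b), (y == c) || (y == d) & (x < y)%N].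
Definition is_cyc (q : 'I_n * 'I_n * 'I_n * 'I_n) :=
  let: (a, b, c, d) := q in cyc w a b c d.

(** A cycle is determined by its edges: if those of [q] all belonged to [q'], the vertices would
    agree. *)
Lemma cyc_edge q q' : is_cyc q -> is_cyc q' -> q != q' ->
  exists x y, in_cyc q x y /\ ~~ in_cyc q' x y.
Proof.
case: q => [[[a b] c] d]; case: q' => [[[a' b'] c'] d'] /=; rewrite /cyc => h h'.
apply: contraPP => no.
have sub x y : in_cyc (a, b, c, d) x y -> in_cyc (a', b', c', d') x y.
  by move=> xy; apply: contrapT => /negP nxy; apply: no; exists x, y.
have := sub a c; have := sub a d; have := sub b d.
rewrite /in_cyc !eqxx ?orbT /= -!val_eqE /= => h1 h2 h3.
have ea : a = a' by apply: ord_inj; lia.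
have eb : b = b' by apply: ord_inj; lia.
have ec : c = c' by apply: ord_inj; lia.
have ed : d = d' by apply: ord_inj; lia.
by rewrite ea eb ec ed eqxx.
Qed.

(** The alternating product of the coordinates around the cycle, in which the torus weights cancel.
    A triangle has no side from [b] to [c], whence the factor 1. *)
Definition cyc_val q (k : 'I_n -> 'I_n -> K) : K :=
  let: (a, b, c, d) := q in k c a * k d b / (k d a * (if b == c then 1 else k c b)).

(** Each edge occurs in the monomial with exponent 1 or -1; when the other coordinates are 1, its
    coordinate must be [al] or the inverse of [al]. *)
Lemma cyc_solve q x y (al : K) : is_cyc q -> in_cyc q x y -> al != 0 ->
  exists2 k0, k0 != 0 & forall k, k y x = k0 ->
    (forall x' y', in_cyc q x' y' -> (x', y') != (x, y) -> k y' x' = 1) ->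
    cyc_val q k = al.
Proof.
case: q => [[[a b] c] d] /=; rewrite /cyc => h /and3P[hx hy xy] al0.
have nab : a == b = false by rewrite -val_eqE /=; lia.
have ncd : c == d = false by rewrite -val_eqE /=; lia.
have cE : (b == c) = ~~ (b < c)%N by rewrite -val_eqE /=; lia.
have lac : (a < c)%N by lia.
have lad : (a < d)%N by lia.
have lbd : (b < d)%N by lia.
have K1 k x' y' : (forall x' y', [&& (x' == a) || (x' == b), (y' == c) || (y' == d) & (x' < y')%N] ->
    (x', y') != (x, y) -> k y' x' = 1 :> K) -> (x' == a) || (x' == b) -> (y' == c) || (y' == d) ->
    (x' < y')%N -> ((x' == x) && (y' == y)) = false -> k y' x' = 1.
  by move=> H h1 h2 h3 h4; apply: H; [rewrite h1 h2|rewrite xpair_eqE h4].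
move: hx hy => /orP[] /eqP ex /orP[] /eqP ey; rewrite {x}ex {y}ey in xy K1 *.
- exists al => // k kE /K1 H; rewrite kE (H b d) ?(H a d) ?eqxx ?orbT //= ?ncd ?[d == c]eq_sym ?ncd ?andbF //.
  by case: ifP => bc; rewrite ?(H b c) ?eqxx ?orbT ?[b == a]eq_sym ?nab // ?mulr1 ?invr1 ?mulr1 //; move: bc; rewrite cE => /negbFE.
- exists al^-1; first by rewrite invr_eq0.
  move=> k kE /K1 H; rewrite kE (H a c) ?(H b d) ?eqxx ?orbT //= ?ncd ?[b == a]eq_sym ?nab ?andbF //.
  by case: ifP => bc; rewrite ?(H b c) ?eqxx ?orbT ?[b == a]eq_sym ?nab // ?mulr1 ?mul1r ?invrK //; move: bc; rewrite cE => /negbFE.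
- have bc : b == c = false by rewrite cE xy.
  exists al^-1; first by rewrite invr_eq0.
  by move=> k kE /K1 H; rewrite bc kE (H a c) ?(H b d) ?(H a d) ?eqxx ?orbT //= ?ncd ?[d == c]eq_sym ?ncd ?nab ?andbF // !mul1r invrK.
- exists al => // k kE /K1 H; rewrite kE (H a c) ?(H a d) ?eqxx ?orbT //= ?nab ?andbF //.
  by case: ifP => bc; rewrite ?(H b c) ?eqxx ?orbT ?ncd ?andbF // ?mul1r ?mulr1 ?invr1 ?mulr1 //; move: bc; rewrite cE => /negbFE.
Qed.

(** In terms of minors, numerator and denominator involve the same columns and the same added rows
    [w c], [w d], so the torus multiplies both by the same factor. *)
Lemma cyc_invariant q : is_cyc q ->
  exists f : ratfun flag_regular (schubert K w), invariant_ratfun flag_regular flag_act torus (schubert K w) f /\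
    forall k, (forall i j, k i j != 0) -> Defs.dom f (flag_of (cell_pt w k)) /\
      ratval f (flag_of (cell_pt w k)) = cyc_val q k.
Proof.
case: q => [[[a b] c] d] /= h; have h' := h; rewrite /cyc in h.
pose P (g : GL) := minor w c a (glmx g) * minor w d b (glmx g).
pose Q (g : GL) := minor w d a (glmx g) * minor w c b (glmx g).
have pP : gl_poly P by apply: (fa_mul (@gl_poly_alg K n)); exact: minor_poly.
have pQ : gl_poly Q by apply: (fa_mul (@gl_poly_alg K n)); exact: minor_poly.
have PQ : same_weight P Q by apply: same_weightM; exact: same_weight_minor.
have valP k : P (cell_pt w k) = k c a * k d b.
  by rewrite /P !cell_minor ?cell_mx_inv //; lia.
have valQ k : Q (cell_pt w k) = k d a * (if b == c then 1 else k c b).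
  rewrite /Q !cell_minor ?(cell_mx_inv _ (i := d)); try lia; congr (_ * _).
  have [->|bc] := eqVneq b c; first exact: cell_mx_diag.
  by rewrite cell_mx_inv //; move: bc; rewrite -val_eqE /=; lia.
have Q0 k : (forall i j, k i j != 0) -> Q (cell_pt w k) != 0.
  by move=> k0; rewrite valQ mulf_neq0 //; case: ifP => // _; exact: oner_neq0.
have [f [fd fv]] := flag_ratfun pP pQ PQ (@cell_pt_schubert K n w (fun _ _ => 1))
   (Q0 (fun _ _ => 1) (fun _ _ => oner_neq0 _)).
exists f; split; last by move=> k k0; rewrite fd fv valP valQ; split=> //; rewrite -valQ; exact: Q0.
move=> t x Tt; elim/flag_ofW: x => g _ _ _; rewrite flag_actE !fv.
have [t' t0 tE] := torus_diag_gl Tt.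
have tg i j : glmx (t * g)%g i j = t' i * glmx g i j by rewrite tE diag_gl_mull.
rewrite /P /Q !(minor_lmul _ _ _ tg).
set x := \prod_(i < a) _; set y := \prod_(i < b) _.
have x0 : x != 0 by apply/prodf_neq0.
have y0 : y != 0 by apply/prodf_neq0.
set m1 := minor _ _ _ _; set m2 := minor _ _ _ _; set m3 := minor _ _ _ _; set m4 := minor _ _ _ _.
have z0 : x * t' (w c) * (y * t' (w d)) != 0 by rewrite !mulf_neq0.
transitivity ((x * t' (w c) * (y * t' (w d)) * (m1 * m2)) /
              (x * t' (w c) * (y * t' (w d)) * (m3 * m4))).
  by congr (_ / _); ring.
by rewrite -mulf_div divff // mul1r.
Qed.

(** Each of two cycles has an edge outside the other. The coordinates on these two edges adjust the
    two invariants independently to any nonzero values, so the invariants are algebraically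
    independent. *)
Lemma complexity1_uniq_cyc :
  complexity_is flag_regular flag_act torus (schubert K w) 1 -> uniq_cyc w.
Proof.
move=> [_ cmax] a b c d a' b' c' d' h h'.
have [[-> -> -> ->]//|ne] := eqVneq (a, b, c, d) (a', b', c', d'); exfalso.
have hq : is_cyc (a, b, c, d) by [].
have hq' : is_cyc (a', b', c', d') by [].
move: hq hq' ne; move: (a, b, c, d) (a', b', c', d') => q q' hq hq' ne {a b c d h a' b' c' d' h'}.
have [f [fI fV]] := cyc_invariant hq; have [f' [fI' fV']] := cyc_invariant hq'.
have [x [y [xy nxy]]] := cyc_edge hq hq' ne.
have [x' [y' [xy' nxy']]] := cyc_edge hq' hq ltac:(by rewrite eq_sym).
pose F (i : 'I_2) := if i == ord0 then f else f'.
suff : (2 <= 1)%N by [].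
apply: (cmax 2%N F) => [i|p p0]; first by rewrite /F; case: ifP.
apply: mpoly_vanish => v v0.
have [k0 k00 kP] := cyc_solve hq xy (v0 ord0).
have [k1 k10 kP'] := cyc_solve hq' xy' (v0 (lift ord0 ord0)).
pose k (j i : 'I_n) := if (i, j) == (x, y) then k0 else if (i, j) == (x', y') then k1 else 1.
have kn0 i j : k i j != 0 by rewrite /k; do 2?case: ifP; rewrite ?oner_neq0.
have e1 : cyc_val q k = v ord0.
  apply: kP => [|i j ij ne']; first by rewrite /k eqxx.
  rewrite /k (negbTE ne') ifF //; apply/negbTE; apply: contraNneq nxy' => -[<- <-].
  exact: ij.
have e2 : cyc_val q' k = v (lift ord0 ord0).
  have ne1 i j : in_cyc q' i j -> (i, j) != (x, y).
    by move=> ij; apply: contraNneq nxy => -[<- <-].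
  apply: kP' => [|i j ij ne']; first by rewrite /k (negbTE (ne1 _ _ xy')) eqxx.
  by rewrite /k (negbTE (ne1 _ _ ij)) (negbTE ne').
have := p0 _ (@cell_pt_schubert K n w k).
rewrite (meval_eq (v2 := v)) => [->//|i].
  by move=> i; rewrite /F; case: ifP => _; [have [] := fV k kn0|have [] := fV' k kn0].
have [i0|ni0] := eqVneq i ord0.
  by rewrite /F i0 eqxx; have [_ ->] := fV k kn0.
rewrite /F (negbTE ni0); have [_ ->] := fV' k kn0; rewrite e2; congr v.
by apply: ord_inj; case: i ni0 => [[|[|]]].
Qed.
End Invariants.

(** * Smoothness *)

Section Cotangent.
Variables (K : fieldType) (X : topologicalType) (reg : X -> set (X -> K)).
Hypothesis reg_alg : forall x, fun_alg (reg x).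
Variables (Y : set X) (x : X).

Lemma regular_at_alg : fun_alg (regular_at reg Y x).
Proof.
split=> [a|f g [F rF fF] [G rG gG]|f g [F rF fF] [G rG gG]].
- by exists (fun=> a); [exact: fa_cst|near=> y].
- exists (fun y => F y + G y); first exact: fa_add.
  near=> y => Yy; have -> : f y = F y by move: Yy; near: y.
  by have -> : g y = G y by move: Yy; near: y.
- exists (fun y => F y * G y); first exact: fa_mul.
  near=> y => Yy; have -> : f y = F y by move: Yy; near: y.
  by have -> : g y = G y by move: Yy; near: y.
Unshelve. all: by end_near.
Qed.

Lemma max_ideal2_0 : max_ideal2 reg Y x (fun=> 0).
Proof.
exists 0%N, (fun _ _ => 0), (fun _ _ => 0); split=> [[]//|[]//|].
by near=> y => _; rewrite big_ord0.
Unshelve. all: by end_near.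
Qed.

Lemma max_ideal2_add f g : max_ideal2 reg Y x f -> max_ideal2 reg Y x g ->
  max_ideal2 reg Y x (fun y => f y + g y).
Proof.
move=> [r [a [b [ha hb fE]]]] [r' [a' [b' [ha' hb' gE]]]].
pose join (p : 'I_r -> X -> K) (p' : 'I_r' -> X -> K) (i : 'I_(r + r')) :=
  match fintype.split i with inl j => p j | inr j => p' j end.
exists (r + r')%N, (join a a'), (join b b'); split.
- by move=> i; rewrite /join; case: fintype.split => j.
- by move=> i; rewrite /join; case: fintype.split => j.
- near=> y => Yy.
  have -> : f y = \sum_(j < r) a j y * b j y by move: Yy; near: y.
  have -> : g y = \sum_(j < r') a' j y * b' j y by move: Yy; near: y.
  rewrite big_split_ord /=; congr (_ + _); apply: eq_bigr => i _; rewrite /join.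
    by rewrite -[lshift _ _]/(unsplit (inl i)) unsplitK.
  by rewrite -[rshift _ _]/(unsplit (inr i)) unsplitK.
Unshelve. all: by end_near.
Qed.

Lemma max_ideal2_scale c f : max_ideal2 reg Y x f -> max_ideal2 reg Y x (fun y => c * f y).
Proof.
move=> [r [a [b [ha hb fE]]]]; exists r, (fun i y => c * a i y), b; split=> //.
  move=> j; have [raj aj0] := ha j; split; last by rewrite aj0 mulr0.
  by apply: (fa_mul regular_at_alg) => //; exact: (fa_cst regular_at_alg).
near=> y => Yy.
have -> : f y = \sum_(j < r) a j y * b j y by move: Yy; near: y.
by rewrite mulr_sumr; apply: eq_bigr => i _; rewrite mulrA.
Unshelve. all: by end_near.
Qed.

Lemma max_ideal2_sum m (f : 'I_m -> X -> K) (c : 'I_m -> K) :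
  (forall i, max_ideal2 reg Y x (f i)) ->
  max_ideal2 reg Y x (fun y => \sum_i c i * f i y).
Proof.
elim: m f c => [|m IH] f c hf.
  by under eq_fun do rewrite big_ord0; exact: max_ideal2_0.
under eq_fun do rewrite big_ord_recl; apply: max_ideal2_add.
  exact: max_ideal2_scale.
exact: (IH (fun i => f (lift ord0 i)) (fun i => c (lift ord0 i))).
Qed.

(** If [m < e], the coefficient matrix of a basis has a nonzero row vector in its kernel, which
    gives the zero function a second expansion. *)
Lemma cotangent_dim_le e m (s : 'I_m -> X -> K) :
  cotangent_dim_is reg Y x e ->
  (forall f, max_ideal reg Y x f -> exists c : 'rV[K]_m,
      max_ideal2 reg Y x (fun y => f y - \sum_(k < m) c 0 k * s k y)) ->
  (e <= m)%N.
Proof.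
move=> [t tm tP] span; rewrite leqNgt; apply/negP => lt.
have [a aP] := choice (fun i => span (t i) (tm i)).
pose A : 'M[K]_(e, m) := \matrix_(i, k) a i 0 k.
have [c cA c0] : exists2 c : 'rV[K]_e, c *m A = 0 & c != 0.
  have : kermx A != 0.
    rewrite -mxrank_eq0 mxrank_ker subn_eq0 -ltnNge.
    exact: leq_ltn_trans (rank_leq_col A) lt.
  by move=> /rowV0Pn[c /sub_kermxP cA c0]; exists c.
have m0 : max_ideal reg Y x (fun=> 0) by split=> //; exact: (fa_cst regular_at_alg).
have [c' [_ uniq]] := tP _ m0.
have e1 : c' = 0.
  apply: uniq; rewrite (_ : (fun y => _) = fun=> 0); first exact: max_ideal2_0.
  by apply/funext => y; rewrite big1 ?subr0 // => i _; rewrite mxE mul0r.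
have e2 : c' = - c.
  apply: uniq.
  rewrite (_ : (fun y => _) = fun y => \sum_i c 0 i * (t i y - \sum_(k < m) a i 0 k * s k y)).
    exact: max_ideal2_sum.
  apply/funext => y; rewrite sub0r -sumrN; under [RHS]eq_bigr do rewrite mulrBr.
  rewrite sumrB [X in _ - X](_ : _ = 0) ?subr0.
    by apply: eq_bigr => i _; rewrite mxE mulNr opprK.
  under eq_bigr do rewrite mulr_sumr.
  rewrite exchange_big big1 // => k _.
  transitivity ((c *m A) 0 k * s k y); last by rewrite cA mxE mul0r.
  rewrite mxE mulr_suml; apply: eq_bigr => i _.
  by rewrite mxE mulrA.
by move: c0; rewrite -oppr_eq0 -e2 e1 eqxx.
Qed.
End Cotangent.

(** The expansion passes to products by [F G - F0 G0 = (F - F0) G + F0 (G - G0)]. *)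
Lemma hadamard (K : fieldType) m (P : mpoly m K) (v0 : 'I_m -> K) :
  exists A : 'I_m -> mpoly m K, forall v,
    meval v P = meval v0 P + \sum_k (v k - v0 k) * meval v (A k).
Proof.
pose C (F : ('I_m -> K) -> K) := (exists P, forall v, F v = meval v P) /\
  (exists A : 'I_m -> mpoly m K, forall v, F v = F v0 + \sum_k (v k - v0 k) * meval v (A k)).
have CA : fun_alg C.
  split=> [a|F G [[P1 F1] [A FA]] [[P2 G1] [B GB]]|F G [[P1 F1] [A FA]] [[P2 G1] [B GB]]].
  - split; first by exists (mpolyC m a) => v; rewrite mevalC.
    by exists (fun=> 0) => v; rewrite big1 ?addr0 // => k _; rewrite meval0 mulr0.
  - split; first by exists (P1 + P2) => v; rewrite mevalD F1 G1.
    exists (fun k => A k + B k) => v; rewrite {1}FA {1}GB addrACA -big_split /=.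
    by congr (_ + _); apply: eq_bigr => k _; rewrite mevalD mulrDr.
  - split; first by exists (P1 * P2) => v; rewrite mevalM F1 G1.
    exists (fun k => A k * P2 + mpolyC m (F v0) * B k) => v.
    set S1 := \sum_k (v k - v0 k) * meval v (A k).
    set S2 := \sum_k (v k - v0 k) * meval v (B k).
    have -> : \sum_k (v k - v0 k) * meval v (A k * P2 + mpolyC m (F v0) * B k) =
        S1 * G v + F v0 * S2.
      rewrite mulr_suml mulr_sumr -big_split; apply: eq_bigr => k _.
      by rewrite mevalD !mevalM mevalC -G1 /=; ring.
    by rewrite {1}FA GB -/S1 -/S2; ring.
suff [_ H] : C (fun v => meval v P) by [].
apply: (fa_meval CA) => i; split; first by exists (mpolyX K (mnm1 i)) => v; rewrite mevalXU.
exists (fun k => if k == i then 1 else 0) => v.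
rewrite (bigD1 i) //= eqxx meval1 mulr1 big1 ?addr0 => [|k /negbTE ->]; last by rewrite meval0 mulr0.
by rewrite addrC subrK.
Qed.

(** * Charts of a Schubert variety *)

Section Smooth.
Variables (K : fieldType) (n : nat) (w : 'S_n).
Local Notation GL := (GL K n).
Local Notation Fl := (Fl K n).
Local Notation m := #|tangent_pairs w|.

Let e (k : 'I_m) := enum_val k.
Let Z : set GL := [set u | lower_unip (glmx u) /\ schubert K w (flag_of u)].
Let tau (u : GL) (k : 'I_m) := glmx u (e k).2 (e k).1.
Let C (F : GL -> K) := exists p, forall u, Z u -> F u = meval (tau u) p.

Let C_alg : fun_alg C.
Proof.
split=> [a|f g [p pf] [q qg]|f g [p pf] [q qg]].
- by exists (mpolyC _ a) => u Zu; rewrite mevalC.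
- by exists (p + q) => u Zu; rewrite mevalD pf ?qg.
- by exists (p * q) => u Zu; rewrite mevalM pf ?qg.
Qed.

Let C_eq F G : (forall u, Z u -> F u = G u) -> C F -> C G.
Proof. by move=> FG [p pF]; exists p => u Zu; rewrite -FG ?pF. Qed.

(* By induction on [j - i], together with the entries of the inverse: each pair that is not in
   [tangent_pairs w] gives the vanishing of an entry of [u] or of its inverse. *)
Lemma chart_coords i j : C (fun u => glmx u j i).
Proof.
suff : forall d (i j : 'I_n), (j - i <= d)%N ->
  C (fun u => glmx u j i) /\ C (fun u => invmx (glmx u) j i).
  by move=> H; have [] := H _ i j (leqnn _).
elim=> [|d IH] {}i {}j.
  rewrite leqn0 subn_eq0 => ji; split.
    apply: (@C_eq (fun=> (j == i)%:R)); last exact: (fa_cst C_alg).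
    by move=> u [lu _]; rewrite lu.
  apply: (@C_eq (fun=> (j == i)%:R)); last exact: (fa_cst C_alg).
  by move=> u [lu _]; rewrite (lower_unip_inv lu).
move=> jid; have [le|lt] := leqP (j - i) d; first exact: IH.
have ij : (i < j)%N by lia.
pose R (u : GL) := \sum_(l : 'I_n | (i < l < j)%N) glmx u j l * invmx (glmx u) l i.
have CR : C R.
  apply: (fa_sum C_alg) => l /andP[il lj]; apply: (fa_mul C_alg).
    by have [|] := IH l j; first lia.
  by have [|] := IH i l; first lia.
(* The entry [(j, i)] of [u] times its inverse. Only the two extreme terms have gap [j - i]; the
   products in [R] have smaller gaps and are known by induction. *)
have id u : Z u -> glmx u j i + R u + invmx (glmx u) j i = 0.
  move=> [lu _]; have := congr1 (fun B : 'M[K]_n => B j i) (mulmxV (glmxP u)).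
  have ji : (j == i) = false by rewrite -val_eqE /= gtn_eqF.
  rewrite !mxE ji => E; apply: etrans _ E.
  have lV := lower_unip_inv lu.
  rewrite (bigD1 i) //= (bigD1 j) ?ji //= (lV i i (leqnn _)) eqxx mulr1 (lu j j (leqnn _)) eqxx mul1r.
  rewrite -addrA [R u + _]addrC; congr (_ + (_ + _)).
  rewrite /R [RHS](bigID (fun l : 'I_n => (i < l < j)%N)) /= [X in _ + X]big1 ?addr0.
    apply: eq_bigl => l; case: (boolP (i < l < j)%N) => [/andP[h1 h2]|]; rewrite ?andbF ?andbT //.
    by rewrite -!val_eqE /= gtn_eqF // ltn_eqF.
  move=> l /andP[/andP[li lj]]; rewrite negb_and -!leqNgt => /orP[h|h].
    by rewrite lV // (negbTE li) mulr0.
  by rewrite lu // eq_sym (negbTE lj) mul0r.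
have Cij : C (fun u => glmx u j i).
  have [tp|] := boolP ((i, j) \in tangent_pairs w).
    exists (mpolyX K (mnm1 (enum_rank_in tp (i, j)))) => u Zu.
    by rewrite mevalXU /tau /e enum_rankK_in.
  rewrite inE /= ij /= negb_and !negb_exists => /orP[/forallP H|/forallP H].
    apply: (@C_eq (fun=> 0)); last exact: (fa_cst C_alg).
    move=> u [_ Xu]; rewrite (schubert_entry0 Xu) // => a ai.
    by have := H a; rewrite ai /= -ltnNge.
  apply: (@C_eq (fun u => - R u)); last exact: (fa_opp C_alg).
  move=> u Zu; have := id u Zu; have [_ Xu] := Zu.
  rewrite (schubert_inv0 Xu) => [/eqP|a ja].
    by rewrite addr0 addr_eq0 => /eqP ->.
  by have := H a; rewrite ja /= -ltnNge.
split=> //; apply: (@C_eq (fun u => - (glmx u j i + R u))).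
  by move=> u Zu; have /eqP := id u Zu; rewrite addr_eq0 => /eqP ->; rewrite opprK.
by apply: (fa_opp C_alg); apply: (fa_add C_alg).
Qed.

Section Chart.
Variables (a : GL) (u0 : GL).
Hypotheses (ua : upper_borel a) (lu0 : lower_unip (glmx u0)).
Let g1 : GL := (a^-1 * u0)%g.
Let x := flag_of g1.
Hypothesis Xx : schubert K w x.

(** Quotients of these minors are the entries of the unipotent factor of [a * g]. They define a
    section [S] of the projection over the translate by [a^-1] of the opposite big cell, and [O]
    marks the flags where it is a section. *)
Let P (j i : 'I_n) (g : GL) := minor 1%g j i (glmx (a * g)%g).
Let coord (j i : 'I_n) : Fl -> K := flag_quot (P j i) (P i i).
Let U (y : Fl) : 'M[K]_n := \matrix_(j, i) if (i < j)%N then coord j i y else (j == i)%:R.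
Let S (y : Fl) : GL := (a^-1 * toGL (U y))%g.
Let O (y : Fl) := flag_of (S y) = y.

Let pP j i : gl_poly (P j i).
Proof. exact: (gl_poly_lmul _ (@minor_poly K n _ _ _)). Qed.

Let wP j i : same_weight (P j i) (P i i).
Proof.
move=> g b ub; have [c c0 e1] := @same_weight_minor K n 1%g j i i (a * g)%g b ub.
by exists c => //; rewrite /P !mulgA.
Qed.

Let coordE (u b : GL) (j i : 'I_n) : lower_unip (glmx u) -> upper_borel b -> (i <= j)%N ->
  coord j i (flag_of (a^-1 * u * b)%g) = glmx u j i.
Proof.
move=> lu ub ij; rewrite flag_of_mulB // /coord flag_quotE // /P mulKVg.
by rewrite !minor1_unip // [glmx u i i]lu // eqxx divr1.
Qed.

Let U_lower y : lower_unip (U y).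
Proof. by move=> j i ji; rewrite mxE ltnNge ji. Qed.

Let UE (u b : GL) : lower_unip (glmx u) -> upper_borel b ->
  toGL (U (flag_of (a^-1 * u * b)%g)) = u.
Proof.
move=> lu ub; apply/glmx_inj; rewrite toGLE; last exact: lower_unip_unit.
apply/matrixP => j i; rewrite mxE; case: ltnP => ij; last by rewrite lu.
by rewrite coordE // ltnW.
Qed.

Let Sx : S x = g1.
Proof.
rewrite /S; congr (_ * _)%g; rewrite /x /g1 -[(a^-1 * u0)%g]mulg1.
by apply: UE => //; exact: upper_borel1.
Qed.

Let near_O : \forall y \near x, O y.
Proof.
apply/near_flag_of.
have H : \forall h \near g1, \prod_i P i i h != 0.
  apply: near_gl_neq0; first by apply: (fa_prod (@gl_poly_alg K n)).
  apply/prodf_neq0 => i _; rewrite /P mulKVg minor1_unip // lu0 // eqxx.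
  exact: oner_neq0.
apply: filterS H => h /prodf_neq0 Ph.
have [b [ub b_unit] lub] := lu_of_minors (glmxP (a * h)%g) (fun i => Ph i isT).
pose b' := MkGL b_unit; have ub' : upper_borel b' by apply/upper_borelE.
have hE : h = (a^-1 * (a * h * b') * b'^-1)%g by rewrite !mulgA mulVg mul1g mulgK.
rewrite /O /S {1}hE UE //; last exact: upper_borelV.
by rewrite [in RHS]hE [RHS]flag_of_mulB //; exact: upper_borelV.
Qed.

Let coord_regular j i : flag_regular x (coord j i).
Proof.
apply: flag_quot_regular => //.
by rewrite /P mulKVg minor1_unip // lu0 // eqxx oner_neq0.
Qed.

Let U_regular j i : flag_regular x (fun y => U y j i).
Proof.
under eq_fun do rewrite mxE; case: (_ < _)%N; first exact: coord_regular.
exact: (fa_cst (@flag_regular_alg K n x)).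
Qed.

Let S_regular j i : flag_regular x (fun y => glmx (S y) j i).
Proof.
apply: (fa_mulmx (@flag_regular_alg K n x)) => k l.
  exact: (fa_cst (@flag_regular_alg K n x)).
under eq_fun do rewrite toGLE ?lower_unip_unit //.
exact: U_regular.
Qed.

Let S_poly_regular f : gl_poly f -> flag_regular x (fun y => f (S y)).
Proof.
move=> [p pf]; under eq_fun do rewrite pf /gl_eval.
apply: (fa_meval (@flag_regular_alg K n x)) => k; case/mxvec_indexP: k => i j.
by under eq_fun do rewrite mxvecE; exact: S_regular.
Qed.

Let UZ y : schubert K w y -> O y -> Z (toGL (U y)).
Proof.
move=> Xy Oy; split; first by rewrite toGLE ?lower_unip_unit.
have -> : flag_of (toGL (U y)) = flag_act a y.
  by rewrite -[in RHS]Oy flag_actE /S mulKVg.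
exact: borel_stable.
Qed.

(* [hadamard] at the point [t x] writes the numerator of a regular function vanishing at [x] as a
   combination of the [s k], with coefficients that are constant modulo the maximal ideal. *)
Lemma cotangent_le_chart d :
  cotangent_dim_is flag_regular (schubert K w) x d -> (d <= m)%N.
Proof.
pose t y := tau (toGL (U y)).
have Ox : O x by rewrite /O Sx.
have t_reg k : flag_regular x (fun y => t y k).
  rewrite /t /tau; under eq_fun do rewrite toGLE ?lower_unip_unit //.
  exact: U_regular.
have polyC f : gl_poly f -> exists p : mpoly m K, forall y, schubert K w y -> O y ->
    f (S y) = meval (t y) p.
  move=> pf; have [p pE] : C (fun u => f (a^-1 * u)%g).
    have [q qE] := gl_poly_lmul a^-1%g pf.
    apply: (@C_eq (fun u => gl_eval q u)) => [u _|]; first by rewrite -qE.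
    apply: (fa_meval C_alg) => k; case/mxvec_indexP: k => i j.
    by under eq_fun do rewrite mxvecE; exact: chart_coords.
  by exists p => y Xy Oy; rewrite -pE //; exact: UZ.
pose s k y := t y k - t x k.
have regA := @flag_regular_alg K n x.
have s_reg k : flag_regular x (s k).
  by apply: (fa_sub regA) => //; exact: (fa_cst regA).
have toY f : flag_regular x f -> regular_at flag_regular (schubert K w) x f.
  by move=> rf; exists f => //; near=> y.
have mp_reg p : flag_regular x (fun y => meval (t y) p).
  exact: (fa_meval regA).
move=> cd; apply: (cotangent_dim_le (@flag_regular_alg K n) cd (s := s)).
move=> f [[F rF fF] fx].
have [p [q /nbhs_glP[f0 pf0 [f0g pqE]]]] := flag_regular_gl rF.
have [P0 P0E] := polyC _ (ex_intro _ p (fun g => erefl (gl_eval p g))).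
have [Q0 Q0E] := polyC _ (ex_intro _ q (fun g => erefl (gl_eval q g))).
have Q0x : meval (t x) Q0 != 0 by rewrite -Q0E // Sx; have [] := pqE _ f0g.
have FE : \forall y \near x, schubert K w y -> F y = meval (t y) P0 / meval (t y) Q0.
  have f0S : \forall y \near x, f0 (S y) != 0.
    by apply: flag_regular_neq0; [exact: S_poly_regular|rewrite Sx].
  near=> y => Xy.
  have Oy : O y by near: y; exact: near_O.
  have fy : f0 (S y) != 0 by near: y; exact: f0S.
  by have [_ /= e1] := pqE _ fy; rewrite -P0E // -Q0E // -e1 Oy.
have P0x : meval (t x) P0 = 0.
  apply/eqP; have := nbhs_singleton fF Xx; rewrite fx (nbhs_singleton FE Xx) => /esym/eqP.
  by rewrite mulf_eq0 invr_eq0 (negbTE Q0x) orbF.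
have [A AE] := hadamard P0 (t x).
pose c k := meval (t x) (A k) / meval (t x) Q0.
exists (\row_k c k), m, s, (fun k y => meval (t y) (A k) / meval (t y) Q0 - c k); split.
- by move=> k; split; [exact: toY|rewrite /s subrr].
- move=> k; split; last by rewrite subrr.
  apply: toY; apply: (fa_sub regA); last exact: (fa_cst regA).
  by apply: (fa_mul regA) => //; exact: (flag_regular_inv (mp_reg Q0)).
near=> y => Xy.
have -> : f y = F y by move: Xy; near: y.
have -> : F y = meval (t y) P0 / meval (t y) Q0 by move: Xy; near: y.
rewrite AE P0x add0r mulr_suml -sumrB; apply: eq_bigr => k _.
by rewrite mxE /s; ring.
Unshelve. all: by end_near.
Qed.
End Chart.

Lemma cotangent_le x d : schubert K w x ->
  cotangent_dim_is flag_regular (schubert K w) x d -> (d <= m)%N.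
Proof.
elim/flag_ofW: x => g Xg cd.
have [a [b [u [[ua a_unit] [ub b_unit] lu aE]]]] := big_cell_translate (glmxP g).
pose a' := MkGL a_unit; pose b' := MkGL b_unit; pose u' := MkGL (lower_unip_unit lu).
have ua' : upper_borel a' by apply/upper_borelE.
have ub' : upper_borel b' by apply/upper_borelE.
have gE : flag_of g = flag_of (a'^-1 * u')%g.
  have -> : u' = (a' * g * b')%g by apply: glmx_inj; rewrite /= aE.
  by rewrite -mulgA mulKg flag_of_mulB.
rewrite gE in Xg cd; exact: (cotangent_le_chart ua' _ Xg cd).
Qed.
End Smooth.

Lemma not_singular (K : closedFieldType) n (w : 'S_n) : uniq_cyc w ->
  (forall a b c d, cyc w a b c d -> b = c :> nat) ->
  ~ singular flag_regular (schubert K w).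
Proof.
move=> wu wK [x [d [e [Xx dimd cote lt]]]].
have := leq_trans (cotangent_le Xx cote) (card_tangent_pairs wu wK).
by move=> /leq_trans/(_ (dim_ge_inversions dimd)); rewrite leqNgt lt.
Qed.

End FlagVariety.

Local Open Scope classical_set_scope.
Local Open Scope complex_scope.

Theorem lemma4p1 (R : realType) (n : nat) (w : 'S_n)
    (L B_L : set (GL R[i] n)) :
  is_levi_subgroup (stabilizer flag_act (schubert R[i] w)) L ->
  torus `<=` L ->
  is_borel_subgroup L B_L ->
  torus `<=` B_L ->
  singular flag_regular (schubert R[i] w) ->
  complexity_is flag_regular flag_act torus (schubert R[i] w) 1 ->
  complexity_is flag_regular flag_act B_L (schubert R[i] w) 0 /\
  finitely_many_orbits flag_act B_L (schubert R[i] w).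
Proof.
move=> levi TL borel TB sing cT.
have uq := @complexity1_uniq_cyc R[i] n w cT.
have [[a [b [c [d [abcd bc]]]]]|noK] :=
    pselect (exists a b c d, cyc w a b c d /\ (b < c)%N); last first.
  exfalso; apply: (@not_singular R[i] n w uq _ sing) => a b c d abcd.
  apply/eqP; rewrite eqn_leq; have /and5P[_ -> _ _ _] := abcd; rewrite leqNgt.
  by apply/negP => bc; apply: noK; exists a, b, c, d.
have [x01 wB] := K22_boundsP uq abcd bc.
have ad : (a < d)%N by move: abcd; rewrite /cyc => /and4P[ab _ cd _]; exact: ltn_trans (ltn_trans ab bc) cd.
have wdesc : ((w^-1)%g (w a) < (w^-1)%g (w d))%N by rewrite !permK.
have ne : w d != w a by rewrite -val_eqE /= x01 neq_ltn ltnSn.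
have ne' : w a != w d by rewrite eq_sym.
have [sL clL _ _] := levi.
have up k : stabilizer flag_act (schubert R[i] w) (elem_gl (w d) (w a) k).
  by apply: borel_stabilizer; apply: elem_upper; rewrite x01.
have dn k : stabilizer flag_act (schubert R[i] w) (elem_gl (w a) (w d) k).
  exact: elem_stabilizer.
have Lup k := levi_root_group k ne levi TL up dn.
have Ldn k := levi_root_group k ne' levi TL dn up.
have Bel := borel_root_group ne sL clL borel TB Lup Ldn.
have [[[sB _ _] _ _] _] := borel.
have fin := orbits_finite x01 wB wdesc sB TB Bel.
split=> //; apply: finitely_many_orbits_complexity0 => //.
- by exists (flag_of (1 * weyl R[i] w)%g); apply: schubert_cell; exact: upper_borel1.
- exact: flag_act1.
Qed.
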